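(* Let $k_1\neq k_2$ in $\{1,\dots,K\}$, $1\le l_1\le L_{k_1}$ and $1\le l_2\le L_{k_2}$. Then $$\frac{T_{(k_1,l_1),(k_2,l_2)}(\nu)}{\mathbb{E}\,T_{(k_1,l_1),(k_2,l_2)}(\nu)}\;\longrightarrow\; Z\quad\text{in distribution as }\nu\to\infty,$$ where $Z$ has the distribution of $\alpha Y+(1-\alpha)W$, with $Y$ an exponential random variable with unit mean and $W$ a random variable independent of $Y$ with Laplace transform $$\mathbb{E}(e^{-sW})=\frac{1}{1+\sum_{k\in\mathcal{A}}\frac{\gamma_k s}{1+\gamma_k s/\beta_k}+s\,\gamma_{\mathcal{S}}}.$$
   Context: Let $K, L_1,\dots,L_K$ be positive integers and let $f_1,\dots,f_K:\mathbb{R}_+\to\mathbb{R}_+$ be monotone functions with $\lim_{\nu\to\infty} f_k(\nu)=\infty$ for every $k$. Put $\mathcal{B}_k=\{(k,l):1\le l\le L_k\}$ and $\Omega=\{0\}\cup\bigcup_{k=1}^K\mathcal{B}_k$. For each $\nu$, $\{X(t)\}_{t\ge 0}$ is the continuous-time Markov process on $\Omega$ with transition rates $q(0,(k,1))=L_k f_k(\nu)$, $q((k,1),0)=1$, $q((k,l),(k,l+1))=(L_k-l)f_k(\nu)$ for $1\le l\le L_k-1$, $q((k,l),(k,l-1))=l$ for $2\le l\le L_k$ (for $k=1,\dots,K$), all other off-diagonal rates being $0$. For states $a,b\in\Omega$, the transition time is $T_{a,b}(\nu)=\inf\{t>0: X(t)=b\}$ for the process started at $X(0)=a$. For fixed $k_1\ne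 k_2$, the following limits are assumed to exist: - for $k\ne k_2$, $\gamma_k=\lim_{\nu\to\infty}\frac{f_k(\nu)^{L_k}}{\sum_{j\ne k_2} f_j(\nu)^{L_j}}\in[0,1]$; put $K_*=\{k\ne k_2:\gamma_k>0\}$; - for $k\in K_*$, $\beta_k=\lim_{\nu\to\infty}\frac{L_k f_k(\nu)}{L_{k_2}f_{k_2}(\nu)}\in[0,\infty]$; - $\alpha=\lim_{\nu\to\infty}\frac{\mathbb{E}\,T_{(k_1,l_1),0}(\nu)}{\mathbb{E}\,T_{(k_1,l_1),(k_2,l_2)}(\nu)}\in[0,1]$. Put $\mathcal{A}=\{k\in K_*:0<\beta_k<\infty\}$, $\mathcal{S}=\{k\in K_*:\beta_k=\infty\}$ and $\gamma_{\mathcal{S}}=\sum_{k\in\mathcal{S}}\gamma_k$ (empty sums are $0$). *)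

(* Defs.v *)
From HB Require Import structures.
From mathcomp Require Export all_boot all_order all_algebra.
From mathcomp Require Export all_classical all_reals all_analysis.
Export Order.TTheory GRing.Theory Num.Theory.
Export numFieldNormedType.Exports.

Set Implicit Arguments.
Unset Strict Implicit.
Unset Printing Implicit Defensive.

Global Open Scope classical_set_scope.
Global Open Scope ring_scope.

Section MarkovProcess.
Context {R : realType} {S : finType}.

Record transition_function (p : R -> S -> S -> R) : Prop := {
  tf0 : forall i j, p 0 i j = (i == j)%:R ;
  tf_ge0 : forall t i j, 0 <= t -> 0 <= p t i j ;
  tf_sum1 : forall t i, 0 <= t -> \sum_j p t i j = 1 ;
  tf_Chapman_Kolmogorov : forall s t i j, 0 <= s -> 0 <= t ->
    p (s + t) i j = \sum_k p s i k * p t k j }.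

(* The diagonal values of [q] are ignored. *)
Definition generator (q : S -> S -> R) (i j : S) : R :=
  if i == j then - \sum_(k | k != i) q i k else q i j.

Definition has_rates (p : R -> S -> S -> R) (q : S -> S -> R) : Prop :=
  forall i j, (p h i j - (i == j)%:R) / h @[h --> 0^'+] --> generator q i j.

(* The time index of [X] ranges over R; only X t with 0 <= t is constrained. *)
Record markov_process d (T : measurableType d) (P : probability T R)
    (X : R -> T -> S) (q : S -> S -> R) : Prop := {
  mp_measurable : forall t i, 0 <= t -> measurable [set w | X t w = i] ;
  mp_right_continuous : forall w t, 0 <= t ->
    \forall s \near t^'+, X s w = X t w ;
  mp_markov : exists p : R -> S -> S -> R,
    [/\ transition_function p, has_rates p q &
      forall (t : nat -> R) (x : nat -> S) (n : nat),
        0 <= t 0%N -> {homo t : i j / (i <= j)%N >-> i <= j} ->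
        P [set w | forall m, (m <= n.+1)%N -> X (t m) w = x m] =
        (P [set w | forall m, (m <= n)%N -> X (t m) w = x m] *
         (p (t n.+1 - t n) (x n) (x n.+1))%:E)%E] }.

(* Equal to +oo on the paths that never visit [b]. *)
Definition hitting_time T (X : R -> T -> S) (b : S) (w : T) : \bar R :=
  ereal_inf [set t%:E | t in [set t : R | 0 < t /\ X t w = b]].

End MarkovProcess.

Section Probability.
Context {R : realType}.

Definition independent_RV d (T : measurableType d) (P : probability T R)
    (Y W : {RV P >-> R}) : Prop :=
  forall A B : set R, measurable A -> measurable B ->
    P (Y @^-1` A `&` W @^-1` B) = (P (Y @^-1` A) * P (W @^-1` B))%E.

Definition has_law d (T : measurableType d) (P : probability T R)
    (Y : {RV P >-> R}) (mu : set R -> \bar R) : Prop :=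
  forall A : set R, measurable A -> distribution P Y A = mu A.

(* The variables V nu may take the value +oo and live on different spaces. *)
Definition cvg_in_distribution
    (d : R -> measure_display) (T : forall nu, measurableType (d nu))
    (P : forall nu, probability (T nu) R) (V : forall nu, T nu -> \bar R)
    d' (T' : measurableType d') (P' : probability T' R) (Z : {RV P' >-> R}) :
    Prop :=
  forall x : R, {for x, continuous (cdf Z)} ->
    P nu [set w | (V nu w <= x%:E)%E] @[nu --> +oo] --> cdf Z x.

End Probability.

Section Model.
Context {R : realType} {K : nat} (L : 'I_K -> nat).

(* None is the state 0; Some (k, l), with l < L k, is the state (k, l + 1):
   branches are numbered from 0 to K - 1, and positions in them from 0. *)
Definition state : finType := option {k : 'I_K & 'I_(L k)}.

Definition at_branch (k : 'I_K) (l : 'I_(L k)) : state :=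
  Some (Tagged (fun k => 'I_(L k)) l).

(* F k is the value f_k(nu). *)
Definition rate (F : 'I_K -> R) (a b : state) : R :=
  match a, b with
  | None, None => 0
  | None, Some (existT k l) => if l == 0%N :> nat then (L k)%:R * F k else 0
  | Some (existT k l), None => if l == 0%N :> nat then 1 else 0
  | Some (existT k l), Some (existT k' l') =>
      if k != k' then 0
      else if l' == l.+1 :> nat then (L k - l.+1)%N%:R * F k
      else if l == l'.+1 :> nat then l.+1%:R
      else 0
  end.

End Model.

Section Limits.
Context {R : realType} {K : nat}.
Variables (k2 : 'I_K) (gamma : 'I_K -> R) (beta : 'I_K -> \bar R).

Definition Kstar : {set 'I_K} := [set k | (k != k2) && (0 < gamma k)]%SET.

Definition Aset : {set 'I_K} :=
  [set k in Kstar | (0 < beta k)%E && (beta k < +oo)%E]%SET.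

Definition Sset : {set 'I_K} := [set k in Kstar | beta k == +oo%E]%SET.

Definition gammaS : R := \sum_(k in Sset) gamma k.

Definition laplace_W (s : R) : R :=
  1 / (1 + \sum_(k in Aset) gamma k * s / (1 + gamma k * s / fine (beta k))
         + s * gammaS).

End Limits.

(* Main.v *)
(** The Laplace transform [E_i (exp (- s T_b))], as a function of the starting
    state [i], is the solution [g] of [Q g = s g] off [b] with [g b = 1]; this
    is read off a telescoping sum along the dyadic skeletons of the process.
    On a branch the chain is an Ehrenfest urn with reversible weights
    [binomial(L, l) f^l], so that summing the equations of [g] from the tip of
    the branch gives the flux of [g] across each edge.  Since [f] is large, [g]
    is almost constant on a branch away from the centre, and the drop
    [x = g(0) - g(k,1)] satisfies [x ~ s m (g(0) - x)], where
    [m = ((1+f)^L - 1) / (L f)] is the mean return time to 0.  This sandwiches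
    both the transforms and, as [s] tends to 0, the expectations between
    explicit expressions with the same limit, and gives
    [1 / (1 + alpha s) * laplace_W ((1 - alpha) s)] for the normalized time.
    The law of [W] exists because [c / (c + psi)] remains a Laplace transform
    for all [c > 0] when compound Poisson jumps with exponential sizes are
    added to a linear exponent [psi].  Convergence of Laplace transforms
    implies convergence in distribution by testing with the polynomials
    [1 - (1 - y^n)^N] in [y = exp (- V)]. *)

(* All estimates at fixed [nu] are inequalities in [s > 0] that hold as soon as every [f k nu] is at
   least 1. They serve twice: with [s] tending to 0 they give the expectations, including their
   finiteness, without any recurrence or uniform integrability argument; with [s = t / e nu] and
   growing [nu] they give the limit law. The form of [laplace_W] reflects the excursions made before
   the target branch is entered. The initial stay in branch [k1] is nearly exponential and carries
   the share [alpha] of the mean. At the centre, branch [k] competes with [k2] at odds about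
   [beta k], and each stay in it is again nearly exponential. If [beta k] is positive and finite,
   the few stays remain visible as exponential jumps; if it is infinite, many short stays average
   out to a drift [s * gamma k]; if it is 0, the stays are too rare to appear in the limit law,
   although they keep their share [gamma k] of the mean escape time. The final walk along [k2] is
   negligible. *)
From HB Require Import structures.
Require Import Defs.
From mathcomp Require Import measurable_realfun ring lra zify.

Set Implicit Arguments.
Unset Strict Implicit.
Unset Printing Implicit Defensive.

(** * Convergence in distribution from Laplace transforms *)

Section bounded_functions.
Context {R : realType} {d} {T : measurableType d} (P : probability T R).
Implicit Types f g : T -> R.

Lemma integrable_bounded f (M : R) : measurable_fun setT f ->
  (forall w, `|f w| <= M) -> P.-integrable setT (EFin \o f).
Proof.
move=> mf fM; apply: measurable_bounded_integrable => //.
  by rewrite (le_lt_trans (probability_le1 P measurableT))// ltry.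
exists M; split; first exact: num_real.
by move=> N MN x _ /=; apply: (le_trans (fM x)); exact: ltW.
Qed.

Lemma integrable_itv01 f : measurable_fun setT f ->
  (forall w, 0 <= f w <= 1) -> P.-integrable setT (EFin \o f).
Proof.
move=> mf f01; apply: (@integrable_bounded _ 1) => // w.
by have /andP[f0 f1] := f01 w; rewrite ger0_norm.
Qed.

Lemma EFin_Rintegral f : P.-integrable setT (EFin \o f) ->
  (\int[P]_w (f w)%:E)%E = (\int[P]_w f w)%:E.
Proof. by move=> fi; rewrite /Rintegral fineK//; exact: integrable_fin_num. Qed.

Lemma Rintegral_cst1 (c : R) : \int[P]_w c = c.
Proof.
rewrite Rintegral_cst// [X in _ * fine X](_ : _ = 1%E) ?mulr1//.
exact: probability_setT.
Qed.

Lemma RintegralDcst f (c : R) : P.-integrable setT (EFin \o f) ->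
  \int[P]_w (f w + c) = \int[P]_w f w + c.
Proof.
move=> fi; rewrite RintegralD ?Rintegral_cst1//.
by apply: (@integrable_bounded _ `|c|).
Qed.

Lemma Rintegral_indic (A : set T) : measurable A ->
  \int[P]_w (\1_A w : R) = fine (P A).
Proof.
by move=> mA; rewrite /Rintegral integral_indic// setIT.
Qed.

Lemma integrable_indic (A : set T) : measurable A ->
  P.-integrable setT (EFin \o (\1_A : T -> R)).
Proof.
move=> mA; apply: integrable_itv01; first exact: measurable_indic.
by move=> w; rewrite indicE; case: (w \in A); rewrite /= ?ler01 lexx.
Qed.

Lemma measurable_exprn f n : measurable_fun setT f ->
  measurable_fun setT (fun w => f w ^+ n).
Proof. by move=> mf; apply: measurable_funX. Qed.

Lemma integrable_exprn f n : measurable_fun setT f ->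
  (forall w, 0 <= f w <= 1) -> P.-integrable setT (EFin \o (fun w => f w ^+ n)).
Proof.
move=> mf f01; apply: integrable_itv01; first exact: measurable_exprn.
by move=> w; have /andP[f0 f1] := f01 w; rewrite exprn_ge0// exprn_ile1.
Qed.

(** Both conclusions go through one induction, since additivity at the head needs integrability of
    the tail. *)
Lemma Rintegral_sum (I : Type) (s : seq I) (F : I -> T -> R) :
  (forall i, P.-integrable setT (EFin \o F i)) ->
  P.-integrable setT (EFin \o (fun w => \sum_(i <- s) F i w)) /\
  \int[P]_w \sum_(i <- s) F i w = \sum_(i <- s) \int[P]_w F i w.
Proof.
move=> Fi; elim: s => [|i s [IHi IH]].
  have -> : (fun w => \sum_(i <- [::]) F i w) = cst 0.
    by apply/funext => w; rewrite big_nil.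
  split; first by apply: integrable_itv01 => // w; rewrite lexx ler01.
  by rewrite big_nil Rintegral_cst// mul0r.
have -> : (fun w => \sum_(i <- i :: s) F i w) =
    (fun w => F i w + \sum_(i <- s) F i w).
  by apply/funext => w; rewrite big_cons.
split; last by rewrite RintegralD// IH big_cons.
by have := integrableD measurableT (Fi i) IHi.
Qed.

Lemma Rintegral_horner f (p : {poly R}) : measurable_fun setT f ->
  (forall w, 0 <= f w <= 1) ->
  \int[P]_w p.[f w] = \sum_(i < size p) p`_i * \int[P]_w f w ^+ i.
Proof.
move=> mf f01.
have -> : (fun w => p.[f w]) = (fun w => \sum_(i < size p) p`_i * f w ^+ i).
  by apply/funext => w; rewrite horner_coef.
rewrite (Rintegral_sum _ _).2.
  by apply: eq_bigr => i _; rewrite RintegralZl//; exact: integrable_exprn.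
move=> i; have := @integrableZl _ _ _ P setT measurableT p`_i _ (integrable_exprn i mf f01).
by [].
Qed.

Lemma measurable_horner f (p : {poly R}) : measurable_fun setT f ->
  measurable_fun setT (fun w => p.[f w]).
Proof.
move=> mf.
have -> : (fun w => p.[f w]) = (fun w => \sum_(i < size p) p`_i * f w ^+ i).
  by apply/funext => w; rewrite horner_coef.
apply: measurable_sum => i; apply: measurable_funM => //; exact: measurable_exprn.
Qed.

End bounded_functions.

(* [1 - (1 - y ^+ n) ^+ N], with [N] between [c2 ^- n] and [c1 ^- n], is a
   smooth step from 0 to 1 in the gap between [c1] and [c2]. *)
Lemma threshold_poly (R : realType) (c1 c2 e : R) :
  0 < c1 -> c1 < c2 -> 0 < e ->
  exists p : {poly R}, forall y, 0 <= y <= 1 ->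
    [/\ 0 <= p.[y] <= 1, (y <= c1 -> p.[y] <= e) &
        (c2 <= y -> 1 - e <= p.[y])].
Proof.
move=> c10 c12 e0; have c20 : 0 < c2 := lt_trans c10 c12.
pose r := c2 / c1; have r1 : 1 < r by rewrite ltr_pdivlMr// mul1r.
have bernoulli (t : R) n : -1 <= t -> 1 + n%:R * t <= (1 + t) ^+ n.
  move=> t1; elim: n => [|n IH]; first by rewrite mul0r addr0 expr0.
  rewrite exprS; apply: (@le_trans _ _ ((1 + t) * (1 + n%:R * t))).
    have := mulr_ge0 (ler0n R n) (sqr_ge0 t); rewrite -natr1 expr2; nra.
  by rewrite ler_wpM2l//; lra.
(* The ratio of [c2 ^+ n] to [c1 ^+ n] must be so large that some integer [N] has both
   [N * c1 ^+ n <= e] and [N * c2 ^+ n >= e^-1]. *)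
have [n nP] : exists n, (e^-1 + 1) / e <= r ^+ n.
  pose n := Num.truncn ((e^-1 + 1) / e / (r - 1)).
  exists n.+1; apply: le_trans (_ : 1 + n.+1%:R * (r - 1) <= _); last first.
    by have := @bernoulli (r - 1) n.+1; rewrite addrCA subrr addr0; apply; lra.
  have : (e^-1 + 1) / e / (r - 1) < n.+1%:R by exact: truncnS_gt.
  by rewrite ltr_pdivrMr ?subr_gt0// => h; lra.
have cn1 : 0 < c1 ^+ n.+1 by rewrite exprn_gt0.
have cn2 : 0 < c2 ^+ n.+1 by rewrite exprn_gt0.
(* The largest [N] allowed by the first requirement. Truncation loses less than 1, which is the
   [+ 1] in the choice of [n]; this uses [c2 <= 1], and for [c2 > 1] the last claim is vacuous. *)
pose N := (Num.truncn (e / c1 ^+ n.+1)).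
have [N1 N2] : N%:R * c1 ^+ n.+1 <= e /\ 
   (c2 <= 1 -> e^-1 <= N%:R * c2 ^+ n.+1).
  have /andP[h1 h2] : N%:R <= e / c1 ^+ n.+1 < N.+1%:R.
    by apply: Num.Theory.truncn_itv; rewrite divr_ge0 ?ltW.
  split; first by rewrite -ler_pdivlMr.
  move=> c2le1.
  have : (e^-1 + 1) / e <= r ^+ n.+1.
    by rewrite (le_trans nP)// ler_eXn2l.
  rewrite /r expr_div_n ler_pdivrMr// => h.
  have {}h2 : c2 ^+ n.+1 * (e / c1 ^+ n.+1) <= c2 ^+ n.+1 * N.+1%:R.
    by rewrite ler_wpM2l// ltW.
  have : c2 ^+ n.+1 <= 1 by rewrite exprn_ile1// ltW.
  move: h2; rewrite -natr1 => h2 h3.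
  have : e^-1 + 1 <= c2 ^+ n.+1 * (e / c1 ^+ n.+1).
    by apply: le_trans h _; rewrite mulrAC mulrA.
  lra.
exists (1 - (1 - 'X ^+ n.+1) ^+ N) => y /andP[y0 y1].
rewrite !hornerE.
set t := y ^+ n.+1; have t0 : 0 <= t by rewrite exprn_ge0.
have t1 : t <= 1 by rewrite exprn_ile1.
have q01 : 0 <= (1 - t) ^+ N <= 1.
  by rewrite exprn_ge0 ?subr_ge0//= exprn_ile1 ?subr_ge0// gerBl.
split; first lra.
- move=> yc1; have tc : t <= c1 ^+ n.+1 by rewrite lerXn2r ?nnegrE// ltW.
  have := @bernoulli (- t) N; rewrite lerN2 => /(_ t1).
  have : N%:R * t <= N%:R * c1 ^+ n.+1 by rewrite ler_wpM2l.
  lra.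
- move=> c2y; have tc : c2 ^+ n.+1 <= t by rewrite lerXn2r ?nnegrE// ltW.
  have c2le1 : c2 <= 1 := le_trans c2y y1.
  have {}N2 := N2 c2le1.
  have h1 : N%:R * c2 ^+ n.+1 <= N%:R * t by rewrite ler_wpM2l.
  have h2 : N%:R * t <= (1 + t) ^+ N.
    by apply: le_trans (bernoulli t N _); lra.
  (* Since [1 - t ^+ 2 <= 1], the small power is at most the inverse of [(1 + t) ^+ N], which
     Bernoulli's inequality bounds below by [e^-1]. *)
  have h3 : (1 - t) ^+ N * (1 + t) ^+ N <= 1.
    by rewrite -exprMn exprn_ile1//; nra.
  have h4 : e^-1 <= (1 + t) ^+ N by lra.
  suff : (1 - t) ^+ N <= e by lra.
  rewrite leNgt; apply/negP => h5.
  have : 1 < (1 - t) ^+ N * (1 + t) ^+ N; last by lra.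
  have ei : 0 < e^-1 by rewrite invr_gt0.
  apply: lt_le_trans (_ : (1 - t) ^+ N * e^-1 <= _).
    by rewrite -ltr_pdivrMr// invrK mul1r.
  by rewrite ler_wpM2l//; lra.
Qed.

Section exp_neg.
Context {R : realType}.

(** The value 0 at [+oo] lets paths that never reach the target contribute nothing to the transform;
    it is also the default at [-oo]. *)
Definition exp_neg (t : \bar R) : R := if t is r%:E then expR (- r) else 0.

Lemma exp_neg_itv01 t : (0 <= t)%E -> 0 <= exp_neg t <= 1.
Proof.
case: t => [r| |] //=; rewrite ?lexx ?ler01// lee_fin => r0.
by rewrite expR_ge0 -expR0 ler_expR oppr_le0.
Qed.

Lemma measurable_exp_neg d (T : measurableType d) (V : T -> \bar R) :
  measurable_fun setT V -> measurable_fun setT (exp_neg \o V).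
Proof.
move=> mV.
have -> : exp_neg \o V =
    (fun w => expR (- fine (V w)) * \1_[set w | V w \is a fin_num] w).
  apply/funext => w /=; rewrite indicE.
  case E : (V w) => [r| |] /=; last 2 first.
  - by rewrite memNset ?mulr0//= E.
  - by rewrite memNset ?mulr0//= E.
  by rewrite mem_set ?mulr1//= E.
apply: measurable_funM.
  apply: (measurableT_comp (f := @expR R)); first exact: measurable_expR.
  by apply: measurable_funN; apply: (measurableT_comp (f := @fine R)).
apply: measurable_indic.
by have := emeasurable_fin_num measurableT mV; rewrite setTI.
Qed.

Lemma le_exp_neg x t : (0 <= t)%E -> (expR (- x) <= exp_neg t) = (t <= x%:E)%E.
Proof.
case: t => [r| |] //=; first by rewrite ler_expR lerN2 lee_fin.
by move=> _; rewrite leNgt expR_gt0.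
Qed.

End exp_neg.

Lemma cvg_big_sum (R : realType) (U : Type) (F : set_system U) (I : Type)
    (s : seq I) (Q : pred I) (f : I -> U -> R) (l : I -> R) : Filter F ->
  (forall i, Q i -> f i x @[x --> F] --> l i) ->
  \sum_(i <- s | Q i) f i x @[x --> F] --> \sum_(i <- s | Q i) l i.
Proof.
move=> FF fl; elim: s => [|i s IH].
  rewrite big_nil; under eq_fun do rewrite big_nil; exact: cvg_cst.
rewrite big_cons; under eq_fun do rewrite big_cons.
by case: ifPn => // Qi; apply: cvgD => //; exact: fl.
Qed.

Lemma cvg_Rintegral_horner (R : realType) (d : R -> measure_display)
    (T : forall nu, measurableType (d nu))
    (P : forall nu, probability (T nu) R) (y : forall nu, T nu -> R)
    d' (T' : measurableType d') (P' : probability T' R) (z : T' -> R) :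
    (forall nu, 0 <= nu -> measurable_fun setT (y nu)) ->
    (forall nu w, 0 <= y nu w <= 1) ->
    measurable_fun setT z -> (forall w, 0 <= z w <= 1) ->
    (forall m, \int[P nu]_w y nu w ^+ m @[nu --> +oo] -->
      \int[P']_w z w ^+ m) ->
  forall p : {poly R}, \int[P nu]_w p.[y nu w] @[nu --> +oo] -->
    \int[P']_w p.[z w].
Proof.
move=> my y01 mz z01 yz p; rewrite Rintegral_horner//.
have h : (\sum_(i < size p) p`_i * \int[P nu]_w y nu w ^+ i)
    @[nu --> +oo] --> \sum_(i < size p) p`_i * \int[P']_w z w ^+ i.
  apply: cvg_big_sum => i _; apply: cvgM; [exact: cvg_cst | exact: yz].
apply: cvg_trans h; apply: near_eq_cvg.
near=> nu; rewrite Rintegral_horner//; apply: my.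
by near: nu; exact: nbhs_pinfty_ge.
Unshelve. all: by end_near. Qed.

(** * Convergence of the moments of [exp (- V)] implies convergence in distribution *)

Section continuity_theorem.
Context {R : realType} (d : R -> measure_display)
  (T : forall nu, measurableType (d nu)) (P : forall nu, probability (T nu) R)
  (V : forall nu, T nu -> \bar R)
  d' (T' : measurableType d') (P' : probability T' R) (Z : T' -> R).
Arguments V : clear implicits.
Hypothesis mV : forall nu, 0 <= nu -> measurable_fun setT (V nu).
Hypothesis V_ge0 : forall nu w, (0 <= V nu w)%E.
Arguments V_ge0 : clear implicits.
Hypothesis mZ : measurable_fun setT Z.
Hypothesis Z_ge0 : forall w, 0 <= Z w.
Hypothesis cvg_moments : forall m,
  \int[P nu]_w exp_neg (V nu w) ^+ m @[nu --> +oo] -->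
  \int[P']_w expR (- Z w) ^+ m.

Let y nu w := exp_neg (V nu w).
Arguments y : clear implicits.
Let z w := expR (- Z w).

Let my nu : 0 <= nu -> measurable_fun setT (y nu).
Proof. by move=> nu0; apply: measurable_exp_neg; exact: mV. Qed.

Let y01 nu w : 0 <= y nu w <= 1. Proof. exact: exp_neg_itv01. Qed.

Let mz : measurable_fun setT z.
Proof.
apply: (measurableT_comp (f := @expR R)); first exact: measurable_expR.
exact: measurable_funN.
Qed.

Let z01 w : 0 <= z w <= 1.
Proof. by rewrite /z expR_ge0 -expR0 ler_expR oppr_le0 Z_ge0. Qed.

Let mVx nu x : 0 <= nu -> measurable [set w | (V nu w <= x%:E)%E].
Proof.
move=> nu0; have := emeasurable_fun_infty_c measurableT (mV nu0) x%:E.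
by rewrite setTI.
Qed.

Let mZx x : measurable [set w | Z w <= x].
Proof.
rewrite (_ : [set w | _] = Z @^-1` `]-oo, x]%classic).
  by rewrite -[X in measurable X]setTI; exact: mZ.
by apply/seteqP; split => w /=; rewrite in_itv.
Qed.

Let G x := fine (P' [set w | Z w <= x]).
Let F nu x := fine (P nu [set w | (V nu w <= x%:E)%E]).

Let G_ge0 x : 0 <= G x. Proof. exact: fine_ge0. Qed.
Let F_ge0 nu x : 0 <= F nu x. Proof. exact: fine_ge0. Qed.

Let cvg_poly p : \int[P nu]_w p.[y nu w] @[nu --> +oo] --> \int[P']_w p.[z w].
Proof. exact: (@cvg_Rintegral_horner R d T P y _ _ P' z my y01 mz z01 cvg_moments p). Qed.

(** A polynomial stepping from 0 to 1 between [expR (- x')] and [expR (- x)] has an integral that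
    dominates [F nu x] and is dominated by [G x'], each up to [e / 3]; the last third pays for the
    convergence of the integrals. *)
Lemma limit_cdf_upper x x' e : x < x' -> 0 < e ->
  \forall nu \near +oo, F nu x <= G x' + e.
Proof.
move=> xx' e0; have [x0|x0] := ltP x 0.
  near=> nu; rewrite /F.
  rewrite (_ : [set w | _] = set0); first by rewrite measure0 addr_ge0// ltW.
  apply/seteqP; split => // w /= /(le_trans (V_ge0 _ _)).
  by rewrite lee_fin leNgt x0.
have e3 : 0 < e / 3 by rewrite divr_gt0.
have c12 : expR (- x') < expR (- x) by rewrite ltr_expR ltrN2.
have [p pP] := threshold_poly (expR_gt0 _) c12 e3.
have : \forall nu \near +oo, `|\int[P']_w p.[z w] - \int[P nu]_w p.[y nu w]| < e / 3.
  by have /cvgrPdist_lt := @cvg_poly p; apply.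
move=> H; near=> nu.
have nu0 : 0 <= nu by near: nu; exact: nbhs_pinfty_ge.
have H1 : `|\int[P']_w p.[z w] - \int[P nu]_w p.[y nu w]| < e / 3 by near: nu.
have h1 : F nu x <= \int[P nu]_w p.[y nu w] + e / 3.
  rewrite /F -Rintegral_indic; last exact: mVx.
  have -> : \int[P nu]_w p.[y nu w] + e / 3 = \int[P nu]_w (p.[y nu w] + e / 3).
    rewrite RintegralDcst//; apply: integrable_itv01; first exact/measurable_horner/my.
      by move=> w; have [] := pP _ (y01 w).
  apply: le_Rintegral => //.
  - exact/integrable_indic/mVx.
  - apply: (@integrable_bounded _ _ _ _ _ (1 + e / 3)).
      by apply: measurable_funD => //; exact/measurable_horner/my.
    move=> w; have [/andP[p0 p1] _ _] := pP _ (y01 w).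
    by rewrite ger0_norm ?lerD2r// addr_ge0// ltW.
  - move=> w _; have [/andP[p0 p1] _ p2] := pP _ (y01 w).
    rewrite indicE; case: (boolP (w \in _)) => [|_] /=; last first.
      by rewrite addr_ge0// ltW.
    rewrite inE /= -le_exp_neg// => /p2; lra.
have h2 : \int[P']_w p.[z w] <= G x' + e / 3.
  rewrite /G -Rintegral_indic; last exact: mZx.
  have -> : \int[P']_w (\1_[set w | Z w <= x'] w : R) + e / 3 =
      \int[P']_w (\1_[set w | Z w <= x'] w + e / 3).
    rewrite RintegralDcst//; exact/integrable_indic/mZx.
  apply: le_Rintegral => //.
  - apply: integrable_itv01; first exact/measurable_horner/mz.
    by move=> w; have [] := pP _ (z01 w).
  - apply: (@integrable_bounded _ _ _ _ _ (1 + e / 3)).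
      by apply: measurable_funD => //; exact/measurable_indic/mZx.
    move=> w; rewrite ger0_norm ?lerD2r//; rewrite indicE; case: (_ \in _) => //=.
      by rewrite ?ler01 addr_ge0// ltW.
    by rewrite add0r ltW.
  - move=> w _; have [/andP[p0 p1] p2 _] := pP _ (z01 w).
    rewrite indicE; case: (boolP (w \in _)) => [_|] /=; first lra.
    rewrite notin_setE /= => /negP; rewrite -ltNge add0r => xZ; apply: p2.
    by rewrite ler_expR lerN2 ltW.
move: H1; rewrite ltr_norml => /andP[H1 H2]; lra.
Unshelve. all: by end_near. Qed.

(** The argument of [limit_cdf_upper] with [V] and [Z] exchanged. *)
Lemma limit_cdf_lower x x' e : x' < x -> 0 < e ->
  \forall nu \near +oo, G x' - e <= F nu x.
Proof.
move=> xx' e0; have [x0|x0] := ltP x' 0.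
  near=> nu; rewrite /G.
  rewrite (_ : [set w | _] = set0).
    by rewrite measure0 sub0r (le_trans _ (F_ge0 _ _))// oppr_le0 ltW.
  apply/seteqP; split => // w /= /(le_trans (Z_ge0 _)).
  by rewrite leNgt x0.
have e3 : 0 < e / 3 by rewrite divr_gt0.
have c12 : expR (- x) < expR (- x') by rewrite ltr_expR ltrN2.
have [p pP] := threshold_poly (expR_gt0 _) c12 e3.
have : \forall nu \near +oo, `|\int[P']_w p.[z w] - \int[P nu]_w p.[y nu w]| < e / 3.
  by have /cvgrPdist_lt := @cvg_poly p; apply.
move=> H; near=> nu.
have nu0 : 0 <= nu by near: nu; exact: nbhs_pinfty_ge.
have H1 : `|\int[P']_w p.[z w] - \int[P nu]_w p.[y nu w]| < e / 3 by near: nu.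
have h1 : G x' <= \int[P']_w p.[z w] + e / 3.
  rewrite /G -Rintegral_indic; last exact: mZx.
  have -> : \int[P']_w p.[z w] + e / 3 = \int[P']_w (p.[z w] + e / 3).
    rewrite RintegralDcst//; apply: integrable_itv01; first exact/measurable_horner/mz.
      by move=> w; have [] := pP _ (z01 w).
  apply: le_Rintegral => //.
  - exact/integrable_indic/mZx.
  - apply: (@integrable_bounded _ _ _ _ _ (1 + e / 3)).
      by apply: measurable_funD => //; exact/measurable_horner/mz.
    move=> w; have [/andP[p0 p1] _ _] := pP _ (z01 w).
    by rewrite ger0_norm ?lerD2r// addr_ge0// ltW.
  - move=> w _; have [/andP[p0 p1] _ p2] := pP _ (z01 w).
    rewrite indicE; case: (boolP (w \in _)) => [|_] /=; last first.
      by rewrite addr_ge0// ltW.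
    rewrite inE /= => Zx; suff /p2 : expR (- x') <= z w by lra.
    by rewrite ler_expR lerN2.
have h2 : \int[P nu]_w p.[y nu w] <= F nu x + e / 3.
  rewrite /F -Rintegral_indic; last exact: mVx.
  have -> : \int[P nu]_w (\1_[set w | (V nu w <= x%:E)%E] w : R) + e / 3 =
      \int[P nu]_w (\1_[set w | (V nu w <= x%:E)%E] w + e / 3).
    rewrite RintegralDcst//; exact/integrable_indic/mVx.
  apply: le_Rintegral => //.
  - apply: integrable_itv01; first exact/measurable_horner/my.
    by move=> w; have [] := pP _ (y01 w).
  - apply: (@integrable_bounded _ _ _ _ _ (1 + e / 3)).
      by apply: measurable_funD => //; exact/measurable_indic/mVx.
    move=> w; rewrite ger0_norm ?lerD2r//; rewrite indicE; case: (_ \in _) => //=.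
      by rewrite ?ler01 addr_ge0// ltW.
    by rewrite add0r ltW.
  - move=> w _; have [/andP[p0 p1] p2 _] := pP _ (y01 w).
    rewrite indicE; case: (boolP (w \in _)) => [_|] /=; first lra.
    rewrite notin_setE /= => /negP; rewrite -le_exp_neg// -ltNge add0r => xV.
    exact/p2/ltW.
move: H1; rewrite ltr_norml => /andP[H1 H2]; lra.
Unshelve. all: by end_near. Qed.

(** [Z'] is the announced limit and [Z] a nonnegative variable with the same distribution function:
    the test variable [expR (- Z)] has to stay in the unit interval everywhere, which [Z']
    guarantees only almost surely. *)
Lemma cvg_in_distribution_exp_neg (Z' : {RV P' >-> R}) :
  (forall x, cdf Z' x = P' [set w | Z w <= x]) ->
  cvg_in_distribution P V Z'.
Proof.
move=> cdfE x; rewrite /= /prop_for /continuous_at !cdfE => cx.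
have fin_G u : P' [set w | Z w <= u] = (G u)%:E.
  by rewrite /G fineK// fin_num_measure.
rewrite fin_G.
have fin_F nu : 0 <= nu -> P nu [set w | (V nu w <= x%:E)%E] = (F nu x)%:E.
  by move=> nu0; rewrite /F fineK// fin_num_measure//; exact: mVx.
have {}cx : G u @[u --> x] --> G x.
  move: cx; rewrite fin_G => /fine_cvgP[_]; apply: cvg_trans; apply: near_eq_cvg.
  by near=> u; rewrite /= cdfE.
apply/fine_cvgP; split.
  by near=> nu; rewrite fin_F//; near: nu; exact: nbhs_pinfty_ge.
apply/cvgrPdist_le => e e0.
have e2 : 0 < e / 2 by rewrite divr_gt0.
have : \forall u \near x, `|G x - G u| <= e / 2 by move/cvgrPdist_le : cx; apply.
move=> /nbhs_ballP[r /= r0 rP].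
have xr : `|G x - G (x + r / 2)| <= e / 2.
  by apply: rP; rewrite /ball/= opprD addrA subrr sub0r normrN gtr0_norm; lra.
have rx : `|G x - G (x - r / 2)| <= e / 2.
  by apply: rP; rewrite /ball/= opprB addrC subrK gtr0_norm; lra.
have xlt : x < x + r / 2 by lra.
have ltx : x - r / 2 < x by lra.
have U := limit_cdf_upper xlt e2.
have L := limit_cdf_lower ltx e2.
near=> nu => /=.
have hU : F nu x <= G (x + r / 2) + e / 2 by near: nu.
have hL : G (x - r / 2) - e / 2 <= F nu x by near: nu.
rewrite -/(F nu x) ler_norml.
move: xr rx; rewrite !ler_norml; lra.
Unshelve. all: by end_near. Qed.

End continuity_theorem.

(** * The limiting law *)

Definition exponential_law (R : realType) : probability (measurableTypeR R) R :=
  exponential_distribution_exponential_prob__canonical__probability_measure_Probability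
    (@ltr01 R).

Section exponential_law.
Context {R : realType}.
Let mu := @lebesgue_measure R.
Let expo := exponential_law R.

Lemma exponential_prob_dominates : expo `<< mu.
Proof.
apply/null_content_dominatesP => A mA muA0.
rewrite /= /exponential_prob; apply: null_set_integral => //.
by apply/measurable_EFinP/measurable_funTS; exact: measurable_exponential_pdf.
Qed.

(** The density is identified with the Radon-Nikodym derivative, which is unique almost
    everywhere. *)
Lemma integral_exponential_prob1 (f : R -> R) : measurable_fun setT f ->
  (forall x, 0 <= f x <= 1) ->
  (\int[expo]_x (f x)%:E = \int[mu]_x ((f x)%:E * (exponential_pdf 1 x)%:E))%E.
Proof.
move=> mf f01.
have fint : expo.-integrable setT (EFin \o f).
  exact: integrable_itv01.
rewrite -(Radon_Nikodym_change_of_variables exponential_prob_dominates)//=.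
apply: ae_eq_integral => //.
- apply: emeasurable_funM => //; first exact/measurable_EFinP.
  apply: (measurable_int mu).
  by apply: Radon_Nikodym_integrable; exact: exponential_prob_dominates.
- apply: emeasurable_funM => //; first exact/measurable_EFinP.
  by apply/measurable_EFinP; exact: measurable_exponential_pdf.
- apply: ae_eqe_mul2l => /=.
  rewrite Radon_NikodymE//=; first exact: exponential_prob_dominates.
  move=> abmu; case: cid => /= h [h1 h2 h3].
  apply: integral_ae_eq => //=.
  + by apply/measurable_EFinP; exact: measurable_exponential_pdf.
  + by move=> E _ mE; rewrite -h3.
Qed.

Lemma measurable_expR_max (s : R) :
  measurable_fun setT (fun x : R => expR (- (s * Num.max x 0))).
Proof.
apply: (measurableT_comp (f := @expR R)); first exact: measurable_expR.
apply: measurable_funN; apply: measurable_funM => //.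
exact: measurable_maxr.
Qed.

Lemma expR_max_itv01 (s x : R) : 0 <= s -> 0 <= expR (- (s * Num.max x 0)) <= 1.
Proof.
move=> s0; rewrite expR_ge0 -expR0 ler_expR oppr_le0 mulr_ge0//.
by rewrite le_max lexx orbT.
Qed.

Lemma laplace_exponential (s : R) : 0 <= s ->
  \int[expo]_x expR (- (s * Num.max x 0)) = (1 + s)^-1.
Proof.
move=> s0; have s1 : 0 < 1 + s by rewrite ltr_pwDl.
(* Exponential tilting: the factor [exp (- s x)] turns the density of rate 1 into that of rate
   [1 + s], whose total mass is 1. *)
have pdfE x : expR (- (s * Num.max x 0)) * exponential_pdf 1 x =
    (1 + s)^-1 * exponential_pdf (1 + s) x.
  have [x0|x0] := ltP x 0; first by rewrite !lt0_exponential_pdf// !mulr0.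
  rewrite !exponential_pdfE// mul1r mulrA mulVf ?gt_eqF// mul1r -expRD.
  by congr expR; ring.
rewrite /Rintegral integral_exponential_prob1; last 2 first.
- exact: measurable_expR_max.
- by move=> x; exact: expR_max_itv01.
transitivity (fine (\int[mu]_x ((1 + s)^-1%:E * (exponential_pdf (1 + s) x)%:E)%E)).
  by congr fine; apply: eq_integral => x _; rewrite -EFinM; rewrite pdfE.
rewrite ge0_integralZl//.
- by rewrite integral_exponential_pdf// mule1.
- by apply/measurable_EFinP; exact: measurable_exponential_pdf.
- by move=> x _; rewrite lee_fin exponential_pdf_ge0// ltW.
- by rewrite lee_fin invr_ge0 ltW.
Qed.

Lemma exponential_prob_lt0 : expo `]-oo, 0[%classic = 0%E.
Proof.
rewrite /= /exponential_prob; apply: integral0_eq => x /=.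
by rewrite in_itv /= => x0; rewrite lt0_exponential_pdf.
Qed.

End exponential_law.

Lemma Rintegral_prod (R : realType) d1 d2 (T1 : measurableType d1)
    (T2 : measurableType d2) (P1 : probability T1 R) (P2 : probability T2 R)
    (f : T1 -> R) (g : T2 -> R) :
    measurable_fun setT f -> measurable_fun setT g ->
    (forall x, 0 <= f x <= 1) -> (forall x, 0 <= g x <= 1) ->
  \int[(P1 \x P2)%E]_z (f z.1 * g z.2) = \int[P1]_x f x * \int[P2]_y g y.
Proof.
move=> mf mg f01 g01.
have f0 x : 0 <= f x by have /andP[] := f01 x.
have g0 x : 0 <= g x by have /andP[] := g01 x.
rewrite {1}/Rintegral fubini_tonelli1//=; last 2 first.
- apply/measurable_EFinP; apply: measurable_funM.
    exact: (measurableT_comp mf measurable_fst).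
  exact: (measurableT_comp mg measurable_snd).
- by move=> z; rewrite lee_fin mulr_ge0.
rewrite /fubini_F /=.
under eq_integral => x _.
  under eq_integral do rewrite EFinM.
  rewrite ge0_integralZl//; last 3 first.
  - exact/measurable_EFinP.
  - by move=> y _; rewrite lee_fin.
  - by rewrite lee_fin.
  rewrite EFin_Rintegral; last exact: integrable_itv01.
  over.
rewrite ge0_integralZr//; last 3 first.
- exact/measurable_EFinP.
- by move=> y _; rewrite lee_fin.
- by rewrite lee_fin; apply: Rintegral_ge0.
by rewrite EFin_Rintegral//; exact: integrable_itv01.
Qed.

Lemma mnormalize_mass1 d (T : measurableType d) (R : realType)
    (mu : {measure set T -> \bar R}) (P : probability T R) (A : set T) :
  mu setT = 1%E -> mnormalize mu P A = mu A.
Proof.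
by move=> mu1; rewrite /mnormalize mu1 onee_eq0/= invr1 mule1.
Qed.

(** * Functions that are Laplace transforms, and their closure properties *)

Section laplace_law.
Context {R : realType}.
Implicit Types phi rho psi : R -> R.

(* [phi] is the Laplace transform of the positive part of a random variable. *)
Definition laplace_law phi := exists mu : probability (measurableTypeR R) R,
  forall s, 0 <= s -> \int[mu]_x expR (- (s * Num.max x 0)) = phi s.

Lemma laplace_law_RV d (T : measurableType d) (P : probability T R)
    (X : T -> R) phi : measurable_fun setT X -> (forall w, 0 <= X w) ->
    (forall s, 0 <= s -> \int[P]_w expR (- (s * X w)) = phi s) ->
  laplace_law phi.
Proof.
move=> mX X0 Xphi.
have mX' : @measurable_fun _ _ T (measurableTypeR R) setT X := mX.
pose X' : {mfun T >-> measurableTypeR R} :=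
  HB.pack X (isMeasurableFun.Build d _ T (measurableTypeR R) X mX').
exists (distribution P X') => s s0.
rewrite -Xphi// /Rintegral ge0_integral_distribution.
- by congr fine; apply: eq_integral => w _ /=; rewrite max_l.
- by apply/measurable_EFinP; exact: measurable_expR_max.
- by move=> y; rewrite lee_fin expR_ge0.
Qed.

Lemma laplace_law_ext phi rho : (forall s, 0 <= s -> phi s = rho s) ->
  laplace_law phi -> laplace_law rho.
Proof. by move=> h [mu muP]; exists mu => s s0; rewrite muP// h. Qed.

Lemma laplace_law_itv01 phi s : laplace_law phi -> 0 <= s -> 0 <= phi s <= 1.
Proof.
move=> [mu muP] s0; rewrite -muP//; apply/andP; split.
  by apply: Rintegral_ge0 => x _; exact: expR_ge0.
rewrite -[leRHS](Rintegral_cst1 mu); apply: le_Rintegral => //.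
- apply: integrable_itv01; first exact: measurable_expR_max.
  by move=> x; exact: expR_max_itv01.
- by apply: integrable_itv01 => // x; rewrite ler01 lexx.
- by move=> x _; have /andP[] := expR_max_itv01 x s0.
Qed.

Lemma laplace_law_exponential (m : R) : 0 <= m ->
  laplace_law (fun s => (1 + s * m)^-1).
Proof.
move=> m0.
apply: (@laplace_law_RV _ _ (exponential_law R) (fun x => m * Num.max x 0)).
- by apply: measurable_funM => //; exact: measurable_maxr.
- by move=> x; rewrite mulr_ge0// le_max lexx orbT.
- move=> s s0; rewrite -(laplace_exponential (mulr_ge0 s0 m0)).
  by apply: eq_Rintegral => x _; rewrite mulrA.
Qed.

Lemma laplace_lawM phi rho : laplace_law phi -> laplace_law rho ->
  laplace_law (fun s => phi s * rho s).
Proof.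
move=> [mu1 muP1] [mu2 muP2].
apply: (@laplace_law_RV _ _ (mu1 \x mu2)%E
  (fun z => Num.max z.1 0 + Num.max z.2 0)).
- by apply: measurable_funD; apply: measurable_maxr.
- by move=> x; rewrite addr_ge0// le_max lexx orbT.
- move=> s s0; rewrite -muP1// -muP2// -Rintegral_prod; last 4 first.
  + exact: measurable_expR_max.
  + exact: measurable_expR_max.
  + by move=> x; exact: expR_max_itv01.
  + by move=> x; exact: expR_max_itv01.
  by apply: eq_Rintegral => x _; rewrite -expRD; congr expR; ring.
Qed.

(** This is the transform of [X + Y_1 + ... + Y_n] for a random [n] of geometric law
    [(1 - q) * q ^+ n]. Mixing the laws for fixed [n] avoids an infinite family of independent
    variables. *)
Lemma laplace_law_geometric phi rho (q : R) : 0 <= q < 1 ->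
  laplace_law phi -> laplace_law rho ->
  laplace_law (fun s => (1 - q) * phi s / (1 - q * rho s)).
Proof.
move=> /andP[q0 q1] Lphi Lrho.
have L n : laplace_law (fun s => phi s * rho s ^+ n).
  elim: n => [|n IH]; first by apply: laplace_law_ext Lphi => s; rewrite mulr1.
  apply: laplace_law_ext (laplace_lawM IH Lrho) => s s0.
  by rewrite exprSr mulrA.
have [nu nuP] := choice L.
have p0 n : 0 <= (1 - q) * q ^+ n by rewrite mulr_ge0 ?exprn_ge0// subr_ge0 ltW.
pose m_ n : {measure set (measurableTypeR R) -> \bar R} := mscale (NngNum (p0 n)) (nu n).
pose m : {measure set (measurableTypeR R) -> \bar R} := mseries m_ 0.
have geo (a z : R) : 0 <= z < 1 -> 
    (\sum_(n <oo) (a * z ^+ n)%:E)%E = (a / (1 - z))%:E.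
  move=> /andP[z0 z1]; apply/cvg_lim => //.
  under eq_fun do rewrite sumEFin.
  apply/cvg_EFin; first by near=> n.
  by apply: cvg_geometric_series; rewrite ger0_norm.
have mT : m setT = 1%E.
  transitivity (\sum_(n <oo) ((1 - q) * q ^+ n)%:E)%E.
    by apply: eq_eseriesr => n _; rewrite -[RHS]mule1 -(probability_setT (nu n)).
  by rewrite geo ?q0// divff// gt_eqF// subr_gt0.
(* [m] already has mass 1; normalizing only provides the type of a probability. *)
exists (mnormalize m (nu 0)) => s s0.
have /andP[phi0 phi1] := laplace_law_itv01 Lphi s0.
have /andP[rho0 rho1] := laplace_law_itv01 Lrho s0.
rewrite /Rintegral (eq_measure_integral m); last first.
  by move=> A mA _; exact: mnormalize_mass1.
rewrite ge0_integral_measure_series//; last first.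
  by apply/measurable_EFinP; exact: measurable_expR_max.
transitivity (fine (\sum_(n <oo) ((1 - q) * phi s * (q * rho s) ^+ n)%:E)%E).
  congr fine; apply: eq_eseriesr => n _; rewrite ge0_integral_mscale//; last first.
    by apply/measurable_EFinP; exact: measurable_expR_max.
  rewrite EFin_Rintegral; last first.
    apply: integrable_itv01; first exact: measurable_expR_max.
    by move=> x; exact: expR_max_itv01.
  by rewrite nuP// -EFinM /= exprMn; congr EFin; ring.
by rewrite geo// mulr_ge0//= (le_lt_trans _ q1)// ler_piMr.
Unshelve. all: by end_near. Qed.

(* The functions [psi] such that a process with Laplace exponent [psi],
   stopped at an independent exponential time, has a law. *)
Definition laplace_exponent psi := (forall s, 0 <= s -> 0 <= psi s) /\
  forall c, 0 < c -> laplace_law (fun s => c / (c + psi s)).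

(** A drift of speed [g] stopped at an exponential time of rate [c] is exponential with mean
    [g / c]. *)
Lemma laplace_exponent_linear (g : R) : 0 <= g ->
  laplace_exponent (fun s => s * g).
Proof.
move=> g0; split; first by move=> s s0; rewrite mulr_ge0.
move=> c c0; have gc : 0 <= g / c by rewrite divr_ge0// ltW.
apply: laplace_law_ext (laplace_law_exponential gc) => s s0.
have ? : c + s * g != 0 by rewrite gt_eqF// ltr_wpDr// mulr_ge0.
have ? : c != 0 by rewrite gt_eqF.
by field; apply/andP.
Qed.

(** The added term equals [b * (1 - 1 / (1 + g * s / b))]: jumps at rate [b], exponential with mean
    [g / b]. Jumps and killing together occur at rate [c + b], and an event is a jump with
    probability [b / (c + b)]; hence a geometric number of jumps, and [psi] running for exponential
    times of rate [c + b] in between. This is why the induction needs the property of [psi] for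
    every rate [c]. *)
Lemma laplace_exponentD_jump psi (b g : R) : 0 < b -> 0 <= g ->
  laplace_exponent psi ->
  laplace_exponent (fun s => psi s + g * s / (1 + g * s / b)).
Proof.
move=> b0 g0 [psi0 Lpsi]; split.
  move=> s s0; rewrite addr_ge0 ?psi0// divr_ge0 ?addr_ge0 ?divr_ge0 ?mulr_ge0//.
  exact: ltW.
move=> c c0; have cb0 : 0 < c + b by rewrite addr_gt0.
have gb : 0 <= g / b by rewrite divr_ge0// ltW.
have q01 : 0 <= b / (c + b) < 1.
  by rewrite divr_ge0 ?(ltW b0) ?(ltW cb0)//= ltr_pdivrMr// mul1r ltrDr.
have := laplace_law_geometric q01 (Lpsi _ cb0)
  (laplace_lawM (Lpsi _ cb0) (laplace_law_exponential gb)).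
apply: laplace_law_ext => s s0.
have ps := psi0 _ s0; set p := psi s in ps *.
have gs : 0 <= g * s by rewrite mulr_ge0.
have ? : c + b + p != 0 by rewrite gt_eqF// ltr_wpDr.
have ? : c + b != 0 by rewrite gt_eqF.
have ? : b != 0 by rewrite gt_eqF.
have ? : b + g * s != 0 by rewrite gt_eqF// ltr_wpDr.
have ? : b + s * g != 0 by rewrite mulrC.
have h0 : 0 < (c + p) * (b + g * s) + g * s * b.
  rewrite ltr_wpDr ?mulr_ge0 ?(ltW b0)// mulr_gt0 ?ltr_wpDr// ltr_wpDr//.
  field; do ?[apply/andP; split] => //.
by rewrite addrA -mulrDl gt_eqF.
Qed.

End laplace_law.

Lemma laplace_exponent_sum (R : realType) (I : finType) (A : {set I})
    (g b : I -> R) (c : R) :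
    0 <= c -> (forall i, i \in A -> 0 <= g i) -> (forall i, i \in A -> 0 < b i) ->
  laplace_exponent
    (fun s => \sum_(i in A) g i * s / (1 + g i * s / b i) + s * c).
Proof.
move=> c0 g0 b0.
have -> : (fun s => \sum_(i in A) g i * s / (1 + g i * s / b i) + s * c) =
    (fun s => \sum_(i <- enum A) g i * s / (1 + g i * s / b i) + s * c).
  by apply/funext => s; rewrite big_enum.
have : {subset enum A <= A} by move=> i; rewrite mem_enum.
elim: (enum A) => [_|i r IH rA].
  have -> : (fun s => \sum_(i <- [::]) g i * s / (1 + g i * s / b i) + s * c) =
      (fun s => s * c) by apply/funext => s; rewrite big_nil add0r.
  exact: laplace_exponent_linear.
have iA : i \in A by apply: rA; rewrite mem_head.
have /IH E : {subset r <= A} by move=> j jr; apply: rA; rewrite inE jr orbT.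
have := laplace_exponentD_jump (b0 _ iA) (g0 _ iA) E.
by congr laplace_exponent; apply/funext => s; rewrite big_cons; ring.
Qed.

Lemma laplace_law_laplace_W (R : realType) (K : nat) (k2 : 'I_K)
    (gamma : 'I_K -> R) (beta : 'I_K -> \bar R) :
  laplace_law (laplace_W k2 gamma beta).
Proof.
have gamma0 k : k \in Kstar k2 gamma -> 0 <= gamma k.
  by rewrite inE => /andP[_ /ltW].
have [] := @laplace_exponent_sum R _ (Aset k2 gamma beta) gamma
  (fine \o beta) (gammaS k2 gamma beta).
- by apply: sumr_ge0 => k; rewrite inE => /andP[/gamma0].
- by move=> k; rewrite inE => /andP[/gamma0].
- by move=> k; rewrite inE => /andP[_ ?]; exact: fine_gt0.
move=> _ /(_ _ ltr01); apply: laplace_law_ext => s _.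
by rewrite /laplace_W addrA.
Qed.

Lemma eq_measure_null d (T : measurableType d) (R : realType)
    (P : probability T R) (A B N : set T) :
    measurable A -> measurable B -> measurable N -> P N = 0%E ->
  A `<=` B `|` N -> B `<=` A `|` N -> P A = P B.
Proof.
move=> mA mB mN PN AB BA; apply/eqP; rewrite eq_le; apply/andP; split.
- rewrite -[leRHS]adde0 -PN; apply: le_trans (measureU2 _ mB mN).
  by apply: le_measure => //; rewrite inE //; exact: measurableU.
- rewrite -[leRHS]adde0 -PN; apply: le_trans (measureU2 _ mA mN).
  by apply: le_measure => //; rewrite inE //; exact: measurableU.
Qed.

(** [Y] is a coordinate on the real line, so it may be negative on a null set. [Z] keeps the
    pointwise formula, while [Z0] takes positive parts to be nonnegative everywhere, as the
    continuity theorem demands; both have the same distribution function. *)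
Lemma limit_variables (R : realType) (phi : R -> R) (alpha : R) :
    laplace_law phi -> 0 <= alpha <= 1 ->
  exists (d' : measure_display) (T' : measurableType d')
         (P' : probability T' R) (Y W Z : {RV P' >-> R}) (Z0 : T' -> R),
    [/\ has_law Y (exponential_prob 1),
        forall s : R, 0 <= s -> ('M_P' W (- s))%E = (phi s)%:E,
        independent_RV Y W &
        forall w, Z w = alpha * Y w + (1 - alpha) * W w ] /\
    [/\ measurable_fun setT Z0, forall w, 0 <= Z0 w,
        forall x, cdf Z x = P' [set w | Z0 w <= x] &
        forall m : nat, \int[P']_w expR (- Z0 w) ^+ m =
          (1 + m%:R * alpha)^-1 * phi (m%:R * (1 - alpha))].
Proof.
move=> [mu muP] /andP[a0 a1].
pose TR := measurableTypeR R.
pose P' : probability (TR * TR)%type R := (exponential_law R \x mu)%E.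
pose Yf (z : TR * TR) : R := z.1.
pose Wf (z : TR * TR) : R := Num.max (z.2 : R) 0.
pose Zf (z : TR * TR) : R := alpha * Yf z + (1 - alpha) * Wf z.
pose Z0 (z : TR * TR) : R := alpha * Num.max (Yf z) 0 + (1 - alpha) * Wf z.
have mY : measurable_fun setT Yf by exact: measurable_fst.
have m2 : measurable_fun setT (fun z : TR * TR => z.2 : R) by exact: measurable_snd.
have mW : measurable_fun setT Wf by exact: measurable_maxr.
have mZ : measurable_fun setT Zf.
  by apply: measurable_funD; apply: measurable_funM.
have mZ0 : measurable_fun setT Z0.
  by apply: measurable_funD; apply: measurable_funM => //; exact: measurable_maxr.
have Z00 w : 0 <= Z0 w.
  by rewrite addr_ge0// mulr_ge0 ?subr_ge0// le_max lexx orbT.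
have PX (A B : set TR) : measurable A -> measurable B ->
    P' (A `*` B) = (exponential_law R A * mu B)%E.
  by move=> mA mB; exact: product_measure1E.
have PXT (A : set TR) : measurable A -> P' (A `*` setT) = exponential_law R A.
  move=> mA; rewrite PX// -[RHS]mule1; congr (_ * _)%E; exact: probability_setT.
have PTX (A : set TR) : measurable A -> P' (setT `*` A) = mu A.
  move=> mA; rewrite PX// -[RHS]mul1e; congr (_ * _)%E; exact: probability_setT.
pose Y : {RV P' >-> R} := HB.pack Yf (isMeasurableFun.Build _ _ _ R Yf mY).
pose W : {RV P' >-> R} := HB.pack Wf (isMeasurableFun.Build _ _ _ R Wf mW).
pose Z : {RV P' >-> R} := HB.pack Zf (isMeasurableFun.Build _ _ _ R Zf mZ).
exists _, _, P', Y, W, Z, Z0; split; split => //.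
- move=> A mA; rewrite /distribution /pushforward.
  rewrite (_ : Y @^-1` A = A `*` setT); last first.
    by apply/seteqP; split => z //= [].
  exact: PXT.
- move=> s s0; rewrite /mmt_gen_fun unlock.
  transitivity (\int[P']_z (expR (- (s * Wf z)))%:E)%E.
    by apply: eq_integral => z _ /=; congr (expR _)%:E; ring.
  rewrite EFin_Rintegral; last first.
    apply: integrable_itv01 => [|w]; last exact: expR_max_itv01.
    exact: (measurableT_comp (measurable_expR_max s) m2).
  congr EFin.
  have := @Rintegral_prod R _ _ TR TR (exponential_law R) mu (fun=> 1)
    (fun x => expR (- (s * Num.max (x : R) 0))).
  rewrite muP// Rintegral_cst1 mul1r => <- //.
  + by apply: eq_Rintegral => z _; rewrite mul1r.
  + exact: measurable_expR_max.
  + by move=> _; rewrite ler01 lexx.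
  + by move=> x; exact: expR_max_itv01.
- move=> A B mA mB.
  pose B' := (fun x : TR => Num.max (x : R) 0) @^-1` B.
  have mB' : measurable B'.
    have mm : measurable_fun setT (fun x : TR => Num.max (x : R) 0).
      exact: measurable_maxr.
    by rewrite -[X in measurable X]setTI; exact: mm.
  rewrite (_ : Y @^-1` A `&` W @^-1` B = A `*` B'); last first.
    by apply/seteqP; split => z.
  rewrite (_ : Y @^-1` A = A `*` setT); last first.
    by apply/seteqP; split => z //= [].
  rewrite (_ : W @^-1` B = setT `*` B'); last first.
    by apply/seteqP; split => z //= [].
  by rewrite PX// PXT// PTX.
- move=> x; rewrite /cdf /distribution /pushforward.
  pose N : set (TR * TR) := `]-oo, 0[%classic `*` setT.
  have mN : measurable N by apply: measurableX => //; exact: measurable_itv.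
  have NE z : ~ N z -> Zf z = Z0 z.
    move=> Nz; rewrite /Zf /Z0 max_l// leNgt; apply/negP => Yz; apply: Nz.
    by split => //=; rewrite in_itv.
  apply: (@eq_measure_null _ _ _ _ _ _ N) => //.
  + by rewrite -[X in measurable X]setTI; exact: (mZ).
  + rewrite (_ : [set w | _] = Z0 @^-1` `]-oo, x]%classic).
      by rewrite -[X in measurable X]setTI; exact: mZ0.
    by apply/seteqP; split => w /=; rewrite in_itv.
  + by rewrite PXT; [exact: exponential_prob_lt0 | exact: measurable_itv].
  + move=> z /=; rewrite in_itv /= => Zx; have [Nz|Nz] := pselect (N z); [by right|left].
    by rewrite /= -NE.
  + move=> z /= Zx; have [Nz|Nz] := pselect (N z); [by right|left].
    by rewrite /= in_itv /= NE.
- move=> m.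
  rewrite -muP; last by rewrite mulr_ge0// subr_ge0.
  rewrite -laplace_exponential ?mulr_ge0// -Rintegral_prod; last 4 first.
  + exact: measurable_expR_max.
  + exact: measurable_expR_max.
  + by move=> y; apply: expR_max_itv01; rewrite mulr_ge0.
  + by move=> y; apply: expR_max_itv01; rewrite mulr_ge0// subr_ge0.
  apply: eq_Rintegral => z _; rewrite -expRD -expRM_natl; congr expR.
  by rewrite /Z0 /Yf /Wf; ring.
Qed.

(** * Laplace transforms of hitting times *)

Section finite_range.
Context {R : realType} {d} {T : measurableType d} (P : probability T R)
  {F : finType} (xi : T -> F).
Hypothesis mxi : forall x, measurable [set w | xi w = x].
Implicit Type G : F -> R.

Lemma finite_range_indic G w :
  G (xi w) = \sum_x G x * \1_[set w | xi w = x] w.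
Proof.
rewrite (bigD1 (xi w))//= big1 ?addr0 => [|x xw].
  by rewrite indicE mem_set ?mulr1.
by rewrite indicE memNset ?mulr0//= => /esym/eqP; rewrite (negbTE xw).
Qed.

Lemma measurable_finite_range G : measurable_fun setT (fun w => G (xi w)).
Proof.
under eq_fun do rewrite finite_range_indic.
by apply: measurable_sum => x; apply: measurable_funM => //; exact: measurable_indic.
Qed.

Lemma integrable_finite_range G :
  P.-integrable setT (EFin \o (fun w => G (xi w))).
Proof.
apply: (@integrable_bounded _ _ _ _ _ (\sum_x `|G x|)).
  exact: measurable_finite_range.
by move=> w; rewrite (bigD1 (xi w))//= lerDl sumr_ge0.
Qed.

Lemma Rintegral_finite_range G :
  \int[P]_w G (xi w) = \sum_x G x * fine (P [set w | xi w = x]).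
Proof.
under eq_Rintegral do rewrite finite_range_indic.
have i1 x := integrable_indic P (mxi x).
rewrite (Rintegral_sum _ _).2.
  by apply: eq_bigr => x _; rewrite RintegralZl// Rintegral_indic.
by move=> x; have := @integrableZl _ _ _ P setT measurableT (G x) _ (i1 x).
Qed.

End finite_range.

(** * Discounted sequences stopped at a state *)

Section stopped_sequence.
Context {R : realType} {S : eqType} (b : S) (g : S -> R) (r : R).
Hypothesis gb : g b = 1.
Implicit Type x : nat -> S.

(* Telescopes to [r ^+ m * g (x m)], where [m] is [N] or the first visit of
   [x] to [b], whichever comes first. *)
Definition stopped_sum x N := g (x 0%N) + \sum_(n < N)
  r ^+ n * [forall m : 'I_n.+1, x m != b]%:R * (r * g (x n.+1) - g (x n)).

Lemma stopped_sum_before x N : (forall m, (m < N)%N -> x m != b) ->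
  stopped_sum x N = r ^+ N * g (x N).
Proof.
elim: N => [|N IH] xb; first by rewrite /stopped_sum big_ord0 addr0 mul1r.
rewrite /stopped_sum big_ord_recr/= addrA -/(stopped_sum x N) IH; last first.
  by move=> m mN; apply: xb; rewrite ltnS ltnW.
rewrite (_ : [forall m : 'I_N.+1, x m != b] = true) ?mulr1; last first.
  by apply/forallP => m; apply: xb.
by rewrite exprS; ring.
Qed.

Lemma stopped_sum_after x tau N : (tau <= N)%N ->
  (forall m, (m < tau)%N -> x m != b) -> x tau = b ->
  stopped_sum x N = r ^+ tau.
Proof.
move=> + xb xtau; elim: N => [|N IH].
  by rewrite leqn0 => /eqP t0; move: xb xtau; rewrite t0 => xb xt;
    rewrite /stopped_sum big_ord0 addr0 xt gb.
rewrite leq_eqVlt => /predU1P[<-|tN].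
  by rewrite stopped_sum_before// xtau gb mulr1.
rewrite /stopped_sum big_ord_recr/= addrA -/(stopped_sum x N) IH//.
rewrite (_ : [forall m : 'I_N.+1, x m != b] = false) ?mulr0 ?mul0r ?addr0//.
by apply/forallP => /(_ (Ordinal tN)); rewrite /= xtau eqxx.
Qed.

(** Provides the dominating constant for the passage to the limit along the skeletons. *)
Lemma stopped_sum_bound x N (M : R) : 0 <= r <= 1 -> (forall i, `|g i| <= M) ->
  `|stopped_sum x N| <= M.
Proof.
move=> /andP[r0 r1] gM.
have M1 : 1 <= M by have := gM b; rewrite gb normr1.
have rn n : 0 <= r ^+ n <= 1 by rewrite exprn_ge0// exprn_ile1.
have [h|/negP h] := boolP [forall m : 'I_N, x m != b].
  rewrite stopped_sum_before => [|m mN].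
    rewrite normrM ger0_norm ?exprn_ge0//.
    by have /andP[? ?] := rn N; rewrite (le_trans _ (gM (x N)))// ler_piMl.
  by have /forallP /(_ (Ordinal mN)) := h.
have ex : exists m, x m == b.
  by move/negP: h; rewrite negb_forall => /existsP[m]; rewrite negbK; exists m.
have [tau /eqP xt tmin] := ex_minnP ex.
rewrite (@stopped_sum_after x tau)//.
- by have /andP[? ?] := rn tau; rewrite ger0_norm// (le_trans _ M1).
- move/negP: h; rewrite negb_forall => /existsP[m]; rewrite negbK => /tmin tm.
  by rewrite (leq_trans tm)// ltnW.
- by move=> m mt; apply/negP => /tmin; rewrite leqNgt mt.
Qed.

End stopped_sequence.

(** * The process observed at the multiples of a step [h] *)

Section skeleton.
Context {R : realType} {S : finType} {d} {T : measurableType d}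
  (P : probability T R) (X : R -> T -> S) (p : R -> S -> S -> R) (h : R).
Hypothesis mX : forall t i, 0 <= t -> measurable [set w | X t w = i].
Hypothesis h_gt0 : 0 < h.
Hypothesis markovP : forall (t : nat -> R) (x : nat -> S) (n : nat),
  0 <= t 0%N -> {homo t : i j / (i <= j)%N >-> i <= j} ->
  P [set w | forall m, (m <= n.+1)%N -> X (t m) w = x m] =
  (P [set w | forall m, (m <= n)%N -> X (t m) w = x m] *
     (p (t n.+1 - t n) (x n) (x n.+1))%:E)%E.

Let t (m : nat) : R := m%:R * h.

Let t_ge0 m : 0 <= t m. Proof. by rewrite mulr_ge0// ltW. Qed.

(** A finite function, so that the whole past is a variable with finitely many values and
    expectations are finite sums. *)
Definition skeleton_path n w : {ffun 'I_n.+1 -> S} := [ffun m => X (t (val m)) w].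

Lemma measurable_skeleton_path n x :
  measurable [set w | skeleton_path n w = x].
Proof.
have -> : [set w | skeleton_path n w = x] =
    \bigcap_(m in [set: 'I_n.+1]) [set w | X (t m) w = x m].
  apply/seteqP; split => w /=; first by move=> <- m _ /=; rewrite ffunE.
  by move=> H; apply/ffunP => m; rewrite ffunE; exact: H.
by apply: fin_bigcap_measurable => [|m _]; [exact: finite_finset | exact: mX].
Qed.

Lemma markov_skeleton n (x : {ffun 'I_n.+1 -> S}) j :
  P [set w | (skeleton_path n w, X (t n.+1) w) = (x, j)] =
  (P [set w | skeleton_path n w = x] * (p h (x ord_max) j)%:E)%E.
Proof.
pose y m := if (m <= n)%N then x (inord m) else j.
have tn : t n.+1 - t n = h by rewrite /t -mulrBl -natr1 addrAC subrr add0r mul1r.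
have := @markovP t y n (t_ge0 _).
rewrite tn /y leqnn ltnn.
have -> : inord n = ord_max :> 'I_n.+1 by apply/val_inj; rewrite /= inordK.
have th : {homo t : i j / (i <= j)%N >-> i <= j}.
  by move=> u v uv; rewrite /t ler_pM2r// ler_nat.
move=> /(_ th) E.
have E1 : [set w | (skeleton_path n w, X (t n.+1) w) = (x, j)] =
    [set w | forall m, (m <= n.+1)%N -> X (t m) w = y m].
  apply/seteqP; split => w /=.
    move=> [xE jE] m; rewrite leq_eqVlt => /predU1P[->|mn].
      by rewrite /y ltnn.
    by rewrite /y -ltnS mn -xE ffunE /= inordK.
  move=> H; congr pair; last by have := H n.+1 (leqnn _); rewrite /y ltnn.
  apply/ffunP => m; rewrite ffunE.
  have mn : (m <= n)%N by rewrite -ltnS ltn_ord.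
  by rewrite (H m (leqW mn)) /y mn inord_val.
have E2 : [set w | skeleton_path n w = x] =
    [set w | forall m, (m <= n)%N -> X (t m) w = y m].
  apply/seteqP; split => w /=.
    by move=> xE m mn; rewrite /y mn -xE ffunE /= inordK// ltnS.
  move=> H; apply/ffunP => m; rewrite ffunE.
  have mn : (m <= n)%N by rewrite -ltnS ltn_ord.
  by rewrite H// /y mn inord_val.
by rewrite E1 E2 E.
Qed.

Lemma measurable_pair n (z : {ffun 'I_n.+1 -> S} * S) :
  measurable [set w | (skeleton_path n w, X (t n.+1) w) = z].
Proof.
case: z => x j.
have -> : [set w | (skeleton_path n w, X (t n.+1) w) = (x, j)] =
    [set w | skeleton_path n w = x] `&` [set w | X (t n.+1) w = j].
  by apply/seteqP; split => w /= [-> ->].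
by apply: measurableI; [exact: measurable_skeleton_path | exact: mX].
Qed.

(** The Markov property as a conditional expectation given the whole past. The dependence of [G] on
    the entire path is needed for the indicator that [b] has not been visited yet. *)
Lemma Rintegral_skeleton_step n (G : {ffun 'I_n.+1 -> S} -> R) (phi : S -> R) :
  \int[P]_w (G (skeleton_path n w) * phi (X (t n.+1) w)) =
  \int[P]_w (G (skeleton_path n w) *
     \sum_j p h (skeleton_path n w ord_max) j * phi j).
Proof.
rewrite (@Rintegral_finite_range _ _ _ P _
  (fun w => (skeleton_path n w, X (t n.+1) w)) _ (fun z => G z.1 * phi z.2)); last first.
  exact: measurable_pair.
rewrite (@Rintegral_finite_range _ _ _ P _ (skeleton_path n) _
  (fun z => G z * \sum_j p h (z ord_max) j * phi j)); last first.
  exact: measurable_skeleton_path.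
transitivity (\sum_(z : {ffun 'I_n.+1 -> S} * S) G z.1 * phi z.2 *
  fine (P [set w | (skeleton_path n w, X (t n.+1) w) = (z.1, z.2)])).
  by apply: eq_bigr => -[x j] _.
rewrite -(pair_bigA _ (fun x j => G x * phi j *
  fine (P [set w | (skeleton_path n w, X (t n.+1) w) = (x, j)]))) /=.
apply: eq_bigr => x _; rewrite -mulrA [X in _ = _ * X]mulrC !mulr_sumr.
apply: eq_bigr => j _; rewrite markov_skeleton fineM//; last first.
  by apply: fin_num_measure; exact: measurable_skeleton_path.
by rewrite /=; ring.
Qed.

Variables (a b : S) (g : S -> R) (r delta : R).
Hypothesis start : P [set w | X 0 w = a] = 1%E.
Hypothesis r_itv : 0 < r < 1.
Hypothesis deltaP : forall i, i != b ->
  `|r * (\sum_j p h i j * g j) - g i| <= delta.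

Let r_ge0 : 0 <= r. Proof. by case/andP: r_itv => /ltW. Qed.

Let delta_ge0 : (exists i, i != b) -> 0 <= delta.
Proof. by move=> [i ib]; exact: le_trans (normr_ge0 _) (deltaP ib). Qed.

Definition stopped_functional N w := stopped_sum b g r (fun m => X (t m) w) N.

Let increment n (x : {ffun 'I_n.+1 -> S}) (j : S) : R :=
  r ^+ n * [forall m : 'I_n.+1, x m != b]%:R * (r * g j - g (x ord_max)).

Let increment_int n : P.-integrable setT
  (EFin \o (fun w => increment (skeleton_path n w) (X (t n.+1) w))).
Proof.
exact: (@integrable_finite_range _ _ _ P _
  (fun w => (skeleton_path n w, X (t n.+1) w)) (@measurable_pair n)
  (fun z => increment z.1 z.2)).
Qed.

Let stopped_functionalE N w : stopped_functional N w =
  g (X (t 0) w) + \sum_(n < N) increment (skeleton_path n w) (X (t n.+1) w).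
Proof.
rewrite /stopped_functional /stopped_sum; congr (_ + _); apply: eq_bigr => n _.
rewrite /increment ffunE; congr (_ * (_ : bool)%:R * _).
by apply: eq_forallb => m; rewrite ffunE.
Qed.

Let Rintegral_increment n : (exists i, i != b) ->
  `|\int[P]_w increment (skeleton_path n w) (X (t n.+1) w)| <= r ^+ n * delta.
Proof.
move=> /delta_ge0 d0.
pose G (x : {ffun 'I_n.+1 -> S}) : R :=
  r ^+ n * [forall m : 'I_n.+1, x m != b]%:R.
have iG phi : P.-integrable setT (EFin \o (fun w =>
    G (skeleton_path n w) * phi (skeleton_path n w))).
  exact: (@integrable_finite_range _ _ _ P _ _ (@measurable_skeleton_path n)
    (fun z => G z * phi z)).
have i2 : P.-integrable setT (EFin \o (fun w =>
    G (skeleton_path n w) * (r * g (X (t n.+1) w)))).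
  exact: (@integrable_finite_range _ _ _ P _
    (fun w => (skeleton_path n w, X (t n.+1) w)) (@measurable_pair n)
    (fun z => G z.1 * (r * g z.2))).
have -> : \int[P]_w increment (skeleton_path n w) (X (t n.+1) w) =
    \int[P]_w (G (skeleton_path n w) *
      (r * (\sum_j p h (skeleton_path n w ord_max) j * g j) -
       g (skeleton_path n w ord_max))).
  transitivity (\int[P]_w (G (skeleton_path n w) * (r * g (X (t n.+1) w)) -
      G (skeleton_path n w) * g (skeleton_path n w ord_max))).
    by apply: eq_Rintegral => w _; rewrite -mulrBr.
  rewrite RintegralB//; last exact: (iG (fun z => g (z ord_max))).
  rewrite (Rintegral_skeleton_step G (fun j => r * g j)) -RintegralB//.
  - apply: eq_Rintegral => w _; rewrite -mulrBr; congr (_ * (_ - _)).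
    by rewrite mulr_sumr; apply: eq_bigr => j _; ring.
  - exact: (iG (fun z => \sum_j p h (z ord_max) j * (r * g j))).
  - exact: (iG (fun z => g (z ord_max))).
have iH := iG (fun z => r * (\sum_j p h (z ord_max) j * g j) - g (z ord_max)).
apply: le_trans (le_normr_Rintegral _ iH) _ => //.
rewrite -[leRHS](Rintegral_cst1 P); apply: le_Rintegral => //.
- exact: (@integrable_finite_range _ _ _ P _ _ (@measurable_skeleton_path n)
    (fun z => `|G z * (r * (\sum_j p h (z ord_max) j * g j) - g (z ord_max))|)).
- by apply: (@integrable_bounded _ _ _ _ _ `|r ^+ n * delta|).
- move=> w _; rewrite normrM ger0_norm; last by rewrite mulr_ge0// exprn_ge0.
  rewrite /G; case: (boolP [forall _, _]) => [/forallP H|_]; last first.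
    by rewrite mulr0 mul0r mulr_ge0// exprn_ge0.
  by rewrite mulr1 ler_wpM2l ?exprn_ge0// deltaP.
Qed.

(** As long as [b] is avoided, the mean of the next increment is at most [r ^+ n * delta] by
    [deltaP]; the geometric series makes the total error independent of [N]. *)
Lemma Rintegral_stopped_functional N : (exists i, i != b) ->
  `|\int[P]_w stopped_functional N w - g a| <= delta / (1 - r).
Proof.
move=> ib; have d0 := delta_ge0 ib; have /andP[r0 r1] := r_itv.
under eq_Rintegral do rewrite stopped_functionalE.
have mX0 i : measurable [set w | X (t 0) w = i] by exact: mX.
have [i1 i2] := Rintegral_sum (index_enum 'I_N) (fun n : 'I_N => increment_int n).
rewrite RintegralD//; last first.
  exact: (integrable_finite_range P mX0 g).
rewrite i2.
have -> : \int[P]_w g (X (t 0) w) = g a.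
  rewrite (Rintegral_finite_range P mX0 g) (bigD1 a)//= big1 ?addr0.
    by rewrite /t mul0r start mulr1.
  move=> i ia; rewrite [X in fine X](_ : _ = 0%E) ?mulr0//.
  apply/eqP; rewrite eq_le measure_ge0 andbT.
  have <- : P (~` [set w | X 0 w = a]) = 0%E.
    by rewrite probability_setC ?start ?subee//; exact: mX.
  apply: le_measure; rewrite ?inE//; first exact/measurableC/mX.
  by move=> w /=; rewrite /t mul0r => -> /eqP; rewrite (negbTE ia).
rewrite addrAC subrr add0r.
apply: le_trans (ler_norm_sum _ _ _) _.
apply: (@le_trans _ _ (\sum_(n < N) r ^+ n * delta)).
  by apply: ler_sum => n _; exact: Rintegral_increment.
rewrite -mulr_suml mulrC ler_wpM2l// -(@ler_pM2r _ (1 - r)) ?subr_gt0//.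
rewrite mulVf ?gt_eqF ?subr_gt0// mulrC -[1 - r]opprB mulNr -subrX1.
by rewrite opprB gerBl exprn_ge0.
Qed.

Lemma measurable_stopped_functional N : measurable_fun setT (stopped_functional N).
Proof.
have -> : stopped_functional N = fun w => g (X (t 0) w) +
    \sum_(n < N) increment (skeleton_path n w) (X (t n.+1) w).
  by apply/funext => w; exact: stopped_functionalE.
apply: measurable_funD.
  by apply: (@measurable_finite_range _ _ _ _ (X (t 0))) => i; exact: mX.
apply: measurable_sum => n.
exact: (@measurable_finite_range _ _ _ _
  (fun w => (skeleton_path n w, X (t n.+1) w)) (@measurable_pair n)
  (fun z => increment z.1 z.2)).
Qed.

End skeleton.

Section expR_bounds.
Context {R : realType}.
Implicit Type x : R.

Lemma expRN_ge x : 1 - x <= expR (- x).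
Proof. exact: expR_ge1Dx. Qed.

Lemma expRN_le x : 0 <= x -> expR (- x) <= (1 + x)^-1.
Proof.
move=> x0; rewrite expRN lef_pV2 ?expR_ge1Dx// posrE ?expR_gt0//.
by rewrite ltr_wpDr.
Qed.

Lemma expRN_le_sqr x : 0 <= x -> expR (- x) <= 1 - x + x ^+ 2.
Proof.
move=> x0; apply: le_trans (expRN_le x0) _.
have x1 : 0 < 1 + x by rewrite ltr_wpDr.
rewrite -(ler_pM2r x1) mulVf ?gt_eqF//.
have : 0 <= x ^+ 3 by rewrite exprn_ge0.
have -> : (1 - x + x ^+ 2) * (1 + x) = 1 + x ^+ 3 by ring.
lra.
Qed.

Lemma sub1_expRN_ge x : 0 <= x -> x / (1 + x) <= 1 - expR (- x).
Proof.
move=> x0; have := expRN_le x0; have x1 : 0 < 1 + x by rewrite ltr_wpDr.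
have -> : x / (1 + x) = 1 - (1 + x)^-1 by field; rewrite gt_eqF.
lra.
Qed.

Lemma expRN_lipschitz x y : 0 <= x -> 0 <= y ->
  expR (- x) - expR (- (x + y)) <= y.
Proof.
move=> x0 y0; rewrite opprD expRD -[X in X - _]mulr1 -mulrBr.
apply: (@le_trans _ _ (1 * y)); last by rewrite mul1r.
apply: ler_pM.
- exact: expR_ge0.
- by rewrite subr_ge0 -expR0 ler_expR oppr_le0.
- by rewrite -expR0 ler_expR oppr_le0.
- by have := expRN_ge y; lra.
Qed.

End expR_bounds.

(** * Hitting times and their Laplace transforms *)

Section hitting.
Context {R : realType} {S : finType} {d} {T : measurableType d}
  (P : probability T R) (X : R -> T -> S) (q : S -> S -> R) (a b : S).
Hypothesis HX : markov_process P X q.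
Hypothesis start : P [set w | X 0 w = a] = 1%E.
Hypothesis ab : a != b.

Let mX t i : 0 <= t -> measurable [set w | X t w = i].
Proof. by move=> t0; exact: (mp_measurable HX). Qed.

Lemma hitting_time_ge0 w : (0 <= hitting_time X b w)%E.
Proof.
by apply: le_ereal_inf_tmp => _ [t [t0 _] <-]; rewrite lee_fin ltW.
Qed.

Lemma hitting_time_lbound t w : 0 < t -> X t w = b ->
  (hitting_time X b w <= t%:E)%E.
Proof. by move=> t0 Xt; apply: ereal_inf_lbound; exists t. Qed.

Lemma visit_persists w t : 0 <= t -> X t w = b ->
  exists2 e, 0 < e & forall u, t < u < t + e -> X u w = b.
Proof.
move=> t0 Xt; have := mp_right_continuous HX w t0.
move=> /nbhs_ballP[e /= e0 eP]; exists e => // u /andP[tu ute].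
by rewrite -Xt; apply: eP => //; rewrite /ball /= ltr_norml; lra.
Qed.

(** By right continuity a visit to [b] lasts for an interval, so that rational times, or a fine
    enough grid, cannot miss it. *)
Lemma hitting_time_lt w y : (hitting_time X b w < y%:E)%E ->
  exists u e, [/\ 0 < u, 0 < e, u + e < y &
    forall v, u < v < u + e -> X v w = b].
Proof.
move=> /ereal_inf_lt[_ [u [u0 Xu] <-]]; rewrite lte_fin => uy.
have [e e0 eP] := visit_persists (ltW u0) Xu.
exists u, (Num.min e ((y - u) / 2)); split => //.
- by rewrite lt_min e0 divr_gt0// subr_gt0.
- have : Num.min e ((y - u) / 2) <= (y - u) / 2 by rewrite ge_min lexx orbT.
  lra.
- move=> v /andP[uv vu]; apply: eP; rewrite uv/=.
  have : Num.min e ((y - u) / 2) <= e by rewrite ge_min lexx.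
  lra.
Qed.

Lemma measurable_hitting_time : measurable_fun setT (hitting_time X b).
Proof.
apply: (measurability _ (ErealGenInftyO.measurableE R)) => _ /= -[_ [y ->] <-].
rewrite setTI.
have -> : hitting_time X b @^-1` `]-oo, y%:E[%classic =
    \bigcup_(r : rat) [set w |
      [&& 0 < (ratr r : R), (ratr r : R) < y & X (ratr r : R) w == b]].
  apply/seteqP; split => w /=; rewrite in_itv /=.
    move=> /hitting_time_lt[u [e [u0 e0 uey ueP]]].
    have [r] : exists r : rat, ratr r \in `]u, (u + e)[.
      by apply: rat_in_itvoo; lra.
    rewrite in_itv /= => /[dup] /ueP Xr /andP[ur rue].
    by exists r => //=; rewrite Xr eqxx andbT; apply/andP; split; lra.
  move=> [r _ /= /and3P[r0 ry /eqP Xr]].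
  by apply: le_lt_trans (hitting_time_lbound r0 Xr) _; rewrite lte_fin.
apply: bigcupT_measurable_rat => r.
have [/andP[r0 ry]|ry] := boolP (0 < (ratr r : R) < y); last first.
  rewrite (_ : [set w | _] = set0)//; apply/seteqP; split => w //=.
  by rewrite andbA (negbTE ry).
rewrite (_ : [set w | _] = [set w | X (ratr r) w = b]); last first.
  by apply/seteqP; split => w /=; rewrite r0 ry => /eqP.
by apply: mX; exact: ltW.
Qed.

Section laplace.
Variables (s : R) (g : S -> R).
Hypothesis s_gt0 : 0 < s.
Hypothesis gb : g b = 1.
Hypothesis gE : forall i, i != b -> \sum_j generator q i j * g j = s * g i.

(** The grid has mesh [2 ^- k] and covers [[0, k]]: refinement and a growing horizon are obtained
    from the same index. *)
Let h (k : nat) : R := 2^-1 ^+ k.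
Let r k := expR (- (s * h k)).
Let N k := (k * 2 ^ k)%N.

Let h_gt0 k : 0 < h k. Proof. by rewrite exprn_gt0// invr_gt0. Qed.

Let h_cvg : h k @[k --> \oo] --> 0.
Proof.
rewrite /h [X in X @ _](_ : _ = geometric 1 2^-1); last first.
  by apply/funext => k; rewrite /= mul1r.
by apply: cvg_geometric; rewrite ger0_norm// invf_lt1// ltr1n.
Qed.

Let r_itv k : 0 < r k < 1.
Proof. by rewrite expR_gt0 -expR0 ltr_expR oppr_lt0 mulr_gt0. Qed.

Let hN k : h k * (N k)%:R = k%:R.
Proof.
by rewrite /h /N natrM natrX mulrCA exprVn mulVf ?mulr1.
Qed.

Let hm k m : r k ^+ m = expR (- (s * (m%:R * h k))).
Proof. by rewrite /r -expRM_natl; congr expR; ring. Qed.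

Let U k w := stopped_functional X (h k) b g (r k) (N k) w.

Let M := \sum_i `|g i|.

Let gM i : `|g i| <= M.
Proof. by rewrite /M (bigD1 i)//= lerDl sumr_ge0. Qed.

Let U_bound k w : `|U k w| <= M.
Proof.
by apply: stopped_sum_bound => //; have /andP[/ltW -> /ltW ->] := r_itv k.
Qed.

Lemma stopped_functional_never w : X 0 w != b ->
  hitting_time X b w = +oo%E -> U k w @[k --> \oo] --> 0.
Proof.
move=> X0 Ty.
have nb t : 0 <= t -> X t w != b.
  rewrite le_eqVlt => /predU1P[<-//|t0]; apply/eqP => Xt.
  by have := hitting_time_lbound t0 Xt; rewrite Ty.
have Ub k : `|U k w| <= expR (- s) ^+ k * M.
  rewrite /U /stopped_functional stopped_sum_before; last first.
    by move=> m _; apply: nb; rewrite mulr_ge0// ltW.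
  rewrite normrM hm [X in s * X]mulrC hN ger0_norm ?expR_ge0// ler_pM ?expR_ge0//.
  by rewrite -expRM_natl mulrN mulrC.
apply/cvgr0Pnorm_lt => e e0.
have c0 : M * expR (- s) ^+ k @[k --> \oo] --> 0.
  by apply: cvg_geometric; rewrite ger0_norm ?expR_ge0// -expR0 ltr_expR oppr_lt0.
near=> k; rewrite (le_lt_trans (Ub k))// mulrC.
have : `|M * expR (- s) ^+ k| < e.
  by near: k; move/cvgr0Pnorm_lt : c0; apply.
by apply: le_lt_trans; exact: ler_norm.
Unshelve. all: by end_near. Qed.

(** The grid sees its first visit no earlier than [tau], and no later than [tau + e] once the mesh
    is shorter than an interval of visits that ends before [tau + e]. *)
Lemma stopped_functional_first_visit w tau e : X 0 w != b -> 0 < e ->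
  hitting_time X b w = tau%:E ->
  \forall k \near \oo, expR (- (s * (tau + e))) <= U k w <= expR (- (s * tau)).
Proof.
move=> X0 e0 Ttau.
have : (hitting_time X b w < (tau + e)%:E)%E by rewrite Ttau lte_fin ltrDl.
move=> /hitting_time_lt[u [eta [u0 eta0 ue uP]]].
near=> k.
have hk : h k < eta by near: k; exact: (cvgr_lt _ h_cvg).
have ke : u + eta <= k%:R by near: k; exact: nbhs_infty_ger.
pose m := (Num.truncn (u / h k)).+1.
have [m1 m2] : u < m%:R * h k /\ m%:R * h k < u + eta.
  have /andP[t1 t2] : (Num.truncn (u / h k))%:R <= u / h k < m%:R.
    by apply: Num.Theory.truncn_itv; rewrite divr_ge0 ?ltW.
  split; first by rewrite -ltr_pdivrMr.
  rewrite /m -natr1 mulrDl mul1r; apply: le_lt_trans (_ : u + h k < _).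
    by rewrite lerD2r -ler_pdivlMr.
  by rewrite ltrD2l.
have mN : (m <= N k)%N.
  rewrite -(ler_nat R) -(ler_pM2r (h_gt0 k)) [leRHS]mulrC hN.
  by rewrite (le_trans (ltW m2)).
have Xm : X (m%:R * h k) w == b by apply/eqP/uP; rewrite m1 m2.
have ex : exists m, X (m%:R * h k) w == b by exists m.
have [n /eqP Xn nmin] := ex_minnP ex.
(* Time 0 belongs to the grid, but the hitting time is an infimum over positive times only. *)
have n0 : (0 < n)%N.
  by rewrite lt0n; apply/eqP => n0; move: Xn X0; rewrite n0 mul0r => ->; rewrite eqxx.
have tn : tau <= n%:R * h k.
  rewrite -lee_fin -Ttau; apply: hitting_time_lbound => //.
  by rewrite mulr_gt0// ltr0n.
have nm : n%:R * h k <= m%:R * h k by rewrite ler_pM2r// ler_nat nmin.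
rewrite /U /stopped_functional (@stopped_sum_after _ _ _ _ _ gb _ n); last first.
- exact: Xn.
- by move=> j jn; apply/negP => /nmin; rewrite leqNgt jn.
- exact: leq_trans (nmin _ Xm) mN.
rewrite hm !ler_expR !lerN2 !ler_pM2l//; apply/andP; split => //; lra.
Unshelve. all: by end_near. Qed.

Lemma stopped_functional_cvg w : X 0 w != b ->
  U k w @[k --> \oo] --> exp_neg (s%:E * hitting_time X b w).
Proof.
move=> X0; have := hitting_time_ge0 w.
case E : (hitting_time X b w) => [tau| |] // => [tau0|_]; last first.
  by rewrite gt0_muley ?lte_fin//=; exact: stopped_functional_never.
have {}tau0 : 0 <= tau by rewrite lee_fin in tau0.
rewrite -EFinM /=; apply/cvgrPdist_le => e e0.
have es : 0 < e / s by rewrite divr_gt0.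
have := stopped_functional_first_visit X0 es E.
apply: filterS => k /andP[h1 h2].
have := @expRN_lipschitz _ (s * tau) e (mulr_ge0 (ltW s_gt0) tau0) (ltW e0).
have <- : s * (tau + e / s) = s * tau + e by field; rewrite gt_eqF.
by move=> h3; rewrite ger0_norm ?subr_ge0//; lra.
Qed.

(** At [u = 0] the function [exp (- s u) * P_u g] has derivative [Q g - s g], which vanishes off [b]
    by [gE]. *)
Let generator_approx (p : R -> S -> S -> R) i : has_rates p q -> i != b ->
  (expR (- (s * u)) * (\sum_j p u i j * g j) - g i) / u @[u --> 0^'+] --> 0.
Proof.
move=> pq ib.
have c1 : \sum_j ((p u i j - (i == j)%:R) / u) * g j @[u --> 0^'+] --> s * g i.
  rewrite -gE//; apply: cvg_big_sum => j _; apply: cvgM; last exact: cvg_cst.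
  exact: pq.
have c2 : (expR (- (s * u)) - 1) / u @[u --> 0^'+] --> - s.
  apply: (@squeeze_cvgr _ _ _ _ (fun=> - s) (fun u => - s + s ^+ 2 * u)).
  - near=> u; have u0 : 0 < u by near: u; exact: nbhs_right_gt.
    have su : 0 <= s * u by rewrite mulr_ge0// ltW.
    have := expRN_ge (s * u); have := expRN_le_sqr su.
    rewrite ler_pdivlMr// ler_pdivrMr// exprMn => h1 h2.
    apply/andP; split; lra.
  - exact: cvg_cst.
  - rewrite -[X in _ --> X]addr0; apply: cvgD; first exact: cvg_cst.
    rewrite -[X in _ --> X](mulr0 (s ^+ 2)); apply: cvgM; first exact: cvg_cst.
    exact/cvg_at_right_filter/cvg_id.
have c3 : expR (- (s * u)) @[u --> 0^'+] --> (1 : R).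
  apply: (@squeeze_cvgr _ _ _ _ (fun u => 1 - s * u) (fun u => 1)).
  - near=> u; have u0 : 0 < u by near: u; exact: nbhs_right_gt.
    by rewrite expRN_ge -expR0 ler_expR oppr_le0 mulr_ge0// ltW.
  - rewrite -[X in _ --> X]subr0; apply: cvgB; first exact: cvg_cst.
    rewrite -[X in _ --> X](mulr0 s); apply: cvgM; first exact: cvg_cst.
    exact/cvg_at_right_filter/cvg_id.
  - exact: cvg_cst.
have : expR (- (s * u)) * (\sum_j (p u i j - (i == j)%:R) / u * g j) +
    (expR (- (s * u)) - 1) / u * g i @[u --> 0^'+] --> 1 * (s * g i) + - s * g i.
  by apply: cvgD; apply: cvgM => //; exact: cvg_cst.
rewrite mul1r mulNr subrr; apply: cvg_trans; apply: near_eq_cvg.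
near=> u; have u0 : 0 < u by near: u; exact: nbhs_right_gt.
rewrite /=.
have -> : \sum_j (p u i j - (i == j)%:R) / u * g j =
    (\sum_j p u i j * g j - g i) / u.
  rewrite mulrBl mulr_suml (_ : g i / u = \sum_j (i == j)%:R / u * g j).
    by rewrite -sumrB; apply: eq_bigr => j _; ring.
  rewrite (bigD1 i)//= eqxx big1 ?addr0 => [|j ji].
    by rewrite mulr1n; ring.
  by rewrite eq_sym (negbTE ji) mul0r mul0r.
by field; rewrite gt_eqF.
Unshelve. all: by end_near. Qed.

Lemma Rintegral_stopped_cvg : \int[P]_w U k w @[k --> \oo] --> g a.
Proof.
have [p [_ pq pM]] := mp_markov HX.
pose delta u := \sum_(i | i != b) `|expR (- (s * u)) * (\sum_j p u i j * g j) - g i|.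
have deltaP u i : i != b ->
    `|expR (- (s * u)) * (\sum_j p u i j * g j) - g i| <= delta u.
  by move=> ib; rewrite /delta [leRHS](bigD1 i)//= lerDl sumr_ge0.
have c1 : delta (h k) / h k @[k --> \oo] --> 0.
  have c0 : delta u / u @[u --> 0^'+] --> 0.
    have c2 : \sum_(i | i != b)
       `|(expR (- (s * u)) * (\sum_j p u i j * g j) - g i) / u|
       @[u --> 0^'+] --> \sum_(i | i != b) `|0 : R|.
      by apply: cvg_big_sum => i ib; apply: cvg_norm; exact: generator_approx.
    rewrite normr0 big1 // in c2.
    apply: cvg_trans c2; apply: near_eq_cvg; near=> u.
    have u0 : 0 < u by near: u; exact: nbhs_right_gt.
    rewrite /delta mulr_suml.
    by apply: eq_bigr => i ib; rewrite normrM normfV (gtr0_norm u0).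
  by move/cvg_at_rightP : c0; apply.
(* [1 - r k] is at least of order [s * h k]. The error [delta (h k)] is negligible against [h k],
   hence still negligible after summation over a discounted horizon of about [1 / (s * h k)]
   steps. *)
have rh k : (1 - r k)^-1 <= (1 + s) / s / h k.
  have sh : 0 < s * h k by rewrite mulr_gt0.
  have h1 : h k <= 1 by rewrite exprn_ile1 ?invr_ge0// invf_le1 ?ler1n.
  have := sub1_expRN_ge (ltW sh); rewrite -/(r k) => H.
  have p1 : 0 < s * h k / (1 + s * h k) by rewrite divr_gt0// addr_gt0.
  apply: (@le_trans _ _ (s * h k / (1 + s * h k))^-1).
    by rewrite lef_pV2// posrE// (lt_le_trans p1).
  rewrite invf_div -mulrA -invfM ler_pM2r ?invr_gt0//.
  by rewrite lerD2l ger_pMr.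
have c3 : delta (h k) / (1 - r k) @[k --> \oo] --> 0.
  apply: (@squeeze_cvgr _ _ _ _ (fun=> 0)
    (fun k => (1 + s) / s * (delta (h k) / h k))).
  - near=> k; have d0 : 0 <= delta (h k) by apply: sumr_ge0.
    have /andP[_ r1] := r_itv k.
    rewrite mulr_ge0 ?invr_ge0 ?subr_ge0 ?(ltW r1)//=.
    rewrite [leRHS](_ : _ = delta (h k) * ((1 + s) / s / h k)); last by ring.
    by rewrite ler_wpM2l.
  - exact: cvg_cst.
  - rewrite -[X in _ --> X](mulr0 ((1 + s) / s)).
    by apply: cvgM => //; exact: cvg_cst.
apply/cvgrPdist_le => e e0; near=> k.
have H := Rintegral_stopped_functional (@mX) (h_gt0 k) pM start (r_itv k)
  (deltaP (h k)) (N k) (ex_intro _ a ab).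
rewrite distrC (le_trans H)//.
have : `|delta (h k) / (1 - r k)| <= e.
  by near: k; move/cvgr0Pnorm_le : c3; apply.
exact/le_trans/ler_norm.
Unshelve. all: by end_near. Qed.

Lemma laplace_hitting_time :
  \int[P]_w exp_neg (s%:E * hitting_time X b w) = g a.
Proof.
have [p [_ _ pM]] := mp_markov HX.
pose f w := (exp_neg (s%:E * hitting_time X b w))%:E.
have mf : measurable_fun setT f.
  apply/measurable_EFinP; apply: measurable_exp_neg.
  apply: emeasurable_funM => //; exact: measurable_hitting_time.
have mU k : measurable_fun setT (EFin \o U k).
  apply/measurable_EFinP.
  exact: (measurable_stopped_functional (@mX) (h_gt0 k) b g (r k) (N k)).
have iM : P.-integrable setT (EFin \o (cst M : T -> R)).
  by apply: (@integrable_bounded _ _ _ _ _ `|M|).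
have H1 : {ae P, forall w, setT w -> (EFin \o U n) w @[n --> \oo] --> f w}.
  exists [set w | X 0 w = b]; split.
  - exact: mX.
  - apply/eqP; rewrite eq_le measure_ge0 andbT.
    have <- : P (~` [set w | X 0 w = a]) = 0%E.
      by rewrite probability_setC ?start ?subee//; exact: mX.
    apply: le_measure; rewrite ?inE//; [exact: mX|exact/measurableC/mX|].
    by move=> w /= -> ba; move: ab; rewrite ba eqxx.
  - move=> w /= H; apply: contrapT => /eqP X0; apply: H => _.
    by apply: cvg_EFin; [near=> k | exact: stopped_functional_cvg].
have H2 : {ae P, forall w n, setT w -> (`|(EFin \o U n) w| <= (EFin \o cst M) w)%E}.
  by apply: aeW => w n _; rewrite lee_fin U_bound.
have [_ _ C] := dominated_convergence measurableT mU mf H1 iM H2.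
have C2 : \int[P]_w U k w @[k --> \oo] --> \int[P]_w exp_neg (s%:E * hitting_time X b w).
  have E : (\int[P]_w f w)%E = (\int[P]_w exp_neg (s%:E * hitting_time X b w))%:E.
    apply: EFin_Rintegral; apply: integrable_itv01; first exact/measurable_EFinP.
    move=> w; apply: exp_neg_itv01; apply: mule_ge0; last exact: hitting_time_ge0.
    by rewrite lee_fin ltW.
  by rewrite E in C; exact: (fine_cvg C).
by apply: (cvg_unique _ C2) => //; exact: Rintegral_stopped_cvg.
Unshelve. all: by end_near. Qed.

End laplace.
End hitting.

(** * Existence of the solution of the resolvent equation *)

Section resolvent.
Context {R : realType} {S : finType} (q : S -> S -> R) (b : S) (s : R).
Hypothesis q_ge0 : forall i j, 0 <= q i j.
Hypothesis s_gt0 : 0 < s.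
Implicit Type v : S -> R.

Lemma generator_sum v i :
  \sum_j generator q i j * v j = \sum_j q i j * (v j - v i).
Proof.
rewrite (bigD1 i)//= [RHS](bigD1 i)//= subrr mulr0 add0r {1}/generator eqxx.
rewrite mulNr mulr_suml -sumrN -big_split/=; apply: eq_bigr => j ji.
by rewrite /generator eq_sym (negbTE ji); ring.
Qed.

(** Minimum principle: at a negative minimum, which cannot be at [b], the generator gives a
    nonnegative value whereas [s * v] is negative. *)
Lemma resolvent_ge0 v : 0 <= v b ->
  (forall i, i != b -> \sum_j generator q i j * v j = s * v i) ->
  forall i, 0 <= v i.
Proof.
move=> vb vE i; case: (arg_minP (P := xpredT) v (isT : xpredT b)) => m _ mmin.
rewrite (le_trans _ (mmin i isT))// leNgt; apply/negP => vm.
have mb : m != b by apply: contraTneq vm => ->; rewrite -leNgt.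
have := vE _ mb; rewrite generator_sum => E.
have : s * v m < 0 by rewrite pmulr_rlt0.
rewrite -E ltNge => /negP; apply; apply: sumr_ge0 => j _.
by rewrite mulr_ge0// subr_ge0 mmin.
Qed.

(** The boundary condition and the equations [s v - Q v = 0] in one square matrix. The unknown is a
    row vector, so the equation at a state is a column. *)
Let A : 'M[R]_#|S| := \matrix_(y, x)
  let i := enum_val x in let j := enum_val y in
  if i == b then (j == b)%:R else s * (i == j)%:R - generator q i j.

Let mulA (u : 'rV[R]_#|S|) i : (u *m A) 0 (enum_rank i) =
  let v j := u 0 (enum_rank j) in
  if i == b then v b else s * v i - \sum_j generator q i j * v j.
Proof.
rewrite mxE (reindex (@enum_rank S)) /=; last exact/onW_bij/enum_rank_bij.
under eq_bigr do rewrite mxE !enum_rankK.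
have delta k : \sum_j u 0 (enum_rank j) * (k == j)%:R = u 0 (enum_rank k).
  rewrite (bigD1 k)//= eqxx mulr1 big1 ?addr0// => j jk.
  by rewrite eq_sym (negbTE jk) mulr0.
rewrite /=; case: ifPn => [_|ib].
  by rewrite -[RHS]delta; apply: eq_bigr => j _; rewrite eq_sym.
rewrite -[X in s * X]delta mulr_sumr -sumrB; apply: eq_bigr => j _; ring.
Qed.

(** A vector in the kernel vanishes at [b]; the minimum principle applied to it and to its opposite
    shows that it is 0. *)
Let A_unit : A \in unitmx.
Proof.
rewrite -row_free_unit -kermx_eq0; apply/rowV0P => u /sub_kermxP uA.
pose v j := u 0 (enum_rank j).
have vE i : i != b -> \sum_j generator q i j * v j = s * v i.
  move=> ib; have := mulA u i; rewrite uA mxE /= (negbTE ib) => /esym/eqP.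
  by rewrite subr_eq0 => /eqP.
have vb : v b = 0 by have := mulA u b; rewrite uA mxE /= eqxx.
have v0 i : v i = 0.
  apply/eqP; rewrite eq_le; apply/andP; split; last first.
    by apply: resolvent_ge0 vE _; rewrite vb.
  rewrite -oppr_ge0; apply: (@resolvent_ge0 (fun j => - v j)) => [|j jb].
    by rewrite vb oppr0.
  rewrite mulrN -vE// -sumrN; apply: eq_bigr => k _; exact: mulrN.
by apply/rowP => x; rewrite mxE -(enum_valK x); exact: v0.
Qed.

Lemma resolvent_exists : exists v : S -> R,
  [/\ v b = 1, forall i, 0 <= v i &
      forall i, i != b -> \sum_j q i j * (v j - v i) = s * v i].
Proof.
pose e : 'rV[R]_#|S| := delta_mx 0 (enum_rank b).
pose u := e *m invmx A.
have uA : u *m A = e by rewrite mulmxKV.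
pose v j := u 0 (enum_rank j).
have vb : v b = 1.
  by have := mulA u b; rewrite uA mxE /= !eqxx => /esym.
have vE i : i != b -> \sum_j generator q i j * v j = s * v i.
  move=> ib; have := mulA u i; rewrite uA mxE /= (negbTE ib) ?eqxx/=.
  rewrite (can_eq enum_rankK) (negbTE ib) => /esym/eqP.
  by rewrite subr_eq0 => /eqP.
exists v; split => // [i|i ib].
  by apply: resolvent_ge0 vE _; rewrite vb.
by rewrite -generator_sum vE.
Qed.

End resolvent.

(** * Expectations from Laplace transforms near 0 *)

Section expectation.
Context {R : realType} {d} {T : measurableType d} (P : probability T R)
  (V : T -> \bar R).
Hypothesis mV : measurable_fun setT V.
Hypothesis V_ge0 : forall w, (0 <= V w)%E.

Let phi (s : R) := \int[P]_w exp_neg (s%:E * V w).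

Let quot (s : R) w := (1 - exp_neg (s%:E * V w)) / s.

Let mexp s : measurable_fun setT (fun w => exp_neg (s%:E * V w)).
Proof.
apply: (@measurable_exp_neg _ _ _ (fun w => (s%:E * V w)%E)).
exact: emeasurable_funM.
Qed.

Let exp01 s w : 0 < s -> 0 <= exp_neg (s%:E * V w) <= 1.
Proof. by move=> s0; rewrite exp_neg_itv01// mule_ge0// lee_fin ltW. Qed.

Let quot_ge0 s w : 0 < s -> 0 <= quot s w.
Proof.
by move=> s0; rewrite divr_ge0 ?(ltW s0)// subr_ge0; case/andP: (exp01 w s0).
Qed.

Let mquot s : measurable_fun setT (quot s).
Proof. by apply: measurable_funM => //; apply: measurable_funB. Qed.

Let integral_quot s : 0 < s -> (\int[P]_w (quot s w)%:E)%E = ((1 - phi s) / s)%:E.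
Proof.
move=> s0.
have i1 : P.-integrable setT (EFin \o (fun w => exp_neg (s%:E * V w))).
  by apply: integrable_itv01 => // w; exact: exp01.
have i0 : P.-integrable setT (EFin \o (cst 1 : T -> R)).
  by apply: integrable_itv01 => // w; rewrite ler01 lexx.
rewrite EFin_Rintegral; last first.
  apply: (@integrable_bounded _ _ _ _ _ s^-1) => // w.
  rewrite ger0_norm ?quot_ge0// -[leRHS]mul1r ler_pM2r ?invr_gt0//.
  by rewrite gerBl; case/andP: (exp01 w s0).
congr EFin; rewrite RintegralZr//; last first.
  have := integrableB measurableT i0 i1.
  by apply: eq_integrable => // w _; rewrite /= EFinB.
by rewrite RintegralB// Rintegral_cst1.
Qed.

Lemma expectation_ge (s : R) : 0 < s -> (((1 - phi s) / s)%:E <= \int[P]_w V w)%E.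
Proof.
move=> s0; rewrite -integral_quot//; apply: ge0_le_integral => //.
- by move=> w _; rewrite lee_fin quot_ge0.
- exact/measurable_EFinP.
- move=> w _; rewrite /quot; have := V_ge0 w.
  case: (V w) => [t| |] //= t0; last by rewrite leey.
  rewrite lee_fin ler_pdivrMr//.
  by have := expRN_ge (s * t); lra.
Qed.

(** Fatou's lemma along [s = 1 / (n + 1)]. The quotients tend to [V] pointwise, also where [V] is
    infinite, since they equal [n + 1] there; the bound therefore proves that the expectation is
    finite. *)
Lemma expectation_le (B : R) : (forall s, 0 < s -> (1 - phi s) / s <= B) ->
  (\int[P]_w V w <= B%:E)%E.
Proof.
move=> phiB; pose s (n : nat) : R := n.+1%:R^-1.
have s0 n : 0 < s n by rewrite invr_gt0 ltr0n.
pose f n w := (quot (s n) w)%:E.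
have sc : s n @[n --> \oo] --> (0 : R) by exact: cvg_harmonic.
have fV w : f n w @[n --> \oo] --> V w.
  rewrite /f /quot; have := V_ge0 w; case: (V w) => [t| |] // t0.
    apply: cvg_EFin; first by near=> n.
    apply: (@squeeze_cvgr _ _ _ _ (fun n => t - s n * t ^+ 2) (fun=> t)).
    - near=> n; rewrite /=; move: (s n) (s0 n) => c c0.
      have st : 0 <= c * t by rewrite mulr_ge0 ?(ltW c0)// -lee_fin.
      rewrite ler_pdivlMr// ler_pdivrMr//.
      have := expRN_ge (c * t); have := expRN_le_sqr st.
      by rewrite exprMn => h1 h2; apply/andP; split; lra.
    - rewrite -[X in _ --> X]subr0; apply: cvgB; first exact: cvg_cst.
      by rewrite -[X in _ --> X](mul0r (t ^+ 2)); apply: cvgM => //; exact: cvg_cst.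
    - exact: cvg_cst.
  have -> : (fun n => ((1 - exp_neg ((s n)%:E * +oo)) / s n)%:E) =
      (fun n => n.+1%:R%:E).
    apply/funext => n; rewrite gt0_muley ?lte_fin//= subr0 mul1r.
    by rewrite /s invrK.
  apply/cvgeryP; apply/cvgryPge => r; near=> n.
  rewrite (le_trans (y := n%:R)) ?ler_nat//.
  by near: n; exact: nbhs_infty_ger.
have -> : (\int[P]_w V w = \int[P]_w limn_einf (f ^~ w))%E.
  apply: eq_integral => w _; apply/esym.
  by rewrite is_cvg_limn_einfE; [exact/cvg_lim | apply/cvg_ex; exists (V w)].
apply: (le_trans (fatou _ _ _ _)) => //.
- by move=> n; exact/measurable_EFinP.
- by move=> n w _; rewrite lee_fin quot_ge0.
rewrite limn_einf_lim; apply: lime_le; first exact: is_cvg_einfs.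
near=> n; apply: (@le_trans _ _ (\int[P]_w f n w)%E).
  by apply: ereal_inf_lbound; exists n => /=.
by rewrite integral_quot// lee_fin phiB.
Unshelve. all: by end_near. Qed.

End expectation.

(** * The star graph *)

Section weights.
Context {R : realType} (L : nat) (F : R).
Hypothesis F_ge1 : 1 <= F.

(* The reversible weights of an Ehrenfest urn with [L] balls. *)
Definition weight n : R := 'C(L, n)%:R * F ^+ n.

Let F_ge0 : 0 <= F. Proof. exact: le_trans ler01 F_ge1. Qed.

Lemma weight_ge0 n : 0 <= weight n.
Proof. by rewrite mulr_ge0 ?exprn_ge0. Qed.

(** Detailed balance across the edge from [n] to [n.+1]. *)
Lemma weight_balance n :
  (L - n)%:R * F * weight n = n.+1%:R * weight n.+1.
Proof.
rewrite /weight exprS [RHS]mulrA -natrM mul_bin_left natrM; ring.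
Qed.

(** The left factor comes from [(n + 1) * C(L, n + 1) = L * C(L - 1, n)]. It bounds below the
    conductance of an edge, and so turns bounds on fluxes into bounds on differences of [u]. *)
Lemma weight_flux_ge n : (n < L)%N ->
  L%:R * F ^+ n.+1 <= n.+1%:R * weight n.+1.
Proof.
move=> nL; rewrite /weight mulrA -natrM -mul_bin_diag.
rewrite ler_wpM2r ?exprn_ge0// ler_nat leq_pmulr// bin_gt0; lia.
Qed.

Lemma sum_weight : \sum_(1 <= j < L.+1) weight j = (1 + F) ^+ L - 1.
Proof.
rewrite exprDn -(big_mkord xpredT (fun i => 1 ^+ (L - i) * F ^+ i *+ 'C(L, i))).
rewrite [in RHS]big_ltn// bin0 !expr0 expr1n mulr1 mulr1n addrAC subrr add0r.
by apply: eq_bigr => i _; rewrite /weight expr1n mul1r mulr_natl.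
Qed.

Lemma sum_weight_le n : \sum_(1 <= j < n.+1) weight j <= 2 ^+ L * F ^+ n.
Proof.
have -> : 2 ^+ L = \sum_(0 <= j < L.+1) 'C(L, j)%:R :> R.
  rewrite (_ : 2 = 1 + 1 :> R)// exprDn big_mkord; apply: eq_bigr => i _.
  by rewrite !expr1n mulr1.
apply: (@le_trans _ _ (\sum_(1 <= j < n.+1) 'C(L, j)%:R * F ^+ n)).
  apply: ler_sum_nat => j /andP[_ jn].
  by rewrite ler_wpM2l// ler_weXn2l.
rewrite -mulr_suml ler_wpM2r ?exprn_ge0//.
apply: (@le_trans _ _ (\sum_(0 <= j < n.+1) 'C(L, j)%:R)).
  by rewrite [leRHS]big_ltn// lerDr.
have [nL|Ln] := leqP n L.
  by rewrite [leRHS](@big_cat_nat _ _ _ n.+1)//= lerDl sumr_ge0.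
rewrite (@big_cat_nat _ _ _ L.+1)//= 1?leqW// [X in _ + X]big_nat [X in _ + X]big1 ?addr0//.
by move=> j /andP[Lj _]; rewrite bin_small.
Qed.

End weights.

(** * The resolvent equation on a single branch *)

Section branch.
Context {R : realType} (L : nat) (F s : R) (u : nat -> R).
Hypothesis L_gt0 : (0 < L)%N.
Hypothesis F_ge1 : 1 <= F.
Hypothesis s_gt0 : 0 < s.
Hypothesis u_ge0 : forall n, 0 <= u n.

Local Notation w := (weight L F).

Definition branch_mean : R := ((1 + F) ^+ L - 1) / (L%:R * F).
(** Relative loss of [u] beyond the first edge: fewer than [L] steps, each at most [1 / F] times the
    first drop. *)
Definition branch_eps : R := L%:R / F.

Let F_gt0 : 0 < F. Proof. exact: lt_le_trans ltr01 F_ge1. Qed.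
Let LF_gt0 : 0 < L%:R * F. Proof. by rewrite mulr_gt0 ?ltr0n. Qed.

(** At the tip [n = L] the first coefficient is 0, so the equation is independent of the value of
    [u] past the branch. *)
Definition branch_balance n :=
  (L - n)%:R * F * (u n.+1 - u n) + n%:R * (u n.-1 - u n) = s * u n.

Lemma branch_mean_ge0 : 0 <= branch_mean.
Proof.
rewrite divr_ge0 ?(ltW LF_gt0)// subr_ge0 exprn_ege1// lerDl; exact: ltW.
Qed.

Lemma branch_eps_ge0 : 0 <= branch_eps.
Proof. by rewrite divr_ge0// ltW. Qed.

Section outside_target.
Hypothesis bal : forall n, (0 < n <= L)%N -> branch_balance n.

(* The sum of the balance equations beyond the edge [(n, n.+1)], weighted by
   the reversible weights. *)
Lemma branch_flux n : (n <= L)%N ->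
  (L - n)%:R * F * w n * (u n - u n.+1) = s * \sum_(n.+1 <= j < L.+1) w j * u j.
Proof.
(* Induction on the distance [k] to the tip, where the flux is 0. *)
move=> nL; have [k E] : exists k, (n + k = L)%N by exists (L - n)%N; lia.
elim: k n nL E => [|k IH] n nL E.
  rewrite big_geq; last lia.
  by rewrite (_ : L - n = 0)%N ?mul0r ?mulr0//; lia.
rewrite big_ltn; last lia.
rewrite [RHS]mulrDr -(IH n.+1); [|lia|lia].
rewrite (weight_balance L F n).
have := @bal n.+1; rewrite /branch_balance /= => /(_ ltac:(lia)) B.
have {B} : w n.+1 * ((L - n.+1)%:R * F * (u n.+2 - u n.+1) +
  n.+1%:R * (u n - u n.+1)) = w n.+1 * (s * u n.+1) by rewrite B.
set a := (L - n.+1)%:R; set b := n.+1%:R; move=> B.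
have -> : s * (w n.+1 * u n.+1) = w n.+1 * (s * u n.+1) by ring.
by rewrite -B; ring.
Qed.

Let sum_ge0 n : 0 <= \sum_(n <= j < L.+1) w j * u j.
Proof.
by apply: sumr_ge0 => j _; rewrite mulr_ge0// weight_ge0.
Qed.

Let coef_gt0 n : (n < L)%N -> 0 < (L - n)%:R * F * w n.
Proof.
move=> nL; rewrite weight_balance; apply: lt_le_trans (weight_flux_ge F_ge1 nL).
by rewrite mulr_gt0 ?ltr0n// exprn_gt0.
Qed.

Lemma branch_decreasing n : (n < L)%N -> u n.+1 <= u n.
Proof.
move=> nL; rewrite -subr_ge0 -(pmulr_rge0 _ (coef_gt0 nL)) branch_flux 1?ltnW//.
by rewrite mulr_ge0// ltW.
Qed.

Lemma branch_le n m : (n <= m <= L)%N -> u m <= u n.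
Proof.
move=> /andP[nm mL]; have [k E] : exists k, (n + k = m)%N by exists (m - n)%N; lia.
elim: k m {nm} mL E => [|k IH] m mL E; first by rewrite -E addn0.
rewrite (_ : m = (n + k).+1) in mL *; last lia.
by apply: le_trans (IH _ _ (erefl _)); [apply: branch_decreasing; lia | lia].
Qed.

Let x := u 0%N - u 1%N.

Let flux0 : L%:R * F * x = s * \sum_(1 <= j < L.+1) w j * u j.
Proof.
by have := branch_flux (leq0n L); rewrite subn0 /weight bin0 expr0 !mulr1.
Qed.

Lemma branch_drop_ge0 : 0 <= x.
Proof. by rewrite subr_ge0 branch_decreasing. Qed.

(** The flux across the first edge is [s] times the weighted sum of [u], and the weights sum to
    [L * F * branch_mean]. As [u] decreases, each value is at most [u 1]. *)
Lemma branch_drop_le : x <= s * branch_mean * (u 0%N - x).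
Proof.
have -> : u 0%N - x = u 1%N by rewrite /x opprB addrC subrK.
rewrite -(ler_pM2l LF_gt0) flux0 /branch_mean -sum_weight.
have -> : forall S : R, L%:R * F * (s * (S / (L%:R * F)) * u 1%N) = s * (S * u 1%N).
  by move=> S; field; rewrite gt_eqF//= pnatr_eq0 -lt0n L_gt0.
rewrite ler_pM2l// mulr_suml; apply: ler_sum_nat => j /andP[j1 jL].
by rewrite ler_wpM2l ?weight_ge0// branch_le//; lia.
Qed.

(** The flux across a later edge is at most the flux [L * F * x] across the first one, while its
    conductance is at least [L * F ^+ 2]; each further step thus loses at most [x / F]. *)
Lemma branch_loss n : (0 < n <= L)%N -> u 1%N - branch_eps * x <= u n.
Proof.
move=> nL.
have step j : (0 < j < L)%N -> u j - u j.+1 <= x / F.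
  move=> /andP[j0 jL].
  have h : L%:R * F ^+ j.+1 * (u j - u j.+1) <= L%:R * F * x.
    rewrite flux0; apply: (@le_trans _ _ ((L - j)%:R * F * w j * (u j - u j.+1))).
      rewrite ler_wpM2r ?subr_ge0 ?branch_decreasing// weight_balance.
      exact: weight_flux_ge.
    rewrite branch_flux 1?ltnW// ler_pM2l// [leRHS](@big_cat_nat _ _ _ j.+1)//=; last lia.
    by rewrite lerDr sumr_ge0// => i _; rewrite mulr_ge0// weight_ge0.
  rewrite ler_pdivlMr// -(ler_pM2l LF_gt0); apply: le_trans h.
  rewrite mulrCA [leLHS](_ : _ = L%:R * F ^+ 2 * (u j - u j.+1)); last ring.
  rewrite ler_wpM2r ?subr_ge0 ?branch_decreasing//.
  by rewrite ler_wpM2l// ler_weXn2l.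
have : u 1%N - u n <= n.-1%:R * (x / F).
  elim: n nL => [|[|n] IH] // nL; first by rewrite subrr mul0r.
  have := IH ltac:(lia); have := step n.+1 ltac:(lia).
  by rewrite /= -[n.+1%:R]natr1; lra.
have : n.-1%:R * (x / F) <= L%:R * (x / F).
  rewrite ler_wpM2r ?divr_ge0 ?branch_drop_ge0 ?(ltW F_gt0)// ler_nat; lia.
rewrite (_ : L%:R * (x / F) = branch_eps * x); last by rewrite /branch_eps; ring.
lra.
Qed.

(** In the flux across the first edge every value is now bounded below by the one at the tip, which
    [branch_loss] keeps close to [u 1]. *)
Lemma branch_drop_ge :
  s * branch_mean * (u 0%N - (1 + branch_eps) * x) <= x.
Proof.
apply: (@le_trans _ _ (s * branch_mean * u L)).
  rewrite ler_wpM2l//.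
    by apply: mulr_ge0; [exact: ltW | exact: branch_mean_ge0].
  have := @branch_loss L; rewrite L_gt0 leqnn => /(_ isT).
  by rewrite /x; lra.
rewrite -(ler_pM2l LF_gt0) flux0 /branch_mean -sum_weight.
have -> : forall S : R, L%:R * F * (s * (S / (L%:R * F)) * u L) = s * (S * u L).
  by move=> S; field; rewrite gt_eqF//= pnatr_eq0 -lt0n L_gt0.
rewrite ler_pM2l// mulr_suml; apply: ler_sum_nat => j /andP[j1 jL].
by rewrite ler_wpM2l ?weight_ge0// branch_le//; lia.
Qed.

Lemma branch_value n : (0 < n <= L)%N ->
  u 0%N - (1 + branch_eps) * x <= u n <= u 0%N - x.
Proof.
move=> nL; have -> : u 0%N - x = u 1%N by rewrite /x opprB addrC subrK.
rewrite branch_le ?andbT; last lia.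
by have := branch_loss nL; rewrite /x; lra.
Qed.

End outside_target.

Section towards_target.
Variable n2 : nat.
Hypothesis n2_gt0 : (0 < n2 <= L)%N.
Hypothesis bal : forall n, (0 < n < n2)%N -> branch_balance n.
Hypothesis u_n2 : u n2 = 1.
Let Phi := L%:R * F * (u 1%N - u 0%N).
Hypothesis Phi_ge0 : 0 <= Phi.

(** Cost of the walk from the centre to the target along its branch: at most [L] steps, each adding
    [2 ^+ L / F] per unit of [s]. *)
Definition target_error : R := L%:R * 2 ^+ L / F.

(** Here the equations are summed from the centre outwards, because they are available only before
    the target. *)
Let target_flux n : (n < n2)%N ->
  (L - n)%:R * F * w n * (u n.+1 - u n) =
  Phi + s * \sum_(1 <= j < n.+1) w j * u j.
Proof.
elim: n => [|n IH] nn2.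
  by rewrite big_geq// subn0 /weight bin0 expr0 /Phi; ring.
rewrite big_nat_recr//= [X in _ = _ + X]mulrDr addrA -IH; last lia.
rewrite (weight_balance L F n).
have := @bal n.+1; rewrite /branch_balance /= => /(_ ltac:(lia)) B.
have -> : s * (w n.+1 * u n.+1) = w n.+1 * (s * u n.+1) by ring.
rewrite -B; ring.
Qed.

Let flux_ge0 n : 0 <= Phi + s * \sum_(1 <= j < n.+1) w j * u j.
Proof.
rewrite addr_ge0// mulr_ge0 ?(ltW s_gt0)//.
by apply: sumr_ge0 => j _; rewrite mulr_ge0// weight_ge0.
Qed.

Let coef_ge n : (n < n2)%N -> L%:R * F ^+ n.+1 <= (L - n)%:R * F * w n.
Proof. by move=> nn2; rewrite weight_balance weight_flux_ge//; lia. Qed.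

Let step_ge0 n : (n < n2)%N -> 0 <= u n.+1 - u n.
Proof.
move=> nn2; have c0 : 0 < (L - n)%:R * F * w n.
  by apply: lt_le_trans (coef_ge nn2); rewrite mulr_gt0 ?ltr0n ?exprn_gt0.
by rewrite -(pmulr_rge0 _ c0) target_flux.
Qed.

Let u_le1 n : (n <= n2)%N -> u n <= 1.
Proof.
move=> nn2; have [k E] : exists k, (n + k = n2)%N by exists (n2 - n)%N; lia.
elim: k n nn2 E => [|k IH] n nn2 E; first by rewrite -u_n2 -E addn0.
have := @step_ge0 n ltac:(lia); have := IH n.+1 ltac:(lia) ltac:(lia); lra.
Qed.

Let step_le n : (0 < n < n2)%N ->
  u n.+1 - u n <= (Phi / (L%:R * F) + s * 2 ^+ L) / F.
Proof.
move=> /andP[n0 nn2].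
have c0 : 0 < L%:R * F ^+ n.+1 by rewrite mulr_gt0 ?ltr0n ?exprn_gt0.
have h1 : L%:R * F ^+ n.+1 * (u n.+1 - u n) <= Phi + s * (2 ^+ L * F ^+ n).
  apply: (@le_trans _ _ ((L - n)%:R * F * w n * (u n.+1 - u n))).
    by rewrite ler_wpM2r ?step_ge0// coef_ge.
  rewrite target_flux// lerD2l ler_pM2l//; apply: le_trans (sum_weight_le L F_ge1 n).
  apply: ler_sum_nat => j /andP[j0 jn]; rewrite -[leRHS]mulr1 ler_wpM2l ?weight_ge0//.
  by apply: u_le1; lia.
rewrite -(ler_pM2l c0); apply: (le_trans h1).
have -> : L%:R * F ^+ n.+1 * ((Phi / (L%:R * F) + s * 2 ^+ L) / F) =
    Phi * (F ^+ n / F) + L%:R * (s * (2 ^+ L * F ^+ n)).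
  by rewrite exprS; field; rewrite gt_eqF//= pnatr_eq0 -lt0n L_gt0.
have Fn : 1 <= F ^+ n / F.
  by rewrite ler_pdivlMr// mul1r -{1}[F]expr1 ler_weXn2l.
have L1 : 1 <= L%:R :> R by rewrite ler1n.
apply: lerD; first by rewrite -[leLHS]mulr1 ler_wpM2l.
rewrite -[leLHS]mul1r ler_wpM2r// mulr_ge0 ?(ltW s_gt0)// mulr_ge0 ?exprn_ge0//.
exact: ltW.
Qed.

Lemma target_le : Phi / (L%:R * F) <= 1 - u 0%N.
Proof.
have -> : Phi / (L%:R * F) = u 1%N - u 0%N.
  by rewrite /Phi mulrAC mulfV ?mul1r// gt_eqF.
by rewrite lerD2r u_le1//; lia.
Qed.

(** The first edge contributes [Phi / (L%:R * F)], and [step_le] bounds each of the remaining steps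
    up to the target, where [u] is 1. *)
Lemma target_ge :
  1 - u 0%N <= Phi / (L%:R * F) * (1 + branch_eps) + s * target_error.
Proof.
pose B := (Phi / (L%:R * F) + s * 2 ^+ L) / F.
have B0 : 0 <= B.
  rewrite divr_ge0 ?(ltW F_gt0)// addr_ge0 ?divr_ge0 ?(ltW LF_gt0)//.
  by rewrite mulr_ge0 ?exprn_ge0 ?(ltW s_gt0).
have E1 : Phi / (L%:R * F) = u 1%N - u 0%N.
  by rewrite /Phi mulrAC mulfV ?mul1r// gt_eqF.
have H n : (0 < n <= n2)%N -> u n - u 1%N <= n.-1%:R * B.
  elim: n => [|[|n] IH] // nL; first by rewrite subrr mul0r.
  have := IH ltac:(lia); have := @step_le n.+1 ltac:(lia).
  by rewrite /= -[n.+1%:R]natr1 -/B; lra.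
have n22 : (0 < n2 <= n2)%N by lia.
have := H _ n22; rewrite u_n2.
have : n2.-1%:R * B <= L%:R * B by rewrite ler_wpM2r// ler_nat; lia.
have -> : L%:R * B = Phi / (L%:R * F) * branch_eps + s * target_error.
  rewrite /B /branch_eps /target_error; ring.
rewrite E1; lra.
Qed.

End towards_target.

End branch.

(** * Gluing the branches at the centre *)

Section star.
Context {R : realType} {K : nat} (L : 'I_K -> nat) (F : 'I_K -> R) (s : R).
Hypothesis L_gt0 : forall k, (0 < L k)%N.
Hypothesis F_ge1 : forall k, 1 <= F k.
Hypothesis s_gt0 : 0 < s.
Implicit Type g : state L -> R.

Lemma rate_ge0 (i j : state L) : 0 <= rate F i j.
Proof.
have F0 k : 0 <= F k by exact: le_trans ler01 (F_ge1 k).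
case: i j => [[k l]|] [[k' l']|] //=; do ?[case: ifP => // _]; rewrite ?mulr_ge0//.
Qed.

(* The values of [g] along branch [k], indexed by the distance to the centre
   (junk value 0 beyond the end of the branch). *)
Definition along g k n : R :=
  if n is m.+1 then
    if insub m : option 'I_(L k) is Some l then g (at_branch l) else 0
  else g None.

Arguments along : simpl never.

Lemma along_at_branch g k (l : 'I_(L k)) : along g k l.+1 = g (at_branch l).
Proof. by rewrite /along /= insubT //= => ?; congr (g (at_branch _)); exact: val_inj. Qed.

Lemma along_ge0 g k n : (forall i, 0 <= g i) -> 0 <= along g k n.
Proof. by move=> g0; rewrite /along; case: n => //= n; case: insubP. Qed.

Lemma sum_state (h : state L -> R) :
  \sum_i h i = h None + \sum_k \sum_(l < L k) h (at_branch l).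
Proof.
rewrite (bigD1 None)//=; congr (_ + _).
rewrite (reindex_omap Some id) => [|[p|]]//=.
rewrite (sig_big_dep _ _ (fun k l => h (at_branch l)))/=.
by apply: eq_big => [p|[k l] _]; rewrite ?eqxx.
Qed.

Lemma rate_row_centre g :
  \sum_j rate F None j * (g j - g None) =
  \sum_k (L k)%:R * F k * (along g k 1 - g None).
Proof.
rewrite sum_state mul0r add0r; apply: eq_bigr => k _.
pose l0 := Ordinal (L_gt0 k).
rewrite (bigD1 l0)//= big1 ?addr0 => [|l ll0].
  by rewrite -(along_at_branch g l0).
by rewrite ifF ?mul0r//; apply/negbTE.
Qed.

Lemma rate_row_branch g k (l : 'I_(L k)) :
  \sum_j rate F (at_branch l) j * (g j - g (at_branch l)) =
  (L k - l.+1)%:R * F k * (along g k l.+2 - along g k l.+1) +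
  l.+1%:R * (along g k l - along g k l.+1).
Proof.
rewrite sum_state (bigD1 k)//= [X in _ + (_ + X)]big1 ?addr0 => [|k' kk']; last first.
  by apply: big1 => l' _; rewrite eq_sym kk' mul0r.
rewrite eqxx /=.
pose up l' : R := if l' == l.+1 :> nat
  then (L k - l.+1)%:R * F k * (along g k l'.+1 - along g k l.+1) else 0.
pose down l' : R := if l == l'.+1 :> nat
  then l.+1%:R * (along g k l'.+1 - along g k l.+1) else 0.
have -> : \sum_(l' < L k) (if l' == l.+1 :> nat then (L k - l.+1)%:R * F k
      else if l == l'.+1 :> nat then l.+1%:R else 0) *
      (g (at_branch l') - g (at_branch l)) =
    \sum_(l' < L k) up l' + \sum_(l' < L k) down l'.
  rewrite -big_split; apply: eq_bigr => l' _; rewrite /up /down !along_at_branch.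
  rewrite /=; case: eqP => [->|_]; last by case: eqP => _; rewrite add0r// mul0r.
  by rewrite ifF ?addr0//; apply/negbTE; lia.
have -> : \sum_(l' < L k) up l' =
    (L k - l.+1)%:R * F k * (along g k l.+2 - along g k l.+1).
  have [lL|Ll] := ltnP l.+1 (L k).
    rewrite (bigD1 (Ordinal lL))//= big1 ?addr0 => [|l' ll']; first by rewrite /up eqxx.
    by rewrite /up ifF//; apply/negbTE; move: ll'; rewrite -val_eqE.
  rewrite (_ : L k - l.+1 = 0)%N ?mul0r; last lia.
  apply: big1 => l' _; rewrite /up ifF//; apply/negbTE; have := ltn_ord l'; lia.
rewrite -!along_at_branch addrCA; congr (_ + _).
(* For [l = 0] the lower neighbour is the centre, whose term stands outside the sum over the
   branch. *)
have [l0|l0] := posnP l.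
  rewrite l0 mul1r /= -[RHS]addr0; congr (_ + _).
  by apply: big1 => l' _; rewrite /down l0.
rewrite mul0r add0r.
have lL : (l.-1 < L k)%N by have := ltn_ord l; lia.
rewrite (bigD1 (Ordinal lL))//= big1 ?addr0 => [|l' ll'].
  by rewrite /down /= prednK// eqxx.
rewrite /down ifF//; apply/negbTE; move: ll'; rewrite -val_eqE /=; lia.
Qed.

Local Notation m k := (branch_mean (L k) (F k)).
Local Notation eps k := (branch_eps (L k) (F k)).

(** Bounds for the relative drop from the centre to branch [k], obtained by solving [branch_drop_le]
    and [branch_drop_ge] for [x]. The upper one is [1 - 1 / (1 + s * m)], as for an exponential stay
    of mean [m]. *)
Definition drop_hi k : R := s * m k / (1 + s * m k).
Definition drop_lo k : R := s * m k / (1 + (1 + eps k) * (s * m k)).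

Let m_ge0 k : 0 <= m k. Proof. exact: branch_mean_ge0. Qed.
Let eps_ge0 k : 0 <= eps k. Proof. exact: branch_eps_ge0. Qed.

Lemma drop_itv (z x : R) k : x <= s * m k * (z - x) ->
  s * m k * (z - (1 + eps k) * x) <= x ->
  drop_lo k * z <= x <= drop_hi k * z.
Proof.
have a0 : 0 <= s * m k by rewrite mulr_ge0// ltW.
rewrite /drop_lo /drop_hi; move: (s * m k) a0 => a a0.
have d1 : 0 < 1 + a by rewrite ltr_wpDr.
have d2 : 0 < 1 + (1 + eps k) * a by rewrite ltr_wpDr// mulr_ge0// addr_ge0.
move=> h1 h2; rewrite mulrAC ler_pdivrMr// mulrAC ler_pdivlMr//.
by apply/andP; split; lra.
Qed.

Lemma star_branch g k : (forall i, 0 <= g i) ->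
  (forall l : 'I_(L k), \sum_j rate F (at_branch l) j * (g j - g (at_branch l)) =
     s * g (at_branch l)) ->
  let x := g None - along g k 1 in
  [/\ 0 <= x, drop_lo k * g None <= x <= drop_hi k * g None &
      forall l : 'I_(L k), g None - (1 + eps k) * x <= g (at_branch l) <= g None - x].
Proof.
move=> g0 gE x.
have bal n : (0 < n <= L k)%N -> branch_balance (L k) (F k) s (along g k) n.
  case: n => // n /andP[_ nL]; have := gE (Ordinal nL).
  by rewrite rate_row_branch -along_at_branch.
have a0 n : 0 <= along g k n by exact: along_ge0.
split.
- exact: (branch_drop_ge0 (L_gt0 k) (F_ge1 k) s_gt0 a0 bal).
- apply: drop_itv.
  + exact: (branch_drop_le (L_gt0 k) (F_ge1 k) s_gt0 a0 bal).
  + exact: (branch_drop_ge (L_gt0 k) (F_ge1 k) s_gt0 a0 bal).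
- move=> l; rewrite -along_at_branch.
  have lL : (0 < l.+1 <= L k)%N by rewrite ltn_ord.
  exact: (branch_value (L_gt0 k) (F_ge1 k) s_gt0 a0 bal lL).
Qed.

Lemma drop_lo_ge0 k : 0 <= drop_lo k.
Proof.
have a0 : 0 <= s * m k by rewrite mulr_ge0// ltW.
by rewrite divr_ge0// addr_ge0// mulr_ge0// addr_ge0.
Qed.

Lemma drop_hi_ge0 k : 0 <= drop_hi k.
Proof.
have a0 : 0 <= s * m k by rewrite mulr_ge0// ltW.
by rewrite divr_ge0// addr_ge0.
Qed.

Lemma star_centre_value g k (l : 'I_(L k)) : g None = 1 -> (forall i, 0 <= g i) ->
  (forall i, i != None -> \sum_j rate F i j * (g j - g i) = s * g i) ->
  1 - (1 + eps k) * drop_hi k <= g (at_branch l) <= 1 - drop_lo k.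
Proof.
move=> gN g0 gE; have [] := @star_branch g k g0 (fun l => gE (at_branch l) isT).
rewrite gN !mulr1 => _ /andP[x1 x2] /(_ l) /andP[v1 v2].
apply/andP; split.
  by apply: le_trans v1; rewrite lerD2l lerN2 ler_wpM2l// addr_ge0.
by apply: le_trans v2 _; rewrite lerD2l lerN2.
Qed.

Section target.
Variables (k1 k2 : 'I_K) (l1 : 'I_(L k1)) (l2 : 'I_(L k2)) (g : state L -> R).
Hypothesis k12 : k1 != k2.
Let b := at_branch l2.
Hypothesis gb : g b = 1.
Hypothesis g_ge0 : forall i, 0 <= g i.
Hypothesis gE : forall i, i != b -> \sum_j rate F i j * (g j - g i) = s * g i.

(** The equation at the centre says that the flux into branch [k2] equals [s * z] plus the fluxes
    into the other branches. Divided by [z] and by the rate towards [k2], it lies between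
    [escape_lo] and [escape_hi], so that [z] is about [1 / (1 + escape)]. *)
Definition escape_hi : R :=
  (s + \sum_(k | k != k2) (L k)%:R * F k * drop_hi k) / ((L k2)%:R * F k2).
Definition escape_lo : R :=
  (s + \sum_(k | k != k2) (L k)%:R * F k * drop_lo k) / ((L k2)%:R * F k2).

Let z := g None.
Let LF_gt0 k : 0 < (L k)%:R * F k.
Proof. by rewrite mulr_gt0 ?ltr0n// (lt_le_trans ltr01). Qed.

Lemma escape_hi_ge0 : 0 <= escape_hi.
Proof.
rewrite divr_ge0 ?(ltW (LF_gt0 _))// addr_ge0 ?(ltW s_gt0)// sumr_ge0// => k _.
apply: mulr_ge0; [exact: ltW | exact: drop_hi_ge0].
Qed.

Lemma escape_lo_ge0 : 0 <= escape_lo.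
Proof.
rewrite divr_ge0 ?(ltW (LF_gt0 _))// addr_ge0 ?(ltW s_gt0)// sumr_ge0// => k _.
apply: mulr_ge0; [exact: ltW | exact: drop_lo_ge0].
Qed.

Let off k : k != k2 -> forall l : 'I_(L k),
  \sum_j rate F (at_branch l) j * (g j - g (at_branch l)) = s * g (at_branch l).
Proof.
move=> kk2 l; apply: gE; apply: contraNneq kk2 => E.
by have /= -> := congr1 (fun i : state L => if i is Some p then tag p else k2) E.
Qed.

Lemma star_start_value :
  (1 - (1 + eps k1) * drop_hi k1) * z <= g (at_branch l1) <= (1 - drop_lo k1) * z.
Proof.
have [_ /andP[x1 x2] /(_ l1) /andP[v1 v2]] := star_branch g_ge0 (off k12).
rewrite !mulrBl !mul1r; apply/andP; split.
  by apply: le_trans v1; rewrite lerD2l lerN2 -mulrA ler_wpM2l// addr_ge0.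
by apply: le_trans v2 _; rewrite lerD2l lerN2.
Qed.

Let x k := z - along g k 1.

Let flux_centre :
  (L k2)%:R * F k2 * (along g k2 1 - along g k2 0) =
  s * z + \sum_(k | k != k2) (L k)%:R * F k * x k.
Proof.
have := gE (isT : None != b); rewrite rate_row_centre (bigD1 k2)//= => <-.
rewrite -addrA -big_split/= big1 ?addr0// => k _.
by rewrite /x /z; ring.
Qed.

Let flux_bounds :
  escape_lo * z <= (s * z + \sum_(k | k != k2) (L k)%:R * F k * x k) /
    ((L k2)%:R * F k2) <= escape_hi * z.
Proof.
rewrite /escape_lo /escape_hi !(mulrAC _ _ z).
rewrite !ler_pM2r ?invr_gt0// !mulrDl !lerD2l !mulr_suml.
apply/andP; split; apply: ler_sum => k kk2.
  rewrite -[leLHS]mulrA ler_pM2l//.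
  by have [_ /andP[]] := star_branch g_ge0 (off kk2).
rewrite -[leRHS]mulrA ler_pM2l//.
by have [_ /andP[]] := star_branch g_ge0 (off kk2).
Qed.

Let flux_ge0 : 0 <= s * z + \sum_(k | k != k2) (L k)%:R * F k * x k.
Proof.
apply: addr_ge0; first by apply: mulr_ge0; [exact: ltW | exact: g_ge0].
apply: sumr_ge0 => k kk2; rewrite mulr_ge0 ?(ltW (LF_gt0 k))//.
by have [] := star_branch g_ge0 (off kk2).
Qed.

Let bal n : (0 < n < l2.+1)%N -> branch_balance (L k2) (F k2) s (along g k2) n.
Proof.
case: n => // n /andP[_ nl2]; have nL : (n < L k2)%N by have := ltn_ord l2; lia.
have : at_branch (Ordinal nL) != b.
  apply/eqP => /(congr1 (fun i : state L =>
    if i is Some p then val (tagged p) else 0%N)) /=; lia.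
by move=> /gE; rewrite rate_row_branch -along_at_branch.
Qed.

Lemma star_centre_le : z * (1 + escape_lo) <= 1.
Proof.
have a0 n : 0 <= along g k2 n by exact: along_ge0.
have n2 : (0 < l2.+1 <= L k2)%N by rewrite ltn_ord.
have u2 : along g k2 l2.+1 = 1 by rewrite along_at_branch.
have p0 : 0 <= (L k2)%:R * F k2 * (along g k2 1 - along g k2 0) by rewrite flux_centre.
have := target_le (L_gt0 k2) (F_ge1 k2) s_gt0 a0 n2 bal u2 p0.
rewrite flux_centre; have /andP[h _] := flux_bounds => /(le_trans h).
by rewrite (_ : along g k2 0 = z)//; lra.
Qed.

Lemma star_centre_ge :
  1 - s * target_error (L k2) (F k2) <= z * (1 + escape_hi * (1 + eps k2)).
Proof.
have a0 n : 0 <= along g k2 n by exact: along_ge0.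
have n2 : (0 < l2.+1 <= L k2)%N by rewrite ltn_ord.
have u2 : along g k2 l2.+1 = 1 by rewrite along_at_branch.
have p0 : 0 <= (L k2)%:R * F k2 * (along g k2 1 - along g k2 0) by rewrite flux_centre.
have := target_ge (L_gt0 k2) (F_ge1 k2) s_gt0 a0 n2 bal u2 p0.
rewrite flux_centre; have /andP[_ h] := flux_bounds => H.
have := ler_wpM2r (addr_ge0 ler01 (eps_ge0 k2)) h.
by move: H; rewrite (_ : along g k2 0 = z)// ; lra.
Qed.

End target.

End star.

(** Lets [s] tend to 0 in a lower bound for a possibly infinite expectation. *)
Lemma le_ereal_linear_perturbation (R : realType) (b c : R) (y : \bar R) :
  0 <= c -> (forall s, 0 < s -> ((b - s * c)%:E <= y)%E) -> (b%:E <= y)%E.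
Proof.
move=> c0 H; apply/lee_addgt0Pr => e e0.
have c1 : 0 < c + 1 by rewrite ltr_wpDl.
have s0 : 0 < e / (c + 1) by rewrite divr_gt0.
have se : e / (c + 1) * c <= e.
  by rewrite mulrAC ler_pdivrMr// ler_pM2l// lerDl.
rewrite -leeBlDr// -EFinB; apply: le_trans (H _ s0).
by rewrite lee_fin lerD2l lerN2.
Qed.

(** * Transforms and expectations of the hitting times at fixed rates *)

Section star_process.
Context {R : realType} {K : nat} (L : 'I_K -> nat) (F : 'I_K -> R)
  {d} {T : measurableType d} (P : probability T R) (X : R -> T -> state L)
  (k1 : 'I_K) (l1 : 'I_(L k1)).
Hypothesis L_gt0 : forall k, (0 < L k)%N.
Hypothesis F_ge1 : forall k, 1 <= F k.
Hypothesis HX : markov_process P X (rate F).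
Hypothesis start : P [set w | X 0 w = at_branch l1] = 1%E.

Local Notation m k := (branch_mean (L k) (F k)).
Local Notation eps k := (branch_eps (L k) (F k)).
Let m_ge0 k : 0 <= m k. Proof. exact: branch_mean_ge0. Qed.
Let eps_ge0 k : 0 <= eps k. Proof. exact: branch_eps_ge0. Qed.

Lemma laplace_star b (s : R) : at_branch l1 != b -> 0 < s ->
  exists g : state L -> R,
    [/\ g b = 1, forall i, 0 <= g i,
        forall i, i != b -> \sum_j rate F i j * (g j - g i) = s * g i &
        \int[P]_w exp_neg (s%:E * hitting_time X b w) = g (at_branch l1)].
Proof.
move=> ab s0.
have [g [gb g0 gE]] := resolvent_exists b (rate_ge0 F_ge1) s0.
exists g; split => //; apply: (laplace_hitting_time HX start ab s0 gb).
by move=> i ib; rewrite generator_sum gE.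
Qed.

Lemma drop_hi_le (s : R) k : 0 < s -> drop_hi L F s k <= s * m k.
Proof.
move=> s0; have a0 : 0 <= s * m k by rewrite mulr_ge0// ltW.
rewrite /drop_hi ler_pdivrMr ?ltr_wpDr//.
by rewrite mulrDr mulr1 lerDl mulr_ge0.
Qed.

Let eps1_ge0 k : 0 <= 1 + eps k.
Proof. by apply: addr_ge0; [exact: ler01 | exact: eps_ge0]. Qed.

Lemma drop_lo_le (s : R) k : 0 < s -> drop_lo L F s k <= s * m k.
Proof.
move=> s0; have a0 : 0 <= s * m k by rewrite mulr_ge0// ltW.
have a1 := mulr_ge0 (eps1_ge0 k) a0.
rewrite /drop_lo ler_pdivrMr ?ltr_wpDr//.
by rewrite mulrDr mulr1 lerDl (mulr_ge0 a0 a1).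
Qed.

Lemma drop_lo_ge (s : R) k : 0 < s ->
  s * m k - s ^+ 2 * ((1 + eps k) * m k ^+ 2) <= drop_lo L F s k.
Proof.
move=> s0; have a0 : 0 <= s * m k by rewrite mulr_ge0// ltW.
have d0 : 0 < 1 + (1 + eps k) * (s * m k).
  by rewrite ltr_wpDr// (mulr_ge0 (eps1_ge0 k) a0).
rewrite /drop_lo ler_pdivlMr//.
have : 0 <= (1 + eps k) ^+ 2 * (s * m k) ^+ 3.
  exact: mulr_ge0 (exprn_ge0 _ (eps1_ge0 k)) (exprn_ge0 _ a0).
lra.
Qed.

Section centre.
Let V := hitting_time X None.
Let mV : measurable_fun setT V. Proof. exact: (measurable_hitting_time _ HX). Qed.
Let V0 w : (0 <= V w)%E. Proof. exact: hitting_time_ge0. Qed.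

Lemma expectation_centre :
  ((m k1)%:E <= \int[P]_w V w)%E /\
  (\int[P]_w V w <= ((1 + eps k1) * m k1)%:E)%E.
Proof.
have H s : 0 < s ->
    1 - (1 + eps k1) * drop_hi L F s k1 <= \int[P]_w exp_neg (s%:E * V w) <=
    1 - drop_lo L F s k1.
  move=> s0; have [g [gb g0 gE ->]] := @laplace_star None s isT s0.
  exact: star_centre_value.
split.
- apply: (@le_ereal_linear_perturbation _ _ ((1 + eps k1) * m k1 ^+ 2)).
    exact: mulr_ge0 (eps1_ge0 k1) (exprn_ge0 _ (m_ge0 k1)).
  move=> s s0; apply: le_trans (expectation_ge P mV V0 s0).
  have /andP[_ h2] := H s s0; have h3 := drop_lo_ge k1 s0.
  by rewrite lee_fin ler_pdivlMr//; lra.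
- apply: expectation_le => // s s0.
  have /andP[h1 _] := H s s0.
  have : (1 + eps k1) * drop_hi L F s k1 <= (1 + eps k1) * (s * m k1).
    by rewrite ler_wpM2l// drop_hi_le.
  by rewrite ler_pdivrMr//; lra.
Qed.

End centre.

Section target.
Variables (k2 : 'I_K) (l2 : 'I_(L k2)).
Hypothesis k12 : k1 != k2.
Let b := at_branch l2.
Let V := hitting_time X b.
Let mV : measurable_fun setT V. Proof. exact: (measurable_hitting_time _ HX). Qed.
Let V0 w : (0 <= V w)%E. Proof. exact: hitting_time_ge0. Qed.

Let ab : at_branch l1 != b.
Proof.
apply: contra_neq k12 => E.
by have /= -> := congr1 (fun i : state L => if i is Some p then tag p else k2) E.
Qed.

(** Approximate mean time from the centre to the target: branch [k] is entered on average
    [L k * F k / (L k2 * F k2)] times before [k2], for a mean time [m k] each, and the summand 1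
    accounts for the holding times at the centre. It is the derivative of [escape_hi] at [s = 0]. *)
Definition escape_mean : R :=
  (1 + \sum_(k | k != k2) ((1 + F k) ^+ L k - 1)) / ((L k2)%:R * F k2).

Let LF_gt0 k : 0 < (L k)%:R * F k.
Proof. by rewrite mulr_gt0 ?ltr0n// (lt_le_trans ltr01). Qed.

Lemma branch_meanE k : (L k)%:R * F k * m k = (1 + F k) ^+ L k - 1.
Proof. by rewrite /branch_mean mulrC divfK// gt_eqF. Qed.

Let escape_meanE : escape_mean =
  (1 + \sum_(k | k != k2) (L k)%:R * F k * m k) / ((L k2)%:R * F k2).
Proof. by congr ((1 + _) / _); apply: eq_bigr => k _; rewrite branch_meanE. Qed.

Lemma escape_hi_le (s : R) : 0 < s -> escape_hi L F s k2 <= s * escape_mean.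
Proof.
move=> s0; rewrite escape_meanE mulrA /escape_hi ler_pM2r ?invr_gt0//.
rewrite mulrDr mulr1 lerD2l mulr_sumr; apply: ler_sum => k _.
by rewrite [leRHS]mulrCA ler_pM2l// drop_hi_le.
Qed.

Lemma laplace_target (s : R) : 0 < s ->
  exists2 z, 0 <= z &
  [/\ (1 - (1 + eps k1) * drop_hi L F s k1) * z <=
        \int[P]_w exp_neg (s%:E * V w) <= (1 - drop_lo L F s k1) * z,
      z * (1 + escape_lo L F s k2) <= 1 &
      1 - s * target_error (L k2) (F k2) <=
        z * (1 + escape_hi L F s k2 * (1 + eps k2))].
Proof.
move=> s0; have [g [gb g0 gE ->]] := laplace_star ab s0.
exists (g None) => //; split.
- exact: (star_start_value L_gt0 F_ge1 s0 l1 k12 g0 gE).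
- exact: (star_centre_le L_gt0 F_ge1 s0 k12 gb g0 gE).
- exact: (star_centre_ge L_gt0 F_ge1 s0 k12 gb g0 gE).
Qed.

Let target_error_ge0 : 0 <= target_error (L k2) (F k2).
Proof.
by rewrite divr_ge0 ?mulr_ge0 ?exprn_ge0// (le_trans ler01).
Qed.

Lemma escape_mean_ge0 : 0 <= escape_mean.
Proof.
rewrite escape_meanE divr_ge0 ?(ltW (LF_gt0 _))// addr_ge0// sumr_ge0// => k _.
by rewrite mulr_ge0 ?(ltW (LF_gt0 _)).
Qed.

Let c2 := (\sum_(k | k != k2) (L k)%:R * F k * ((1 + eps k) * m k ^+ 2)) /
  ((L k2)%:R * F k2).

Let c2_ge0 : 0 <= c2.
Proof.
rewrite divr_ge0 ?(ltW (LF_gt0 _))// sumr_ge0// => k _.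
apply: mulr_ge0; first exact: ltW.
exact: mulr_ge0 (eps1_ge0 k) (exprn_ge0 _ (m_ge0 k)).
Qed.

Let escape_lo_ge (s : R) : 0 < s ->
  s * escape_mean - s ^+ 2 * c2 <= escape_lo L F s k2.
Proof.
move=> s0; rewrite escape_meanE /c2 !mulrA -mulrBl /escape_lo ler_pM2r ?invr_gt0//.
rewrite mulrDr mulr1 -addrA lerD2l !mulr_sumr -sumrB; apply: ler_sum => k _.
have -> : s * ((L k)%:R * F k * m k) - s ^+ 2 * ((L k)%:R * F k * ((1 + eps k) * m k ^+ 2))
  = (L k)%:R * F k * (s * m k - s ^+ 2 * ((1 + eps k) * m k ^+ 2)) by ring.
by rewrite ler_pM2l// drop_lo_ge.
Qed.

Let escape_lo_hi (s : R) : 0 < s -> escape_lo L F s k2 <= s * escape_mean.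
Proof.
move=> s0; rewrite escape_meanE mulrA /escape_lo ler_pM2r ?invr_gt0//.
rewrite mulrDr mulr1 lerD2l mulr_sumr; apply: ler_sum => k _.
by rewrite [leRHS]mulrCA ler_pM2l// drop_lo_le.
Qed.

(** First-order expansion in [s] of the bounds of [laplace_target]. The constants [c1], [c2] and
    [c4] only collect second-order terms, which disappear as [s] tends to 0. *)
Lemma expectation_target :
  ((m k1 + escape_mean)%:E <= \int[P]_w V w)%E /\
  (\int[P]_w V w <= ((1 + eps k1) * m k1 + (1 + eps k2) * escape_mean +
     target_error (L k2) (F k2))%:E)%E.
Proof.
have M0 := escape_mean_ge0.
split.
- pose c4 := target_error (L k2) (F k2) + escape_mean * (1 + eps k2).
  have c40 : 0 <= c4 by exact: addr_ge0 target_error_ge0 (mulr_ge0 M0 (eps1_ge0 k2)).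
  pose c1 := (1 + eps k1) * m k1 ^+ 2.
  have c10 : 0 <= c1 by exact: mulr_ge0 (eps1_ge0 k1) (exprn_ge0 _ (m_ge0 k1)).
  apply: (@le_ereal_linear_perturbation _ _
    (c1 + c2 + (m k1 + escape_mean) * c4)).
    by rewrite addr_ge0 ?(addr_ge0 c10 c2_ge0)// (mulr_ge0 (addr_ge0 (m_ge0 k1) M0)).
  move=> s s0; apply: le_trans (expectation_ge P mV V0 s0).
  rewrite lee_fin ler_pdivlMr//.
  have [z z0 [/andP[_ h1] h2 h3]] := laplace_target s0.
  have l1_ := drop_lo_ge k1 s0; have l2_ := escape_lo_ge s0.
  have u1 := drop_lo_le k1 s0; have u2 := escape_lo_hi s0.
  have p1 : 0 <= drop_lo L F s k1 by exact: drop_lo_ge0.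
  have p2 := escape_lo_ge0 L_gt0 F_ge1 s0 k2.
  have z1 : z <= 1 by apply: le_trans h2; rewrite ler_peMr// lerDl.
  have zs : 1 - s * c4 <= z.
    have : z * (escape_hi L F s k2 * (1 + eps k2)) <= s * escape_mean * (1 + eps k2).
      apply: (@le_trans _ _ (escape_hi L F s k2 * (1 + eps k2))).
        by rewrite ler_piMl// (mulr_ge0 (escape_hi_ge0 L_gt0 F_ge1 s0 k2)).
      by rewrite ler_wpM2r// escape_hi_le.
    by rewrite /c4; lra.
  (* [1 - (1 - drop_lo) * z] is at least [a * z] because [z * (1 + escape_lo) <= 1]; as [a] is of
     order [s], replacing [z] by 1 costs only a second-order term. *)
  set a := escape_lo L F s k2 + drop_lo L F s k1.
  have az : a * (1 - s * c4) <= a * z by rewrite ler_wpM2l// addr_ge0.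
  have ac : a * (s * c4) <= s * (m k1 + escape_mean) * (s * c4).
    rewrite ler_wpM2r//; first by rewrite mulr_ge0// ltW.
    by rewrite /a; lra.
  have -> : (m k1 + escape_mean - s * (c1 + c2 + (m k1 + escape_mean) * c4)) * s =
    s * (m k1 + escape_mean) - s ^+ 2 * c1 - s ^+ 2 * c2 -
    s * (m k1 + escape_mean) * (s * c4) by ring.
  rewrite -/c1 in l1_.
  by rewrite /a in az ac *; lra.
- apply: expectation_le => // s s0.
  have [z z0 [/andP[h1 _] h2 h3]] := laplace_target s0.
  have p2 := escape_lo_ge0 L_gt0 F_ge1 s0 k2.
  have z1 : z <= 1 by apply: le_trans h2; rewrite ler_peMr// lerDl.
  have e0 := escape_hi_ge0 L_gt0 F_ge1 s0 k2.
  have d0 := drop_hi_ge0 L_gt0 F_ge1 s0 k1.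
  have h4 : z * (escape_hi L F s k2 * (1 + eps k2)) <= s * escape_mean * (1 + eps k2).
    apply: (@le_trans _ _ (escape_hi L F s k2 * (1 + eps k2))).
      by rewrite ler_piMl// mulr_ge0.
    by rewrite ler_wpM2r// escape_hi_le.
  have h5 : (1 + eps k1) * drop_hi L F s k1 * z <= (1 + eps k1) * (s * m k1).
    apply: (@le_trans _ _ ((1 + eps k1) * drop_hi L F s k1)).
      by rewrite ler_piMr// mulr_ge0.
    by rewrite ler_wpM2l// drop_hi_le.
  by rewrite ler_pdivrMr//; lra.
Qed.

End target.

End star_process.

(** * Asymptotics *)

Section cvg_facts.
Context {R : realType} {U : Type} {Fl : set_system U} {FF : Filter Fl}.
Implicit Types g h : U -> R.

Lemma cvg_near_eq g h (l : R) : (\forall x \near Fl, g x = h x) ->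
  g x @[x --> Fl] --> l -> h x @[x --> Fl] --> l.
Proof. by move=> gh gl; apply: cvg_trans gl; exact: near_eq_cvg. Qed.

Lemma cvg_exprn g (l : R) n :
  g x @[x --> Fl] --> l -> g x ^+ n @[x --> Fl] --> l ^+ n.
Proof.
move=> gl; elim: n => [|n IH]; first exact: cvg_cst.
by rewrite exprS; under eq_fun do rewrite exprS; exact: cvgM.
Qed.

Lemma cvg_div g h (a b : R) : b != 0 ->
  g x @[x --> Fl] --> a -> h x @[x --> Fl] --> b ->
  g x / h x @[x --> Fl] --> a / b.
Proof. by move=> b0 ga hb; apply: cvgM => //; exact: cvgV. Qed.

Lemma cvg0_squeeze g h : (\forall x \near Fl, 0 <= g x <= h x) ->
  h x @[x --> Fl] --> (0 : R) -> g x @[x --> Fl] --> (0 : R).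
Proof.
move=> gh h0; apply: (@squeeze_cvgr _ _ _ _ (fun=> 0) h) => //; exact: cvg_cst.
Qed.

End cvg_facts.

Section asymptotics.
Context {R : realType} {K : nat} (L : 'I_K -> nat) (f : 'I_K -> R -> R)
  (k1 k2 : 'I_K) (gamma : 'I_K -> R) (beta : 'I_K -> \bar R) (alpha : R).
Hypothesis L_gt0 : forall k, (0 < L k)%N.
Hypothesis f_lim : forall k, f k nu @[nu --> +oo] --> +oo.
Hypothesis k12 : k1 != k2.
Hypothesis gamma_ge0 : forall k, k != k2 -> 0 <= gamma k.
Hypothesis gamma_lim : forall k, k != k2 ->
  f k nu ^+ L k / \sum_(j | j != k2) f j nu ^+ L j @[nu --> +oo] --> gamma k.
Hypothesis beta_ge0 : forall k, k \in Kstar k2 gamma -> (0 <= beta k)%E.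
Hypothesis beta_lim : forall k, k \in Kstar k2 gamma ->
  (((L k)%:R * f k nu) / ((L k2)%:R * f k2 nu))%:E @[nu --> +oo] --> beta k.
Hypothesis alpha_itv : 0 <= alpha <= 1.

Let F nu k := f k nu.
Local Notation m nu k := (branch_mean (L k) (f k nu)).
Local Notation eps nu k := (branch_eps (L k) (f k nu)).
Local Notation M nu := (escape_mean L (F nu) k2).
Local Notation C nu := (target_error (L k2) (f k2 nu)).
(** [G] is the exact factor rate times mean stay, [H] its leading term; [SH] is the denominator
    defining [gamma], and [N] the numerator of [escape_mean]. The limits known for [H / SH] are
    transferred to [G / N]. *)
Let G nu k := (1 + f k nu) ^+ L k - 1.
Let H nu k := f k nu ^+ L k.
Let SH nu := \sum_(j | j != k2) H nu j.
Let N nu := 1 + \sum_(j | j != k2) G nu j.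

Lemma near_f_ge1 : \forall nu \near +oo, forall k, 1 <= f k nu.
Proof. by apply: filter_forall => k; move/cvgryPge : (f_lim k); exact. Qed.

Let f_inv k : (f k nu)^-1 @[nu --> +oo] --> 0.
Proof.
apply/(gtr0_cvgV0 (f := f k)); last exact: f_lim.
by near=> nu; apply: (@lt_le_trans _ _ 1) => //; near: nu;
  apply: filterS near_f_ge1 => nu; exact.
Unshelve. all: by end_near. Qed.

Lemma branch_eps_cvg k : eps nu k @[nu --> +oo] --> 0.
Proof. by rewrite -[X in _ --> X](mulr0 (L k)%:R); apply: cvgM; [exact: cvg_cst|]. Qed.

Lemma target_error_cvg : C nu @[nu --> +oo] --> 0.
Proof.
by rewrite -[X in _ --> X](mulr0 ((L k2)%:R * 2 ^+ L k2)); apply: cvgM; [exact: cvg_cst|].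
Qed.

Let GH_cvg k : G nu k / H nu k @[nu --> +oo] --> (1 : R).
Proof.
have c : (1 + (f k nu)^-1) ^+ L k - (f k nu)^-1 ^+ L k @[nu --> +oo] --> (1 : R).
  have E : (1 + 0) ^+ L k - 0 ^+ L k = 1 :> R.
    by rewrite addr0 expr1n expr0n gtn_eqF// subr0.
  rewrite -[X in _ --> X]E.
  by apply: cvgB; apply: cvg_exprn => //; apply: cvgD => //; exact: cvg_cst.
apply: cvg_near_eq c; apply: filterS near_f_ge1 => nu /(_ k) f1.
have f0 : f k nu != 0 by rewrite gt_eqF// (lt_le_trans ltr01).
rewrite /G /H mulrBl mul1r -exprVn -exprMn; congr (_ ^+ _ - _).
by rewrite mulrDl mul1r divff// addrC.
Qed.

Let H_gt0 nu k : 1 <= f k nu -> 0 < H nu k.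
Proof. by move=> f1; rewrite exprn_gt0// (lt_le_trans ltr01). Qed.

Let SH_ge nu : (forall k, 1 <= f k nu) -> f k1 nu <= SH nu.
Proof.
move=> f1; rewrite /SH (bigD1 k1)//=; apply: (@le_trans _ _ (H nu k1)).
  by rewrite -[leLHS]expr1 /H ler_weXn2l.
by rewrite lerDl sumr_ge0// => k _; exact/ltW/H_gt0.
Qed.

Let SH_gt0 nu : (forall k, 1 <= f k nu) -> 0 < SH nu.
Proof. by move=> f1; rewrite (lt_le_trans _ (SH_ge f1))// (lt_le_trans ltr01). Qed.

Let SH_inv : (SH nu)^-1 @[nu --> +oo] --> 0.
Proof.
apply: (cvg0_squeeze _ (f_inv k1)); apply: filterS near_f_ge1 => nu f1.
have f0 : 0 < f k1 nu by rewrite (lt_le_trans ltr01).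
by rewrite invr_ge0 (ltW (SH_gt0 f1)) lef_pV2 ?posrE ?SH_gt0//= SH_ge.
Qed.

(** The quotients sum to 1 for every large [nu], as [SH] is positive thanks to [k1]. Hence [N] and
    [SH] are equivalent. *)
Let sum_gamma : \sum_(k | k != k2) gamma k = 1.
Proof.
have c1 : \sum_(k | k != k2) H nu k / SH nu @[nu --> +oo] -->
    \sum_(k | k != k2) gamma k.
  by apply: cvg_big_sum => k kk2; exact: gamma_lim.
have c2 : \sum_(k | k != k2) H nu k / SH nu @[nu --> +oo] --> (1 : R).
  apply: (@cvg_near_eq _ _ _ _ (fun=> 1)); last exact: cvg_cst.
  apply: filterS near_f_ge1 => nu f1.
  by rewrite -mulr_suml divff// gt_eqF// SH_gt0.
exact: cvg_unique c1 c2.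
Qed.

Let N_cvg : N nu / SH nu @[nu --> +oo] --> (1 : R).
Proof.
have c : (SH nu)^-1 + \sum_(k | k != k2) (G nu k / H nu k) * (H nu k / SH nu)
    @[nu --> +oo] --> 0 + \sum_(k | k != k2) 1 * gamma k.
  apply: cvgD => //; apply: cvg_big_sum => k kk2; apply: cvgM => //.
  exact: gamma_lim.
have E : 0 + \sum_(k | k != k2) 1 * gamma k = 1.
  by rewrite add0r -[RHS]sum_gamma; apply: eq_bigr => k _; rewrite mul1r.
rewrite E in c; apply: cvg_near_eq c; apply: filterS near_f_ge1 => nu f1.
rewrite /N mulrDl mul1r mulr_suml; congr (_ + _); apply: eq_bigr => k _.
by rewrite mulrA divfK// gt_eqF// H_gt0.
Qed.

Let N_ge nu : (forall k, 1 <= f k nu) -> SH nu <= N nu.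
Proof.
move=> f1; rewrite /N /SH ler_wpDl//; apply: ler_sum => k _; rewrite /G /H.
have f0 : 0 <= f k nu by exact: le_trans ler01 (f1 k).
rewrite lerBrDr addrC; have [n ->] : exists n, L k = n.+1 by exists (L k).-1; rewrite prednK.
elim: n => [|n IH] //; rewrite exprS [leRHS]exprS.
have : 0 <= (1 + f k nu) ^+ n.+1 by rewrite exprn_ge0// addr_ge0.
have : 1 <= (1 + f k nu) ^+ n.+1 by rewrite exprn_ege1// lerDl.
move: IH f0; set a := _ ^+ n.+1; set b := (1 + _) ^+ n.+1; move=> IH f0 b1 b0.
have : f k nu * (1 + a) <= f k nu * b by rewrite ler_wpM2l.
lra.
Qed.

Let N_gt0 nu : (forall k, 1 <= f k nu) -> 0 < N nu.
Proof. by move=> f1; apply: lt_le_trans (N_ge f1); exact: SH_gt0. Qed.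

Let GN_cvg k : k != k2 -> G nu k / N nu @[nu --> +oo] --> gamma k.
Proof.
move=> kk2.
have c : (G nu k / H nu k) * (H nu k / SH nu) / (N nu / SH nu)
    @[nu --> +oo] --> 1 * gamma k / 1.
  apply: cvg_div N_cvg; first exact: oner_neq0.
  by apply: cvgM => //; exact: gamma_lim.
rewrite mul1r divr1 in c; apply: cvg_near_eq c.
apply: filterS near_f_ge1 => nu f1.
have := H_gt0 (f1 k); have := SH_gt0 f1; have := N_gt0 f1 => n0 s0 h0.
by field; rewrite !gt_eqF.
Qed.

Lemma branch_mean_ge1 k nu : (forall k, 1 <= f k nu) -> 1 <= m nu k.
Proof.
move=> f1; have f0 : 0 < f k nu by exact: lt_le_trans ltr01 (f1 k).
have Lf : 0 < (L k)%:R * f k nu by rewrite mulr_gt0 ?ltr0n.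
rewrite /branch_mean ler_pdivlMr// mul1r.
have : forall n : nat, 1 + n%:R * f k nu <= (1 + f k nu) ^+ n.
  elim=> [|n IH]; first by rewrite mul0r addr0.
  have : 0 <= n%:R * (f k nu * f k nu) by rewrite mulr_ge0// mulr_ge0// ltW.
  have : (1 + f k nu) * (1 + n%:R * f k nu) <= (1 + f k nu) * (1 + f k nu) ^+ n.
    by rewrite ler_wpM2l// addr_ge0// ltW.
  by rewrite exprS -[n.+1%:R]natr1; lra.
by move=> /(_ (L k)); lra.
Qed.

Variables (e0 e : R -> R).
Hypothesis e0_bounds : \forall nu \near +oo,
  m nu k1 <= e0 nu <= (1 + eps nu k1) * m nu k1.
Hypothesis e_bounds : \forall nu \near +oo,
  m nu k1 + M nu <= e nu <=
  (1 + eps nu k1) * m nu k1 + (1 + eps nu k2) * M nu + C nu.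
Hypothesis alpha_lim : e0 nu / e nu @[nu --> +oo] --> alpha.

Let M_ge0 nu : (forall k, 1 <= f k nu) -> 0 <= M nu.
Proof. by move=> f1; exact: (escape_mean_ge0 (L := L) (F := F nu)). Qed.

Lemma near_e_ge : \forall nu \near +oo,
  [/\ 1 <= e nu, m nu k1 <= e nu & M nu <= e nu].
Proof.
near=> nu.
have f1 : forall k, 1 <= f k nu by near: nu; exact: near_f_ge1.
have /andP[h _] : m nu k1 + M nu <= e nu <=
  (1 + eps nu k1) * m nu k1 + (1 + eps nu k2) * M nu + C nu by near: nu.
have := branch_mean_ge1 k1 f1; have := M_ge0 f1.
by split; lra.
Unshelve. all: by end_near. Qed.

(** [e0] and [e] stand for the mean times to the centre and to the target; [e0] is squeezed so
    closely that the explicit [m] may replace it. *)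
Lemma branch_fraction_cvg : m nu k1 / e nu @[nu --> +oo] --> alpha.
Proof.
have c : m nu k1 / e0 nu @[nu --> +oo] --> (1 : R).
  apply: (@squeeze_cvgr _ _ _ _ (fun nu => (1 + eps nu k1)^-1) (fun=> 1)).
  - near=> nu.
    have f1 : forall k, 1 <= f k nu by near: nu; exact: near_f_ge1.
    have /andP[h1 h2] : m nu k1 <= e0 nu <= (1 + eps nu k1) * m nu k1 by near: nu.
    have m1 := branch_mean_ge1 k1 f1.
    have ep : 0 <= eps nu k1 by exact: branch_eps_ge0.
    have e00 : 0 < e0 nu by lra.
    rewrite ler_pdivlMr// mulrC ler_pdivrMr ?ltr_wpDr// mulrC h2/=.
    by rewrite ler_pdivrMr// mul1r.
  - have c : (1 + eps nu k1)^-1 @[nu --> +oo] --> ((1 + 0)^-1 : R).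
      apply: cvgV; first by rewrite addr0 oner_eq0.
      by apply: cvgD; [exact: cvg_cst | exact: branch_eps_cvg].
    by rewrite addr0 invr1 in c.
  - exact: cvg_cst.
have {}c : (e0 nu / e nu) * (m nu k1 / e0 nu) @[nu --> +oo] --> alpha * 1.
  exact: cvgM.
rewrite mulr1 in c; apply: cvg_near_eq c; near=> nu.
have f1 : forall k, 1 <= f k nu by near: nu; exact: near_f_ge1.
have /andP[h1 h2] : m nu k1 <= e0 nu <= (1 + eps nu k1) * m nu k1 by near: nu.
have m1 := branch_mean_ge1 k1 f1.
have [e1 _ _] : [/\ 1 <= e nu, m nu k1 <= e nu & M nu <= e nu].
  by near: nu; exact: near_e_ge.
have ne : e nu != 0 by rewrite gt_eqF//; lra.
have ne0 : e0 nu != 0 by rewrite gt_eqF//; lra.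
by rewrite mulrC mulrA divfK.
Unshelve. all: by end_near. Qed.

(** The remainder [e - m - M] is bounded by vanishing multiples of [m], [M] and 1, all at most
    [e]. *)
Lemma escape_fraction_cvg : M nu / e nu @[nu --> +oo] --> 1 - alpha.
Proof.
have c0 : 1 - m nu k1 / e nu - M nu / e nu @[nu --> +oo] --> (0 : R).
  apply: (@cvg0_squeeze _ _ _ _ _ (fun nu => eps nu k1 + eps nu k2 + C nu)).
    near=> nu.
    have f1 : forall k, 1 <= f k nu by near: nu; exact: near_f_ge1.
    have [e1 em eM] : [/\ 1 <= e nu, m nu k1 <= e nu & M nu <= e nu].
      by near: nu; exact: near_e_ge.
    have /andP[h1 h2] : m nu k1 + M nu <= e nu <=
      (1 + eps nu k1) * m nu k1 + (1 + eps nu k2) * M nu + C nu by near: nu.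
    have e00 : 0 < e nu by lra.
    have -> : 1 - m nu k1 / e nu - M nu / e nu = (e nu - m nu k1 - M nu) / e nu.
      by field; rewrite gt_eqF.
    have ep1 : 0 <= eps nu k1 by exact: branch_eps_ge0.
    have ep2 : 0 <= eps nu k2 by exact: branch_eps_ge0.
    have C0 : 0 <= C nu.
      by rewrite divr_ge0 ?mulr_ge0 ?exprn_ge0// (le_trans ler01).
    rewrite divr_ge0 ?(ltW e00)//=; last lra.
    rewrite ler_pdivrMr//.
    have q1 : eps nu k1 * m nu k1 <= eps nu k1 * e nu by rewrite ler_wpM2l.
    have q2 : eps nu k2 * M nu <= eps nu k2 * e nu by rewrite ler_wpM2l.
    have q3 : C nu * 1 <= C nu * e nu by rewrite ler_wpM2l.
    lra.
  rewrite -[X in _ --> X]addr0 -[X in _ --> X + _]addr0.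
  apply: cvgD; [apply: cvgD|]; [exact: branch_eps_cvg|exact: branch_eps_cvg|].
  exact: target_error_cvg.
have c : 1 - m nu k1 / e nu - (1 - m nu k1 / e nu - M nu / e nu)
    @[nu --> +oo] --> 1 - alpha - 0.
  apply: cvgB => //; apply: cvgB; [exact: cvg_cst | exact: branch_fraction_cvg].
rewrite subr0 in c; apply: cvg_near_eq c; near=> nu; lra.
Unshelve. all: by end_near. Qed.

Variable t : R.
Hypothesis t_gt0 : 0 < t.

Let s nu := t / e nu.
Let tau := t * (1 - alpha).
Let LF nu k := (L k)%:R * f k nu.
(** Mean number of stays in branch [k] before an entrance to [k2], times their rescaled mean length.
    It equals [s * M * (G / N)], whence the limit [tau * gamma k]. *)
Let A nu k := LF nu k / LF nu k2 * (s nu * m nu k).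

Let tau_ge0 : 0 <= tau.
Proof. by case/andP: alpha_itv => _ a1; rewrite mulr_ge0 ?subr_ge0// ltW. Qed.

Let LF_gt0 nu k : (forall k, 1 <= f k nu) -> 0 < LF nu k.
Proof. by move=> f1; rewrite mulr_gt0 ?ltr0n// (lt_le_trans ltr01). Qed.

Let s_gt0 nu : 1 <= e nu -> 0 < s nu.
Proof. by move=> e1; rewrite divr_gt0//; lra. Qed.

Let start_drop_cvg : s nu * m nu k1 @[nu --> +oo] --> t * alpha.
Proof.
have -> : (fun nu => s nu * m nu k1) = (fun nu => t * (m nu k1 / e nu)).
  by apply/funext => nu; rewrite /s; ring.
by apply: cvgM; [exact: cvg_cst | exact: branch_fraction_cvg].
Qed.

Let A_cvg k : k != k2 -> A nu k @[nu --> +oo] --> tau * gamma k.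
Proof.
move=> kk2.
have c : t * (M nu / e nu) * (G nu k / N nu) @[nu --> +oo] --> tau * gamma k.
  apply: cvgM; last exact: GN_cvg.
  by apply: cvgM; [exact: cvg_cst | exact: escape_fraction_cvg].
apply: cvg_near_eq c; near=> nu.
have f1 : forall k, 1 <= f k nu by near: nu; exact: near_f_ge1.
have [e1 _ _] : [/\ 1 <= e nu, m nu k1 <= e nu & M nu <= e nu].
  by near: nu; exact: near_e_ge.
have E := branch_meanE (L := L) (F := F nu) L_gt0 f1 k.
have E1 : G nu k = LF nu k * m nu k by rewrite [RHS]E.
have E2 : M nu = N nu / LF nu k2 by [].
rewrite E1 E2 /A /s.
have := LF_gt0 k2 f1; have := N_gt0 f1 => n0 l0.
by field; rewrite !gt_eqF//; lra.
Unshelve. all: by end_near. Qed.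

Let A_ge0 nu k : 1 <= e nu -> (forall k, 1 <= f k nu) -> 0 <= A nu k.
Proof.
move=> e1 f1; have m1 := branch_mean_ge1 k f1.
rewrite mulr_ge0//; first by rewrite divr_ge0// ltW// LF_gt0.
by apply: mulr_ge0; [exact/ltW/s_gt0 | exact: le_trans ler01 m1].
Qed.

Let limit_term k : R :=
  if k \in Aset k2 gamma beta then gamma k * tau / (1 + gamma k * tau / fine (beta k))
  else if k \in Sset k2 gamma beta then gamma k * tau else 0.

(** [s * m] is [A] divided by the ratio that tends to [beta k], so the cases for [beta k] decide
    whether the denominator stays 1, has a finite limit or explodes. The factor [c] treats [drop_hi]
    and [drop_lo] together. *)
Let term_cvg k (c : R -> R) : k != k2 ->
  (\forall nu \near +oo, 1 <= c nu) -> c nu @[nu --> +oo] --> (1 : R) ->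
  A nu k / (1 + c nu * (s nu * m nu k)) @[nu --> +oo] --> limit_term k.
Proof.
move=> kk2 c1 cc; have g0 := gamma_ge0 kk2.
have base : \forall nu \near +oo, [/\ forall k, 1 <= f k nu, 1 <= e nu & 1 <= c nu].
  near=> nu; split; [near: nu; exact: near_f_ge1| |near: nu; exact: c1].
  suff [] : [/\ 1 <= e nu, m nu k1 <= e nu & M nu <= e nu] by [].
  by near: nu; exact: near_e_ge.
have a0 nu : (forall k, 1 <= f k nu) -> 1 <= e nu -> 0 <= s nu * m nu k.
  move=> f1 e1; apply: mulr_ge0; first exact/ltW/s_gt0.
  exact: le_trans ler01 (branch_mean_ge1 k f1).
have aE nu : (forall k, 1 <= f k nu) ->
    s nu * m nu k = A nu k * (LF nu k / LF nu k2)^-1.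
  move=> f1; rewrite /A [RHS]mulrAC mulfV ?mul1r//.
  by rewrite gt_eqF// divr_gt0 ?LF_gt0.
have [kK|kK] := boolP (k \in Kstar k2 gamma); last first.
  rewrite /limit_term !inE; rewrite inE in kK; rewrite (negbTE kK)/=.
  have gk : gamma k = 0.
    by apply/eqP; rewrite eq_le g0 andbT leNgt; move: kK; rewrite kk2.
  have := A_cvg kk2; rewrite gk mulr0; apply: cvg0_squeeze.
  apply: filterS base => nu [f1 e1 cn1].
  have ca : 0 <= c nu * (s nu * m nu k) by rewrite mulr_ge0 ?a0//; lra.
  have An := A_ge0 k e1 f1.
  rewrite divr_ge0//= ?ler_pdivrMr ?ler_peMr//; by rewrite ?addr_ge0 ?lerDl ?ltr_wpDr.
have bl := beta_lim kK; have b0 := beta_ge0 kK.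
have key (l : R) : 0 <= l -> s nu * m nu k @[nu --> +oo] --> l ->
    A nu k / (1 + c nu * (s nu * m nu k)) @[nu --> +oo] -->
    tau * gamma k / (1 + 1 * l).
  move=> l0 al; apply: cvg_div; first by rewrite mul1r gt_eqF// ltr_wpDr.
    exact: A_cvg.
  by apply: cvgD; [exact: cvg_cst | exact: cvgM].
case E : (beta k) => [b| |]; last by rewrite E in b0.
- rewrite E lee_fin in b0; rewrite E in bl.
  have {bl} [_ bl] := (fine_cvgP _ _).1 bl.
  have kS : (k \in Sset k2 gamma beta) = false by rewrite inE E andbF.
  rewrite le_eqVlt in b0; case/predU1P: b0 => [b0|b0].
    have kA : (k \in Aset k2 gamma beta) = false.
      by rewrite inE E -b0 ltxx andbF.
    (* For [beta k = 0] the quotient is at most [LF nu k / LF nu k2], which tends to 0. *)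
    rewrite /limit_term kA kS; move: bl; rewrite -b0; apply: cvg0_squeeze.
    apply: filterS base => nu [f1 e1 cn1] /=.
    have an := a0 nu f1 e1.
    have rp : 0 < LF nu k / LF nu k2 by rewrite divr_gt0 ?LF_gt0.
    have can : s nu * m nu k <= c nu * (s nu * m nu k) by rewrite ler_peMl.
    rewrite divr_ge0 ?A_ge0//=; last lra.
    rewrite ler_pdivrMr; last lra.
    rewrite /A; apply: ler_wpM2l; [exact: ltW|lra].
  have kA : k \in Aset k2 gamma beta by rewrite inE kK E lte_fin b0 ltry.
  rewrite /limit_term kA E /=.
  have al : s nu * m nu k @[nu --> +oo] --> tau * gamma k * b^-1.
    have c' : A nu k * (LF nu k / LF nu k2)^-1 @[nu --> +oo] --> tau * gamma k * b^-1.
      apply: cvgM; first exact: A_cvg.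
      by apply: cvgV => //; rewrite gt_eqF.
    by apply: cvg_near_eq c'; apply: filterS base => nu [f1 _ _]; rewrite aE.
  have l0 : 0 <= tau * gamma k * b^-1 by rewrite mulr_ge0 ?invr_ge0 ?(ltW b0)// mulr_ge0.
  by have := key _ l0 al; rewrite mul1r (mulrC tau).
- rewrite E in bl; move/cvgeryP : bl => bl.
  have kA : (k \in Aset k2 gamma beta) = false by rewrite inE E ltxx !andbF.
  have kS : k \in Sset k2 gamma beta by rewrite inE kK E eqxx.
  rewrite /limit_term kA kS.
  have r0 : (LF nu k / LF nu k2)^-1 @[nu --> +oo] --> (0 : R).
    apply/(gtr0_cvgV0 (f := fun nu => LF nu k / LF nu k2)) => //.
    by apply: filterS base => nu [f1 _ _]; rewrite divr_gt0 ?LF_gt0.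
  have al : s nu * m nu k @[nu --> +oo] --> (0 : R).
    have c' : A nu k * (LF nu k / LF nu k2)^-1 @[nu --> +oo] --> tau * gamma k * 0.
      by apply: cvgM => //; exact: A_cvg.
    rewrite mulr0 in c'.
    by apply: cvg_near_eq c'; apply: filterS base => nu [f1 _ _]; rewrite aE.
  by have := key _ (lexx 0) al; rewrite mulr0 addr0 divr1 mulrC.
Unshelve. all: by end_near. Qed.

Let Psi := \sum_(k | k != k2) limit_term k.

Lemma laplace_W_limit_term : laplace_W k2 gamma beta tau = (1 + Psi)^-1.
Proof.
rewrite /laplace_W div1r -addrA; congr (_ + _)^-1.
rewrite /Psi /gammaS mulr_sumr.
have Kk k : k \in Kstar k2 gamma -> k != k2 by rewrite inE => /andP[].
rewrite [RHS](bigID (mem (Aset k2 gamma beta)))/=; congr (_ + _).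
  rewrite [RHS](eq_bigl (fun k => k \in Aset k2 gamma beta)); last first.
    move=> k; apply: andb_idl; rewrite inE => /andP[/Kk] //.
  by apply: eq_bigr => k kA; rewrite /limit_term kA.
rewrite [RHS](bigID (mem (Sset k2 gamma beta)))/= [X in _ = _ + X]big1 ?addr0; last first.
  by move=> k /andP[/andP[_ kA] kS]; rewrite /limit_term (negbTE kA) (negbTE kS).
rewrite [RHS](eq_bigl (fun k => k \in Sset k2 gamma beta)); last first.
  move=> k; apply/andP/idP => [[]//|kS]; split=> //.
  move: kS; rewrite !inE => /andP[/andP[-> _] /eqP ->].
  by rewrite ltxx !andbF.
apply: eq_bigr => k kS; rewrite /limit_term kS ifF ?(mulrC tau)//.
by move: kS; rewrite !inE => /andP[_ /eqP ->]; rewrite ltxx !andbF.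
Qed.

Let limit_term_ge0 k : k != k2 -> 0 <= limit_term k.
Proof.
move=> kk2; have gt : 0 <= gamma k * tau by rewrite mulr_ge0// gamma_ge0.
rewrite /limit_term; case: ifPn => [|_]; last by case: ifPn.
rewrite inE => /andP[_ /andP[b0 by_]].
rewrite divr_ge0// addr_ge0// divr_ge0// fine_ge0// ltW//.
Qed.

Let Psi_ge0 : 0 <= Psi. Proof. exact: sumr_ge0. Qed.

(** The holding times at the centre are negligible on the scale [e]. *)
Let s_LF_cvg : s nu / LF nu k2 @[nu --> +oo] --> 0.
Proof.
have c : t * (f k2 nu)^-1 @[nu --> +oo] --> t * 0.
  by apply: cvgM; [exact: cvg_cst|].
rewrite mulr0 in c; apply: cvg0_squeeze c; near=> nu.
have f1 : forall k, 1 <= f k nu by near: nu; exact: near_f_ge1.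
have [e1 _ _] : [/\ 1 <= e nu, m nu k1 <= e nu & M nu <= e nu].
  by near: nu; exact: near_e_ge.
have l0 := LF_gt0 k2 f1; have f0 : 0 < f k2 nu by rewrite (lt_le_trans ltr01).
rewrite divr_ge0 ?(ltW (s_gt0 e1)) ?(ltW l0)//=.
apply: ler_pM.
- exact/ltW/s_gt0.
- by rewrite invr_ge0 ltW.
- by rewrite /s ler_pdivrMr ?ler_peMr//; [exact: ltW | lra].
- by rewrite lef_pV2// /LF ler_peMl ?ler1n// ltW.
Unshelve. all: by end_near. Qed.

Lemma escape_hi_cvg : escape_hi L (F nu) (s nu) k2 @[nu --> +oo] --> Psi.
Proof.
rewrite -[X in _ --> X]add0r.
have c : s nu / LF nu k2 + \sum_(k | k != k2) A nu k / (1 + 1 * (s nu * m nu k))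
    @[nu --> +oo] --> 0 + Psi.
  apply: cvgD => //; apply: cvg_big_sum => k kk2; apply: term_cvg => //.
    by near=> nu.
  exact: cvg_cst.
apply: cvg_near_eq c; near=> nu.
rewrite /escape_hi mulrDl mulr_suml; congr (_ + _); apply: eq_bigr => k _.
by rewrite /drop_hi /A /LF /F mul1r; ring.
Unshelve. all: by end_near. Qed.

Lemma escape_lo_cvg : escape_lo L (F nu) (s nu) k2 @[nu --> +oo] --> Psi.
Proof.
rewrite -[X in _ --> X]add0r.
have c : s nu / LF nu k2 +
    \sum_(k | k != k2) A nu k / (1 + (1 + eps nu k) * (s nu * m nu k))
    @[nu --> +oo] --> 0 + Psi.
  apply: cvgD => //; apply: cvg_big_sum => k kk2; apply: term_cvg => //.
    apply: filterS near_f_ge1 => nu f1; rewrite lerDl; exact: branch_eps_ge0.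
  rewrite -[X in _ --> X]addr0; apply: cvgD; first exact: cvg_cst.
  exact: branch_eps_cvg.
apply: cvg_near_eq c; near=> nu.
rewrite /escape_lo mulrDl mulr_suml; congr (_ + _); apply: eq_bigr => k _.
by rewrite /drop_lo /A /LF /F; ring.
Unshelve. all: by end_near. Qed.

Let ta := t * alpha.
Let ta1 : 1 + ta != 0.
Proof.
by case/andP: alpha_itv => a0 _; rewrite gt_eqF// ltr_wpDr// mulr_ge0// ltW.
Qed.

Lemma drop_hi_cvg : drop_hi L (F nu) (s nu) k1 @[nu --> +oo] --> ta / (1 + ta).
Proof. by apply: cvg_div => //; apply: cvgD => //; exact: cvg_cst. Qed.

Lemma drop_lo_cvg : drop_lo L (F nu) (s nu) k1 @[nu --> +oo] --> ta / (1 + ta).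
Proof.
apply: cvg_div => //; apply: cvgD; first exact: cvg_cst.
have c : (1 + eps nu k1) * (s nu * m nu k1) @[nu --> +oo] --> (1 + 0) * ta.
  apply: cvgM => //; apply: cvgD; [exact: cvg_cst | exact: branch_eps_cvg].
by rewrite addr0 mul1r in c.
Qed.

(** The unknown value [z] at the centre is eliminated through its two bounds, leaving [y] between
    explicit products with the same limit. *)
Lemma asymptotic_laplace (y : R -> R) :
  (\forall nu \near +oo, exists2 z, 0 <= z &
    [/\ (1 - (1 + eps nu k1) * drop_hi L (F nu) (s nu) k1) * z <= y nu <=
          (1 - drop_lo L (F nu) (s nu) k1) * z,
        z * (1 + escape_lo L (F nu) (s nu) k2) <= 1 &
        1 - s nu * C nu <= z * (1 + escape_hi L (F nu) (s nu) k2 * (1 + eps nu k2))]) ->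
  y nu @[nu --> +oo] --> (1 + t * alpha)^-1 * laplace_W k2 gamma beta tau.
Proof.
move=> yz; rewrite laplace_W_limit_term.
have P1 : 1 + Psi != 0 by rewrite gt_eqF// ltr_wpDr.
have dropE : (1 + ta)^-1 = 1 - ta / (1 + ta) by field.
have one_eps k : 1 + eps nu k @[nu --> +oo] --> (1 : R).
  rewrite -[X in _ --> X]addr0; apply: cvgD; first exact: cvg_cst.
  exact: branch_eps_cvg.
have chi : 1 - (1 + eps nu k1) * drop_hi L (F nu) (s nu) k1 @[nu --> +oo] --> (1 + ta)^-1.
  rewrite dropE; apply: cvgB; first exact: cvg_cst.
  by rewrite -[X in _ --> X]mul1r; apply: cvgM => //; exact: drop_hi_cvg.
have clo : 1 - drop_lo L (F nu) (s nu) k1 @[nu --> +oo] --> (1 + ta)^-1.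
  rewrite dropE; apply: cvgB; [exact: cvg_cst | exact: drop_lo_cvg].
have zhi : (1 + escape_lo L (F nu) (s nu) k2)^-1 @[nu --> +oo] --> (1 + Psi)^-1.
  by apply: cvgV => //; apply: cvgD; [exact: cvg_cst | exact: escape_lo_cvg].
have sC : s nu * C nu @[nu --> +oo] --> (0 : R).
  have c : t * C nu @[nu --> +oo] --> t * 0.
    by apply: cvgM; [exact: cvg_cst | exact: target_error_cvg].
  rewrite mulr0 in c; apply: cvg0_squeeze c; near=> nu.
  have f1 : forall k, 1 <= f k nu by near: nu; exact: near_f_ge1.
  have [e1 _ _] : [/\ 1 <= e nu, m nu k1 <= e nu & M nu <= e nu].
    by near: nu; exact: near_e_ge.
  have C0 : 0 <= C nu by rewrite divr_ge0 ?mulr_ge0 ?exprn_ge0// (le_trans ler01).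
  rewrite mulr_ge0// ?(ltW (s_gt0 e1))//= ler_wpM2r//.
  by rewrite /s ler_pdivrMr ?ler_peMr//; [exact: ltW | lra].
have zlo : (1 - s nu * C nu) /
    (1 + escape_hi L (F nu) (s nu) k2 * (1 + eps nu k2)) @[nu --> +oo] --> (1 + Psi)^-1.
  have c : (1 - s nu * C nu) /
      (1 + escape_hi L (F nu) (s nu) k2 * (1 + eps nu k2)) @[nu --> +oo] -->
      (1 - 0) / (1 + Psi * 1).
    apply: cvg_div; first by rewrite mulr1.
      by apply: cvgB => //; exact: cvg_cst.
    apply: cvgD; first exact: cvg_cst.
    apply: cvgM => //; exact: escape_hi_cvg.
  by rewrite subr0 mulr1 div1r in c.
have near_s : \forall nu \near +oo, (forall k, 1 <= f k nu) /\ 0 < s nu.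
  near=> nu; split; first by near: nu; exact: near_f_ge1.
  have [e1 _ _] : [/\ 1 <= e nu, m nu k1 <= e nu & M nu <= e nu].
    by near: nu; exact: near_e_ge.
  exact: s_gt0.
(* The bounds on [z] can be multiplied only by nonnegative factors; these have a positive limit. *)
have lo_ge0 : \forall nu \near +oo, 0 <= 1 - (1 + eps nu k1) * drop_hi L (F nu) (s nu) k1.
  have := chi; move/cvgr_ge; apply.
  by rewrite invr_gt0 lt_def ta1 addr_ge0// mulr_ge0 ?(ltW t_gt0)//; case/andP: alpha_itv.
have up_ge0 : \forall nu \near +oo, 0 <= 1 - drop_lo L (F nu) (s nu) k1.
  have := clo; move/cvgr_ge; apply.
  by rewrite invr_gt0 lt_def ta1 addr_ge0// mulr_ge0 ?(ltW t_gt0)//; case/andP: alpha_itv.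
apply: (@squeeze_cvgr _ _ _ _
  (fun nu => (1 - (1 + eps nu k1) * drop_hi L (F nu) (s nu) k1) * ((1 - s nu * C nu) /
    (1 + escape_hi L (F nu) (s nu) k2 * (1 + eps nu k2))))
  (fun nu => (1 - drop_lo L (F nu) (s nu) k1) *
    (1 + escape_lo L (F nu) (s nu) k2)^-1)).
- near=> nu.
  have [f1 s0] : (forall k, 1 <= f k nu) /\ 0 < s nu by near: nu.
  have lo0 : 0 <= 1 - (1 + eps nu k1) * drop_hi L (F nu) (s nu) k1 by near: nu.
  have up0 : 0 <= 1 - drop_lo L (F nu) (s nu) k1 by near: nu.
  have [z z0 [/andP[y1 y2] z1 z2]] : exists2 z, 0 <= z &
    [/\ (1 - (1 + eps nu k1) * drop_hi L (F nu) (s nu) k1) * z <= y nu <=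
          (1 - drop_lo L (F nu) (s nu) k1) * z,
        z * (1 + escape_lo L (F nu) (s nu) k2) <= 1 &
        1 - s nu * C nu <= z * (1 + escape_hi L (F nu) (s nu) k2 * (1 + eps nu k2))].
    by near: nu.
  have el0 : 0 <= escape_lo L (F nu) (s nu) k2 by exact: escape_lo_ge0.
  have eh0 : 0 <= escape_hi L (F nu) (s nu) k2 by exact: escape_hi_ge0.
  have ep2 : 0 <= eps nu k2 by exact: branch_eps_ge0.
  apply/andP; split.
    apply: le_trans y1; rewrite ler_wpM2l// ler_pdivrMr//.
    by rewrite ltr_wpDr// mulr_ge0// addr_ge0.
  apply: (le_trans y2); rewrite ler_wpM2l// -div1r ler_pdivlMr//.
  by rewrite ltr_wpDr.
- exact: cvgM.
- exact: cvgM.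
Unshelve. all: by end_near. Qed.

End asymptotics.

(** Integer moments of the normalized time are transforms of the hitting time itself; at [t = +oo]
    both sides are 0. *)
Lemma exp_neg_scale (R : realType) (t : \bar R) (e : R) (n : nat) :
  (0 <= t)%E -> 0 < e -> (0 < n)%N ->
  exp_neg (t / e%:E)%E ^+ n = exp_neg ((n%:R / e)%:E * t)%E.
Proof.
move=> t0 e0 n0; rewrite inver gt_eqF//.
case: t t0 => [r| |] // _.
  by rewrite -!EFinM /= -expRM_natl; congr expR; ring.
rewrite gt0_mulye ?lte_fin ?invr_gt0// gt0_muley ?lte_fin ?divr_gt0 ?ltr0n//.
by rewrite /= expr0n gtn_eqF.
Qed.

Theorem theorem3p2 (R : realType) (K : nat) (L : 'I_K -> nat)
    (f : 'I_K -> R -> R)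
    (HL : forall k, (0 < L k)%N)
    (f_ge0 : forall k nu, 0 <= nu -> 0 <= f k nu)
    (f_mono : forall k nu nu', 0 <= nu -> nu <= nu' -> f k nu <= f k nu')
    (f_lim : forall k, f k nu @[nu --> +oo] --> +oo)
    (k1 k2 : 'I_K) (Hk : k1 != k2) (l1 : 'I_(L k1)) (l2 : 'I_(L k2))
    (d : R -> measure_display) (T : forall nu, measurableType (d nu))
    (P : forall nu, probability (T nu) R)
    (X : forall nu, R -> T nu -> state L)
    (X_markov : forall nu, 0 <= nu ->
       markov_process (P nu) (X nu) (rate (fun k => f k nu)))
    (X_start : forall nu, 0 <= nu ->
       P nu [set w | X nu 0 w = at_branch l1] = 1%E)
    (gamma : 'I_K -> R) (beta : 'I_K -> \bar R) (alpha : R)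
    (gamma_itv : forall k, k != k2 -> 0 <= gamma k <= 1)
    (gamma_lim : forall k, k != k2 ->
       f k nu ^+ L k / \sum_(j | j != k2) f j nu ^+ L j
         @[nu --> +oo] --> gamma k)
    (beta_itv : forall k, k \in Kstar k2 gamma -> (0 <= beta k)%E)
    (beta_lim : forall k, k \in Kstar k2 gamma ->
       (((L k)%:R * f k nu) / ((L k2)%:R * f k2 nu))%:E
         @[nu --> +oo] --> beta k)
    (alpha_itv : 0 <= alpha <= 1)
    (alpha_lim :
       ((\int[P nu]_w hitting_time (X nu) None w) /
        (\int[P nu]_w hitting_time (X nu) (at_branch l2) w))%E
         @[nu --> +oo] --> alpha%:E) :
  exists (d' : measure_display) (T' : measurableType d')
         (P' : probability T' R) (Y W Z : {RV P' >-> R}),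
    [/\ has_law Y (exponential_prob 1),
        forall s : R, 0 <= s -> ('M_P' W (- s))%E = (laplace_W k2 gamma beta s)%:E,
        independent_RV Y W,
        forall w, Z w = alpha * Y w + (1 - alpha) * W w &
        cvg_in_distribution P
          (fun nu w => (hitting_time (X nu) (at_branch l2) w /
             \int[P nu]_w' hitting_time (X nu) (at_branch l2) w')%E) Z].
Proof.
have [d' [T' [P' [Y [W [Z [Z0 [[Ylaw Wlap YW ZE] [mZ0 Z00 ZZ0 Zmom]]]]]]]]] :=
  limit_variables (laplace_law_laplace_W k2 gamma beta) alpha_itv.
exists d', T', P', Y, W, Z; split => //.
pose F nu k := f k nu.
(* The expectations are known to be finite only once all rates are at least 1, so [fine] is faithful
   for large [nu], which is enough for the limits. *)
pose e0 nu := fine (\int[P nu]_w hitting_time (X nu) None w).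
pose e nu := fine (\int[P nu]_w hitting_time (X nu) (at_branch l2) w).
have near_ok : \forall nu \near +oo, 0 <= nu /\ forall k, 1 <= f k nu.
  near=> nu; split; first by near: nu; exact: nbhs_pinfty_ge.
  by near: nu; exact: near_f_ge1.
have fin_centre nu : 0 <= nu -> (forall k, 1 <= f k nu) ->
    (\int[P nu]_w hitting_time (X nu) None w)%E = (e0 nu)%:E.
  move=> nu0 f1; rewrite fineK//.
  have [h1 h2] := expectation_centre HL f1 (X_markov nu nu0) (X_start nu nu0).
  rewrite ge0_fin_numE ?(le_lt_trans h2) ?ltry//.
  by apply: integral_ge0 => w _; exact: hitting_time_ge0.
have fin_target nu : 0 <= nu -> (forall k, 1 <= f k nu) ->
    (\int[P nu]_w hitting_time (X nu) (at_branch l2) w)%E = (e nu)%:E.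
  move=> nu0 f1; rewrite fineK//.
  have [h1 h2] := expectation_target HL f1 (X_markov nu nu0) (X_start nu nu0) l2 Hk.
  rewrite ge0_fin_numE ?(le_lt_trans h2) ?ltry//.
  by apply: integral_ge0 => w _; exact: hitting_time_ge0.
have e0_bounds : \forall nu \near +oo,
    branch_mean (L k1) (f k1 nu) <= e0 nu <=
    (1 + branch_eps (L k1) (f k1 nu)) * branch_mean (L k1) (f k1 nu).
  apply: filterS near_ok => nu [nu0 f1].
  have [h1 h2] := expectation_centre HL f1 (X_markov nu nu0) (X_start nu nu0).
  by rewrite fin_centre// !lee_fin in h1 h2; rewrite h1 h2.
have e_bounds : \forall nu \near +oo,
    branch_mean (L k1) (f k1 nu) + escape_mean L (F nu) k2 <= e nu <=
    (1 + branch_eps (L k1) (f k1 nu)) * branch_mean (L k1) (f k1 nu) +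
    (1 + branch_eps (L k2) (f k2 nu)) * escape_mean L (F nu) k2 +
    target_error (L k2) (f k2 nu).
  apply: filterS near_ok => nu [nu0 f1].
  have [h1 h2] := expectation_target HL f1 (X_markov nu nu0) (X_start nu nu0) l2 Hk.
  by rewrite fin_target// !lee_fin in h1 h2; rewrite h1 h2.
have near_e : \forall nu \near +oo, 1 <= e nu.
  by apply: filterS (near_e_ge HL f_lim e_bounds) => nu [].
have alpha_lim' : e0 nu / e nu @[nu --> +oo] --> alpha.
  have [_ c] := (fine_cvgP _ _).1 alpha_lim.
  apply: cvg_near_eq c; near=> nu.
  have [nu0 f1] : 0 <= nu /\ forall k, 1 <= f k nu by near: nu.
  have e1 : 1 <= e nu by near: nu.
  have en : e nu != 0 by rewrite gt_eqF// (lt_le_trans ltr01).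
  by rewrite /= fin_centre// fin_target// inver (negbTE en).
have gamma_ge0 k : k != k2 -> 0 <= gamma k by move=> /gamma_itv /andP[].
apply: (cvg_in_distribution_exp_neg (Z := Z0)) => //.
- move=> nu nu0.
  have mT := measurable_hitting_time (at_branch l2) (X_markov nu nu0).
  exact: emeasurable_funM.
- move=> nu w; apply: mule_ge0; first exact: hitting_time_ge0.
  by rewrite inve_ge0; apply: integral_ge0 => w' _; exact: hitting_time_ge0.
(* The moment of order 0 is 1 on both sides; it is separated because the transform is computed at
   positive arguments only. *)
- case=> [|n].
    under eq_fun do under eq_Rintegral do rewrite expr0.
    under eq_Rintegral do rewrite expr0.
    rewrite Rintegral_cst1; under eq_fun do rewrite Rintegral_cst1.
    exact: cvg_cst.
  rewrite Zmom.
  have t0 : 0 < n.+1%:R :> R by rewrite ltr0n.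
  apply: (@cvg_near_eq _ _ _ _ (fun nu => \int[P nu]_w
    exp_neg ((n.+1%:R / e nu)%:E * hitting_time (X nu) (at_branch l2) w))).
    near=> nu.
    have [nu0 f1] : 0 <= nu /\ forall k, 1 <= f k nu by near: nu.
    have e1 : 1 <= e nu by near: nu.
    apply: eq_Rintegral => w _; rewrite fin_target//; apply/esym.
    apply: exp_neg_scale => //; first exact: hitting_time_ge0.
    exact: lt_le_trans ltr01 e1.
  apply: (asymptotic_laplace HL f_lim Hk gamma_ge0 gamma_lim beta_itv beta_lim
    alpha_itv e0_bounds e_bounds alpha_lim' t0).
  near=> nu.
  have [nu0 f1] : 0 <= nu /\ forall k, 1 <= f k nu by near: nu.
  have e1 : 1 <= e nu by near: nu.
  apply: (laplace_target HL f1 (X_markov nu nu0) (X_start nu nu0) l2 Hk).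
  by rewrite divr_gt0// (lt_le_trans ltr01).
Unshelve. all: by end_near. Qed.
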